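(* Let $d\ge 1$, $k\ge 1$ be fixed integers, $p\in[1,\infty]$, $\delta>0$ fixed, and let $X$ be a random variable in $\mathbb{R}^d$ whose density $f$ satisfies Assumption A (see context). Then the mean squared error of the truncated KL entropy estimator using $N$ i.i.d. samples satisfies, as $N\to\infty$, $$\mathbb{E}\Big[\big(\widehat{H}_{\rm tKL}(X)-H(X)\big)^2\Big]=O\left(\frac{(\log N)^{(1+\delta)(2+2/d)}}{N^{2/d}}+\frac{(\log\log N)^2(\log N)^{(2k+2)(1+\delta)}}{N}\right).$$
   Context: $H(X)=-\int f\log f$ is the differential entropy. Assumption A: there exist finite positive constants $C_a,C_b,C_c,C_d,C_e,C_0$ such that (a) $f(x)\le C_a$ almost everywhere; (b) there is $\gamma>0$ with $\int f(x)|\log f(x)|^{1+\gamma}dx\le C_b$; (c) $\int f(x)\exp\{-b f(x)\}dx\le C_c e^{-C_0 b}$ for all $b>1$; (d) for almost every $x$, $f$ is twice continuously differentiable at $x$ and its Hessian $H_f$ satisfies $\|H_f(x)\|_2<C_d$; (e) the set of points violating (d), i.e. $\{x:\|H_f(x)\|_2\ge C_d\}$ (points where $f$ is not twice continuously differentiable included), has $(d-1)$-dimensional Hausdorff measure less than $C_e$. Truncated KL estimator: $X_1,\dots,X_N$ are i.i.d. with density $f$; $\rho_{k,i,p}$ is the $\ell_p$ distance from $X_i$ to its $k$-th nearest neighbor among the other samples; $c_{d,p}$ is the volume of the unit $\ell_p$ ball in $\mathbb{R}^d$; $\psi$ is the digamma function; $a_N=\big((\log N)^{1+\delta}/N\big)^{1/d}$.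 Set $\xi_{k,i,p}(X)=-\psi(k)+\log N+\log c_{d,p}+d\log\rho_{k,i,p}$ if $\rho_{k,i,p}\le a_N$, and $\xi_{k,i,p}(X)=0$ if $\rho_{k,i,p}>a_N$. Then $\widehat{H}_{\rm tKL}(X)=\frac1N\sum_{i=1}^N\xi_{k,i,p}(X)$. *)

(* Defs.v *)
From HB Require Import structures.
From mathcomp Require Import all_boot all_order all_algebra.
From mathcomp Require Import all_classical all_reals all_analysis.

Set Implicit Arguments.
Unset Strict Implicit.
Unset Printing Implicit Defensive.

Import Order.TTheory GRing.Theory Num.Theory.
Import numFieldNormedType.Exports.

Local Open Scope classical_set_scope.
Local Open Scope ring_scope.

Definition rV_display : measure_display.
Proof. exact: default_measure_display. Qed.

(* The sigma-algebra on R^d generated by the coordinate functions coincides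
   with the Borel sigma-algebra. *)

Section measurable_rV.
Context {R : realType} {d : nat}.

Let coord : 'I_d -> 'rV[R]_d -> R := fun i v => v ord0 i.

Let rV_set0 : g_sigma_preimage coord set0.
Proof. exact: sigma_algebra0. Qed.

Let rV_setC A : g_sigma_preimage coord A -> g_sigma_preimage coord (~` A).
Proof. exact: sigma_algebraC. Qed.

Let rV_bigcup (F : (set 'rV[R]_d)^nat) :
  (forall i, g_sigma_preimage coord (F i)) ->
  g_sigma_preimage coord (\bigcup_i (F i)).
Proof. exact: sigma_algebra_bigcup. Qed.

HB.instance Definition _ := @isMeasurable.Build rV_display
  'rV[R]_d (g_sigma_preimage coord) rV_set0 rV_setC rV_bigcup.

End measurable_rV.

Lemma measurable_coord (R : realType) (d : nat) (i : 'I_d) :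
  measurable_fun [set: 'rV[R]_d] (fun v : 'rV[R]_d => v ord0 i).
Proof.
move=> _ Y mY; rewrite setTI; apply: sub_sigma_algebra => /=.
rewrite -bigcup_seq/=; exists i => /=; first by rewrite mem_index_enum.
by exists Y => //; rewrite setTI.
Qed.

Lemma measurable_fun_rVP (R : realType) (d : nat) d0 (T : measurableType d0)
    (f : T -> 'rV[R]_d) :
  measurable_fun [set: T] f <->
  forall i, measurable_fun [set: T] (fun t => f t ord0 i).
Proof.
split=> [mf i|mf].
  exact: (measurableT_comp (measurable_coord i) mf).
apply: (@measurability _ _ _ _ _ _ (\big[setU/set0]_(i < d)
  preimage_set_system setT (fun v : 'rV[R]_d => v ord0 i) measurable)) => //.
move=> _ [A + <-]; rewrite -bigcup_seq/= => -[i _ [Y mY <-]].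
by rewrite !setTI -comp_preimage -[X in measurable X]setTI; exact: mf.
Qed.

Section rV_cons.
Context (R : realType) (n : nat).

Definition rV_cons (u : R * 'rV[R]_n) : 'rV[R]_n.+1 :=
  row_mx (u.1%:M : 'rV[R]_1) u.2.

Let rV_uncons (v : 'rV[R]_(1 + n)) : R * 'rV[R]_n := (v ord0 ord0, rsubmx v).

Lemma measurable_rV_cons : measurable_fun setT rV_cons.
Proof.
apply/measurable_fun_rVP => i.
case: (split_ordP (i : 'I_(1 + n))) => j ij.
  rewrite (_ : (fun _ => _) = fst) //; apply/funext => u.
  rewrite ij; transitivity ((u.1%:M : 'rV[R]_1) ord0 j); first exact: row_mxEl.
  by rewrite (ord1 j) mxE eqxx mulr1n.
rewrite (_ : (fun _ => _) = (fun v : 'rV[R]_n => v ord0 j) \o snd).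
  by apply: measurableT_comp => //; exact: measurable_coord.
by apply/funext => u; rewrite ij; exact: row_mxEr.
Qed.

Lemma rV_cons0 u : rV_cons u ord0 ord0 = u.1.
Proof.
transitivity (row_mx (u.1%:M : 'rV[R]_1) u.2 ord0 (lshift n (ord0 : 'I_1))).
  by rewrite /rV_cons; congr (fun_of_matrix _ _ _); exact: val_inj.
by rewrite row_mxEl mxE eqxx mulr1n.
Qed.

Lemma rV_consS u i : rV_cons u ord0 (lift ord0 i) = u.2 ord0 i.
Proof.
transitivity (row_mx (u.1%:M : 'rV[R]_1) u.2 ord0 (rshift 1 i)).
  by rewrite /rV_cons; congr (fun_of_matrix _ _ _); exact: val_inj.
by rewrite row_mxEr.
Qed.

Let measurable_rV_uncons : measurable_fun setT rV_uncons.
Proof.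
apply/measurable_fun_pairP; split; first exact: measurable_coord.
apply/measurable_fun_rVP => i.
rewrite (_ : (fun _ => _) = (fun v : 'rV[R]_(1 + n) => v ord0 (rshift 1 i))).
  exact: measurable_coord.
by apply/funext => u; rewrite /rV_uncons /= mxE.
Qed.

Let rV_consK : cancel rV_cons rV_uncons.
Proof.
move=> [x v]; rewrite /rV_uncons /rV_cons row_mxKr; congr pair.
rewrite (_ : ord0 = lshift n (ord0 : 'I_1)); last exact: val_inj.
by rewrite row_mxEl mxE eqxx mulr1n.
Qed.

(* The image on R^(1 + n) of the product of lebesgue_measure with mu. *)
Variable mu : {sigma_finite_measure set 'rV[R]_n -> \bar R}.

Definition rV_step : set 'rV[R]_n.+1 -> \bar R :=
  pushforward (lebesgue_measure \x mu)%E rV_cons.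

Let rV_step0 : rV_step set0 = 0%E.
Proof. by rewrite /rV_step /pushforward preimage_set0 measure0. Qed.

Let rV_step_ge0 A : (0 <= rV_step A)%E.
Proof. exact: (@measure_ge0 _ _ _ (lebesgue_measure \x mu)%E). Qed.

Let rV_step_sigma_additive : semi_sigma_additive rV_step.
Proof.
move=> F mF tF mUF; rewrite /rV_step /pushforward preimage_bigcup.
have mpre A : measurable A -> measurable (rV_cons @^-1` A).
  by move=> mA; rewrite -[X in measurable X]setTI; exact: measurable_rV_cons.
apply: measure_semi_sigma_additive.
- by move=> m; exact: mpre.
- apply/trivIsetP => /= i j _ _ ij; rewrite -preimage_setI.
  by move/trivIsetP : tF => /(_ _ _ _ _ ij) ->//; rewrite preimage_set0.
- by rewrite -preimage_bigcup; exact: mpre.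
Qed.

HB.instance Definition _ := isMeasure.Build _ _ _ rV_step
  rV_step0 rV_step_ge0 rV_step_sigma_additive.

Let rV_step_sigma_finite : sigma_finite setT rV_step.
Proof.
have /sigma_finiteP[F [TF ndF Foo]] := sigma_finiteT mu.
have /sigma_finiteP[G [TG ndG Goo]] :=
  sigma_finiteT (@lebesgue_measure R).
exists (fun k => rV_uncons @^-1` (G k `*` F k)).
  apply/esym; rewrite -subTset => v _.
  have [i _ Gi] : (\bigcup_i G i) (rV_uncons v).1 by rewrite -TG.
  have [j _ Fj] : (\bigcup_i F i) (rV_uncons v).2 by rewrite -TF.
  exists (maxn i j) => //; split => /=.
    by move: Gi; apply/subsetPset/ndG/leq_maxl.
  by move: Fj; apply/subsetPset/ndF/leq_maxr.
move=> k; have [mG Gk] := Goo k; have [mF Fk] := Foo k; split.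
  by rewrite -[X in measurable X]setTI; apply: measurable_rV_uncons => //;
    exact: measurableX.
rewrite /rV_step /pushforward -comp_preimage.
rewrite (_ : rV_uncons \o rV_cons = id); last exact/funext/rV_consK.
by rewrite preimage_id product_measure1E// lte_mul_pinfty// ge0_fin_numE.
Qed.

HB.instance Definition _ := Measure_isSigmaFinite.Build _ _ _ rV_step
  rV_step_sigma_finite.

End rV_cons.

Fixpoint lebesgue_rV (R : realType) (d : nat) :
    {sigma_finite_measure set 'rV[R]_d -> \bar R} :=
  match d with
  | 0 => \d_(0 : 'rV[R]_0)
  | n.+1 => rV_step (lebesgue_rV R n)
  end.

Lemma lebesgue_rV_box (R : realType) (d : nat) (A : 'I_d -> set R) :
  (forall i, measurable (A i)) ->
  lebesgue_rV R d [set v | forall i, A i (v ord0 i)] =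
    (\prod_(i < d) lebesgue_measure (A i))%E.
Proof.
elim: d A => [|d IH] A mA.
  by rewrite big_ord0 /= diracE mem_set //= => -[].
pose B := [set v : 'rV[R]_d | forall i, A (lift ord0 i) (v ord0 i)].
have mB : measurable B.
  rewrite (_ : B = \bigcap_(i in [set: 'I_d])
      ((fun v : 'rV[R]_d => v ord0 i) @^-1` A (lift ord0 i))).
    apply: fin_bigcap_measurable => // i _.
    by rewrite -[X in measurable X]setTI; exact: measurable_coord.
  by apply/seteqP; split => v h i; [move=> _; exact: h|exact: (h i I)].
rewrite big_ord_recl -(IH (fun i => A (lift ord0 i)))//.
transitivity ((lebesgue_measure \x lebesgue_rV R d)%E (A ord0 `*` B)).
  apply: (f_equal (lebesgue_measure \x lebesgue_rV R d)%E).
  apply/seteqP; split => -[x v] /=.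
    move=> h; split => [|i] /=; first by move: (h ord0); rewrite rV_cons0.
    by move: (h (lift ord0 i)); rewrite rV_consS.
  move=> [/= hx hv] i; case: (unliftP ord0 i) => [j|] ->.
    by rewrite rV_consS; exact: hv.
  by rewrite rV_cons0.
by rewrite product_measure1E//; exact: mA.
Qed.

Section differential_entropy.
Context (R : realType) (d : nat).
Implicit Types (f : 'rV[R]_d -> R) (v x : 'rV[R]_d) (A U : set 'rV[R]_d).

Local Notation leb := (lebesgue_rV R d).

Definition is_density f :=
  [/\ measurable_fun setT f, (forall x, 0 <= f x)
    & (\int[leb]_x (f x)%:E = 1)%E].

(* ln 0 = 0, so that the integrand vanishes where f does. *)
Definition entropy f : R := - \int[leb]_x (f x * ln (f x)).

Definition enorm v : R := Num.sqrt (\sum_(i < d) v ord0 i ^+ 2).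

(* The l_p norm, for 1 <= p <= +oo; the value at -oo is never used. *)
Definition lp_norm (p : \bar R) v : R :=
  match p with
  | q%:E => (\sum_(i < d) `|v ord0 i| `^ q) `^ q^-1
  | +oo%E => \big[Order.max/0]_(i < d) `|v ord0 i|
  | -oo%E => 0
  end.

(* leb takes finite values on l_p balls. *)
Definition unit_ball_volume (p : \bar R) : R :=
  fine (leb [set v | lp_norm p v <= 1]).

Definition partial (i : 'I_d) f : 'rV[R]_d -> R := 'D_(delta_mx ord0 i) f.

Definition hessian f x : 'M[R]_d :=
  \matrix_(i, j) partial j (partial i f) x.

Definition spectral_norm (M : 'M[R]_d) : R :=
  sup [set enorm (v *m M) | v in [set v | enorm v <= 1]].

(* f is twice differentiable around x and its Hessian is continuous at x. *)
Definition twice_continuously_differentiable_at f x :=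
  (\forall y \near x,
     differentiable f y /\ forall i, differentiable (partial i f) y) /\
  forall i j, {for x, continuous (partial j (partial i f))}.

(* The contribution (diam U)^s of U to a cover; the empty set contributes 0
   even for s = 0. It is only used for bounded U, where the supremum of a
   nonempty set of distances is the diameter. *)
Definition hausdorff_weight (s : nat) U : R :=
  sup [set enorm (u.1 - u.2) | u in U `*` U] ^+ s * (U != set0)%:R.

Definition hausdorff_content (s : nat) (e : R) A : \bar R :=
  ereal_inf [set (\sum_(0 <= n <oo) (hausdorff_weight s (U n))%:E)%E
            | U in [set U : (set 'rV[R]_d)^nat |
                A `<=` \bigcup_n U n /\
                forall n x y, U n x -> U n y -> enorm (x - y) <= e]].

(* Without the normalizing factor that makes it agree with Lebesgue measure. *)
Definition hausdorff_measure (s : nat) A : \bar R :=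
  ereal_sup [set hausdorff_content s e A | e in [set e : R | 0 < e]].

Definition assumption_A f :=
  exists Ca Cb Cc Cd Ce C0 : R,
    [/\ 0 < Ca, 0 < Cb, 0 < Cc & [/\ 0 < Cd, 0 < Ce & 0 < C0]] /\
    let regular x :=
      twice_continuously_differentiable_at f x /\
      spectral_norm (hessian f x) < Cd in
    [/\ {ae leb, forall x, f x <= Ca},
       exists2 g : R, 0 < g &
         (\int[leb]_x (f x * `|ln (f x)| `^ (1 + g))%:E <= Cb%:E)%E,
       forall b : R, 1 < b ->
         (\int[leb]_x (f x * expR (- (b * f x)))%:E
            <= (Cc * expR (- (C0 * b)))%:E)%E,
       {ae leb, forall x, regular x} &
       (hausdorff_measure d.-1 [set x | ~ regular x] < Ce%:E)%E].

(* The X i are mutually independent with common density f. *)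
Definition iid_sample d0 (T : measurableType d0) (P : probability T R)
    (N : nat) (X : 'I_N -> {RV P >-> 'rV[R]_d}) f :=
  (forall (J : {set 'I_N}) (A : 'I_N -> set 'rV[R]_d),
     (forall i, measurable (A i)) ->
     P (\bigcap_(i in [set i | i \in J]) (X i @^-1` A i)) =
     \big[*%E/1%E]_(i in J) P (X i @^-1` A i)) /\
  (forall i A, measurable A ->
     distribution P (X i) A = (\int[leb]_(x in A) (f x)%:E)%E).

End differential_entropy.

Definition Gamma (R : realType) (x : R) : R :=
  \int[lebesgue_measure]_(t in `]0, +oo[) (t `^ (x - 1) * expR (- t)).

Definition digamma (R : realType) (x : R) : R :=
  derive1 (@Gamma R) x / Gamma x.

Section truncated_KL.
Context (R : realType) (d : nat).
Variables (k : nat) (p : \bar R) (delta : R).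

(* The k-th smallest distance from x i to the other points (k >= 1), with a
   junk value 0 if there are fewer than k of them. *)
Definition knn_dist (N : nat) (x : 'I_N -> 'rV[R]_d) (i : 'I_N) : R :=
  nth 0 (sort <=%R [seq lp_norm p (x j - x i) | j <- enum 'I_N & j != i]) k.-1.

Definition truncation_radius (N : nat) : R :=
  (ln N%:R `^ (1 + delta) / N%:R) `^ d%:R^-1.

Definition tKL_term (N : nat) (x : 'I_N -> 'rV[R]_d) (i : 'I_N) : R :=
  let rho := knn_dist x i in
  if rho <= truncation_radius N then
    - digamma k%:R + ln N%:R + ln (unit_ball_volume d p) + d%:R * ln rho
  else 0.

Definition tKL (N : nat) (x : 'I_N -> 'rV[R]_d) : R :=
  N%:R^-1 * \sum_(i < N) tKL_term x i.

Definition tKL_rate (N : nat) : R :=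
  ln N%:R `^ ((1 + delta) * (2 + 2 / d%:R)) / N%:R `^ (2 / d%:R) +
  ln (ln N%:R) ^+ 2 * ln N%:R `^ ((2 * k + 2)%:R * (1 + delta)) / N%:R.

End truncated_KL.

(* Main.v *)
Require Import Defs.
From HB Require Import structures.
From mathcomp Require Import all_boot all_order all_algebra.
From mathcomp Require Import all_classical all_reals all_analysis.
From mathcomp Require Import measurable_realfun ring lra.

(** The variable tau_i = N c rho_i^d attached to the k-th nearest neighbour
    distance rho_i is compared with U / f(X), where U has the Gamma law with
    parameter k: by the digamma formula E ln U = psi(k), the mean of
    ln (U / f(X)) - psi(k) is H(X).

    Replacing ln tau_i by ln (max tau_i (1/N)) costs O(1/N) in mean square and
    bounds every summand by a multiple of ln N. Since the k-th neighbour is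
    ignored beyond the truncation radius a, resampling one point changes only
    the terms of the points within distance a of it, so the Efron-Stein
    inequality bounds the variance.

    For the bias, the layer-cake formula expresses the mean of the truncated
    logarithm through the distribution function P(tau_i <= t). Given X_i = x,
    this is a binomial tail with parameter the mass of the ball of radius
    r(t) about x, which Le Cam's argument replaces by a Poisson tail, and the
    Poisson tail with parameter f(x) t is the distribution function of
    U / f(x). The error depends on the L1 distance between ball averages of f
    and f, which Assumption A bounds by K r (1 + ln (1/r)): f is bounded, is
    either 0 or at least C0, and increments of length r are controlled by the
    Hessian except on lines meeting a set of finite (d-1)-dimensional measure,
    where a dyadic induction on r produces the logarithm. *)

Set Implicit Arguments.
Unset Strict Implicit.
Unset Printing Implicit Defensive.

Import Order.TTheory GRing.Theory Num.Theory.
Import numFieldNormedType.Exports.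

Local Open Scope classical_set_scope.
Local Open Scope ring_scope.

(** * Balls of the l_p norm *)

(** Truncation at both ends is what makes the tools apply. The lower level 1/N bounds every term by
    O(ln N), keeps the layer-cake weight ds/s finite and makes ln (1/r) of order ln N uniformly; it
    is low enough that two given points so close have probability O(N^-2). The upper level T = c (ln
    N)^(1+delta) caps the expected number of neighbours, yet C0 T >= ln N for large N, so that U /
    f(X) > T forces U >= ln N, an event paid for by a factor N^(-1/2). The lower bound C0 thus
    enters there, and also in bounding the volume of the support, over which increments of order r
    are integrated. The comparison of Poisson tails must not cost 1/f(x): it is relative to the mean
    f(x) t, and this denominator is cancelled by the weight f(x) of the law of X_i, which leaves an
    unweighted L1 distance. The bias is then of order a ln N ln ln N plus smaller terms, and delta >
    0 absorbs the ln ln N. The variance is of order (ln N)^2 T^2 / N, within the announced power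
    since 2k + 2 >= 4. *)

Section lp_norm.
Context {R : realType} {d : nat}.
Implicit Types (p : \bar R) (v : 'rV[R]_d).

Lemma lp_norm_ge0 p v : 0 <= lp_norm p v.
Proof.
case: p => [q| |] //=; first exact: powR_ge0.
by apply: (big_ind (fun x => 0 <= x)) => // x y x0 y0; rewrite le_max x0.
Qed.

Lemma ler_coord_lp_norm p v i : (1 <= p)%E -> `|v ord0 i| <= lp_norm p v.
Proof.
case: p => [q| |] //=.
- rewrite lee_fin => q1; have q0 : 0 < q by apply: lt_le_trans q1.
  rewrite -[leLHS]powRr1 // -[X in _ `^ X](@divff _ q) ?gt_eqF // powRrM.
  apply: ge0_ler_powR; rewrite ?nnegrE ?powR_ge0 //.
  - by rewrite invr_ge0 ltW.
  - by apply: sumr_ge0 => j _; exact: powR_ge0.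
  by rewrite (bigD1 i) //= lerDl sumr_ge0 // => j _; exact: powR_ge0.
- by move=> _; rewrite (bigD1 i) //= le_max lexx.
Qed.

(** The factor d is crude, as d^(1/p) <= d. The bound serves to inscribe a cube in the unit ball,
    whose volume is therefore positive. *)
Lemma lp_norm_le_max p v (m : R) : (1 <= p)%E -> 0 <= m ->
  (forall i, `|v ord0 i| <= m) -> lp_norm p v <= d%:R * m.
Proof.
case: d v => [|n] v.
  move=> p1 m0 _; rewrite mul0r; case: p p1 => [q| |] //=.
    rewrite lee_fin => q1; rewrite big_ord0 powR0 //.
    by rewrite invr_eq0 gt_eqF // (lt_le_trans _ q1).
  by rewrite big_ord0.
case: p => [q| |] //=.
- rewrite lee_fin => q1 m0 vm; have q0 : 0 < q by apply: lt_le_trans q1.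
  have h : \sum_(i < n.+1) `|v ord0 i| `^ q <= n.+1%:R * m `^ q.
    rewrite mulr_natl -[X in _ *+ X]card_ord -sumr_const.
    by apply: ler_sum => i _; apply: ge0_ler_powR; rewrite ?nnegrE // ltW.
  apply: le_trans (ge0_ler_powR _ _ _ h) _; rewrite ?nnegrE //.
  - by rewrite invr_ge0 ltW.
  - by apply: sumr_ge0 => i _; exact: powR_ge0.
  - by rewrite mulr_ge0 ?powR_ge0.
  rewrite powRM ?powR_ge0 // -powRrM divff ?gt_eqF // powRr1 //.
  apply: ler_wpM2r => //; rewrite -[leRHS]powRr1 //; apply: ler_powR.
    by rewrite ler1n.
  by rewrite invf_le1.
- move=> _ m0 vm; apply: (@le_trans _ _ m).
    by apply/bigmax_leP.
  by rewrite ler_peMl // ler1n.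
Qed.

Lemma lp_normZ p r v : (1 <= p)%E -> lp_norm p (r *: v) = `|r| * lp_norm p v.
Proof.
case: p => [q| |] //=.
- rewrite lee_fin => q1; have q0 : 0 < q by apply: lt_le_trans q1.
  under eq_bigr do rewrite mxE normrM powRM //.
  rewrite -mulr_sumr powRM ?powR_ge0 //; last first.
    by apply: sumr_ge0 => i _; exact: powR_ge0.
  by rewrite -powRrM divff ?gt_eqF // powRr1.
- move=> _; under eq_bigr do rewrite mxE normrM.
  apply: (big_rec2 (fun x y => x = `|r| * y)); first by rewrite mulr0.
  by move=> i x y _ ->; rewrite maxr_pMr.
Qed.

Lemma lp_normN p v : (1 <= p)%E -> lp_norm p (- v) = lp_norm p v.
Proof. by move=> p1; rewrite -scaleN1r lp_normZ // normrN1 mul1r. Qed.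

Lemma measurable_lp_norm p : measurable_fun setT (@lp_norm R d p).
Proof.
have mnorm i : measurable_fun setT (fun v : 'rV[R]_d => `|v ord0 i|).
  exact: measurableT_comp (measurable_coord i).
case: p => [q| |] /=.
- apply: (measurableT_comp (measurable_powR q^-1)).
  apply: measurable_sum => i.
  exact: (measurableT_comp (measurable_powR q)).
- rewrite /lp_norm /index_enum; elim: (Finite.enum _) => [|i s IH].
    by under eq_fun do rewrite big_nil; exact: measurable_cst.
  by under eq_fun do rewrite big_cons; exact: measurable_maxr.
- exact: measurable_cst.
Qed.

End lp_norm.

Section image_measure.
Context d d' (T : measurableType d) (T' : measurableType d') (R : realType).

Definition image_measure (m : {measure set T -> \bar R}) (g : T -> T')
    (mg : measurable_fun setT g) : {measure set T' -> \bar R} :=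
  measure_function_pushforward__canonical__measure_function_Measure m mg.

Lemma image_measureE (m : {measure set T -> \bar R}) (g : T -> T')
    (mg : measurable_fun setT g) A : image_measure m mg A = m (g @^-1` A).
Proof. by []. Qed.

Lemma ge0_integral_image_measure (m : {measure set T -> \bar R}) (g : T -> T')
    (mg : measurable_fun setT g) (h : T' -> \bar R) :
  measurable_fun setT h -> (forall y, (0 <= h y)%E) ->
  (\int[image_measure m mg]_y h y = \int[m]_x h (g x))%E.
Proof. by move=> mh h0; rewrite [LHS]ge0_integral_pushforward. Qed.

End image_measure.

Section boxes.

(** Boxes are closed under intersection, unlike the one-coordinate cylinders that define the
    sigma-algebra, and uniqueness of measures demands such a generating family. The coordinates [c]
    are abstract so that row vectors and tuples are both covered. *)
Lemma g_sigma_preimage_box (T : pointedType) d (T' : measurableType d) n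
    (c : 'I_n -> T -> T') :
  g_sigma_preimage c = <<s [set B | exists A : 'I_n -> set T',
     (forall i, measurable (A i)) /\ B = [set v | forall i, A i (c i v)]] >>.
Proof.
apply/seteqP; split.
  apply: smallest_sub; first exact: smallest_sigma_algebra.
  rewrite -bigcup_seq => _ /= [i _ [Y mY <-]].
  apply: sub_sigma_algebra => /=.
  exists (fun j => if j == i then Y else setT); split.
    by move=> j; case: ifP.
  rewrite setTI; apply/seteqP; split=> v /=.
    by move=> Yv j; case: eqP => // ->.
  by move=> /(_ i); rewrite eqxx.
apply: smallest_sub; first exact: smallest_sigma_algebra.
move=> _ [A [mA ->]].
(* A generated sigma-algebra provides complements and countable unions, so the finite intersection
   is rewritten with these; indices outside ['I_n] contribute the empty set. *)
rewrite (_ : [set _ | _] = ~` \bigcup_k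
   (if insub k is Some i then ~` (c i @^-1` A i) else set0)); last first.
  rewrite setC_bigcup; apply/seteqP; split => v h.
    move=> k _; case: insubP => [i _ _|_] /=; last by move=> [].
    by move=> /(_ (h i)).
  move=> i; have := h i I; rewrite /= valK /= => /contrapT; exact.
apply: sigma_algebraC; apply: sigma_algebra_bigcup => k.
case: insubP => [i _ _|_]; last exact: sigma_algebra0.
apply: sigma_algebraC; apply: sub_sigma_algebra.
rewrite -bigcup_seq/=; exists i => /=; first by rewrite mem_index_enum.
by exists (A i) => //; rewrite setTI.
Qed.

Lemma eq_measure_box d (T : measurableType d) d' (T' : measurableType d') n
    (c : 'I_n -> T -> T') (R : realType) (m1 m2 : {measure set T -> \bar R})
    (G : nat -> 'I_n -> set T') :
  @measurable d T = g_sigma_preimage c ->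
  (forall A : 'I_n -> set T', (forall i, measurable (A i)) ->
     m1 [set v | forall i, A i (c i v)] = m2 [set v | forall i, A i (c i v)]) ->
  (forall k i, measurable (G k i)) ->
  \bigcup_k [set v | forall i, G k i (c i v)] = setT ->
  (forall k, (m1 [set v | forall i, G k i (c i v)] < +oo)%E) ->
  forall A, measurable A -> m1 A = m2 A.
Proof.
move=> mE m12 mG coverG finG A mA.
rewrite g_sigma_preimage_box in mE.
apply: (measure_unique _ (fun k => [set v | forall i, G k i (c i v)]) mE) => //.
- move=> _ _ [A1 [mA1 ->]] [A2 [mA2 ->]].
  exists (fun i => A1 i `&` A2 i); split; first by move=> i; exact: measurableI.
  apply/seteqP; split=> v /=; first by move=> [h1 h2] i; split.
  by move=> h; split=> i; have [] := h i.
- by move=> k; exists (G k).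
- by move=> _ [B [mB ->]]; exact: m12.
Qed.

End boxes.

Section lebesgue_rV.
Context {R : realType} {d : nat}.
Local Notation leb := (lebesgue_rV R d).

Lemma lebesgue_rV_boxE (A : 'I_d -> set R) (B : set 'rV[R]_d) :
  (forall i, measurable (A i)) -> (forall v, B v <-> forall i, A i (v ord0 i)) ->
  leb B = (\prod_(i < d) lebesgue_measure (A i))%E.
Proof.
move=> mA BE; rewrite -(lebesgue_rV_box mA); congr (leb _).
by apply/seteqP; split => v /BE.
Qed.

Lemma lebesgue_rV_unique (m : {measure set 'rV[R]_d -> \bar R}) :
  (forall (A : 'I_d -> set R) (B : set 'rV[R]_d), (forall i, measurable (A i)) ->
     (forall v, B v <-> forall i, A i (v ord0 i)) ->
     m B = (\prod_(i < d) lebesgue_measure (A i))%E) ->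
  forall A, measurable A -> leb A = m A.
Proof.
move=> mbox; apply: (@eq_measure_box _ _ _ _ d (fun i (v : 'rV[R]_d) => v ord0 i) _ _ _
  (fun k _ => `[- k%:R, k%:R]%classic)) => //.
- by move=> A mA; rewrite [RHS](mbox A) //; exact: lebesgue_rV_boxE.
- rewrite -subTset => v _.
  exists (\max_(i < d) (Num.truncn `|v ord0 i|).+1)%N => // i /=.
  rewrite in_itv /= -ler_norml.
  apply: (@le_trans _ _ (Num.truncn `|v ord0 i|).+1%:R).
    by rewrite ltW // truncnS_gt.
  by rewrite ler_nat; exact: (leq_bigmax i).
- move=> k; rewrite [ltLHS](@lebesgue_rV_boxE (fun=> `[- k%:R, k%:R]%classic)) //.
  rewrite ltey_eq; apply/orP; left.
  apply: prode_fin_num => i _; rewrite lebesgue_measure_itv /=.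
  by case: ifP.
Qed.

Lemma measurable_addv (v : 'rV[R]_d) : 
  measurable_fun setT (fun x : 'rV[R]_d => x + v).
Proof.
apply/measurable_fun_rVP => i; under eq_fun do rewrite mxE.
by apply: measurable_funD => //; exact: measurable_coord.
Qed.

Lemma measurable_scalev (r : R) :
  measurable_fun setT (fun x : 'rV[R]_d => r *: x).
Proof.
apply/measurable_fun_rVP => i; under eq_fun do rewrite mxE.
by apply: measurable_funM => //; exact: measurable_coord.
Qed.

Lemma lebesgue_measure_addr (y : R) (A : set R) : measurable A ->
  lebesgue_measure ((fun x => x + y) @^-1` A) = lebesgue_measure A.
Proof.
have mf : measurable_fun setT (fun x : measurableTypeR R => x + y : measurableTypeR R).
  exact: measurable_funD.
move=> mA; rewrite -[LHS](image_measureE _ mf).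
apply/esym/lebesgue_measure_unique => // _ [[a b] _ <-].
rewrite [RHS]image_measureE.
rewrite (_ : _ @^-1` _ = `]a - y, b - y]%classic); last first.
  by apply/seteqP; split=> x /=; rewrite !in_itv/= lerBrDr ltrBlDr.
rewrite [LHS]lebesgue_measure_itv [RHS]lebesgue_measure_itv /= !lte_fin ltrD2r.
by case: ifP => // _; rewrite -!EFinD; congr EFin; ring.
Qed.

Lemma lebesgue_measure_scale (r : R) (A : set R) : 0 < r -> measurable A ->
  lebesgue_measure ((fun x => r * x) @^-1` A) = ((r^-1)%:E * lebesgue_measure A)%E.
Proof.
have mf : measurable_fun setT (fun x : measurableTypeR R => r * x : measurableTypeR R).
  exact: measurable_funM.
move=> r0 mA; rewrite -[LHS](image_measureE _ mf).
apply: (@canRL _ _ (fun z => r%:E * z)%E (fun z => r^-1%:E * z)%E).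
  by move=> z; rewrite muleA -EFinM mulVf ?gt_eqF // mul1e.
have r0' : 0 <= r by exact: ltW.
transitivity (mscale (NngNum r0') (image_measure lebesgue_measure mf) A) => //.
apply/esym/lebesgue_measure_unique => // _ [[a b] _ <-].
rewrite [RHS]/= /mscale [X in (_ * X)%E]image_measureE.
rewrite (_ : _ @^-1` _ = `](a / r), (b / r)]%classic); last first.
  by apply/seteqP; split=> x /=; rewrite !in_itv/= ler_pdivlMr // ltr_pdivrMr // mulrC.
rewrite [LHS]lebesgue_measure_itv [X in (_ * X)%E]lebesgue_measure_itv /= !lte_fin ltr_pM2r ?invr_gt0 //.
case: ifP => _; last by rewrite mule0.
by rewrite -!EFinD -EFinM; congr EFin; field; rewrite gt_eqF.
Qed.

Lemma lebesgue_rV_addv (v : 'rV[R]_d) (A : set 'rV[R]_d) : measurable A ->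
  leb ((fun x => x + v) @^-1` A) = leb A.
Proof.
move=> mA; rewrite -[LHS](image_measureE _ (measurable_addv v)).
apply/esym/lebesgue_rV_unique => // B C mB CE; rewrite image_measureE.
rewrite [LHS](@lebesgue_rV_boxE (fun i => (fun t => t + v ord0 i) @^-1` B i)).
- by apply: eq_bigr => i _; rewrite lebesgue_measure_addr.
- by move=> i; rewrite -[X in measurable X]setTI; exact: measurable_funD.
- by move=> x; split=> [/CE h i|h]; [|apply/CE => i]; have := h i; rewrite /= mxE.
Qed.

Lemma lebesgue_rV_scale (r : R) (A : set 'rV[R]_d) : 0 < r -> measurable A ->
  leb ((fun x => r *: x) @^-1` A) = ((r ^- d)%:E * leb A)%E.
Proof.
move=> r0 mA; rewrite -[LHS](image_measureE _ (measurable_scalev r)).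
(* The factor moves to the other side: r^d times the image measure is itself a measure, which can be
   identified with Lebesgue measure on boxes. *)
apply: (@canRL _ _ (fun z => (r ^+ d)%:E * z)%E (fun z => (r ^- d)%:E * z)%E).
  by move=> z; rewrite muleA -EFinM mulVf ?expf_eq0 ?gt_eqF ?andbF // mul1e.
have r0' : 0 <= r ^+ d by rewrite exprn_ge0 // ltW.
transitivity (mscale (NngNum r0') (image_measure leb (measurable_scalev r)) A) => //.
apply/esym/lebesgue_rV_unique => // B C mB CE.
rewrite [LHS]/= /mscale [X in (_ * X)%E]image_measureE.
rewrite [X in (_ * X)%E](@lebesgue_rV_boxE (fun i => (fun t => r * t) @^-1` B i)).
- under eq_bigr do rewrite lebesgue_measure_scale //.
  rewrite big_split /= prodEFin prodr_const card_ord muleA -EFinM -exprMn.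
  by rewrite divff ?gt_eqF // expr1n mul1e.
- by move=> i; rewrite -[X in measurable X]setTI; exact: measurable_funM.
- by move=> x; split=> [/CE h i|h]; [|apply/CE => i]; have := h i; rewrite /= mxE.
Qed.

Lemma ge0_integral_lebesgue_rV_addv (v : 'rV[R]_d) (h : 'rV[R]_d -> \bar R) :
  measurable_fun setT h -> (forall x, (0 <= h x)%E) ->
  (\int[leb]_x h (x + v)%R = \int[leb]_x h x)%E.
Proof.
move=> mh h0; rewrite -(ge0_integral_image_measure _ (measurable_addv v)) //.
by apply: eq_measure_integral => A mA _; exact: lebesgue_rV_addv.
Qed.

Lemma lebesgue_rV_cube (r : R) : 0 <= r ->
  leb [set v | forall i, `|v ord0 i| <= r] = ((2 * r) ^+ d)%:E.
Proof.
move=> r0; rewrite (@lebesgue_rV_boxE (fun=> `[- r, r]%classic)) //.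
  rewrite (eq_bigr (fun=> (2 * r)%:E)) ?prodEFin ?prodr_const ?card_ord //.
  move=> i _; rewrite [LHS]lebesgue_measure_itv /= lte_fin.
  case: ifPn => [_|]; first by rewrite -EFinB; congr EFin; ring.
  by rewrite -leNgt => rr; congr EFin; lra.
by move=> v; split=> h i; have := h i; rewrite /= in_itv /= ler_norml.
Qed.

Lemma measurable_cube (r : R) :
  measurable [set v : 'rV[R]_d | forall i, `|v ord0 i| <= r].
Proof.
rewrite (_ : [set _ | _] = \bigcap_(i in [set: 'I_d])
    ((fun v : 'rV[R]_d => v ord0 i) @^-1` `[- r, r])).
  apply: fin_bigcap_measurable => // i _.
  by rewrite -[X in measurable X]setTI; exact: measurable_coord.
apply/seteqP; split => v h i; first by move=> _; rewrite /= in_itv/= -ler_norml.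
by have := h i I; rewrite /= in_itv/= ler_norml.
Qed.

Variable p : \bar R.
Hypothesis p1 : (1 <= p)%E.

Lemma measurable_lp_ball (r : R) : measurable [set v : 'rV[R]_d | lp_norm p v <= r].
Proof.
rewrite (_ : [set _ | _] = @lp_norm R d p @^-1` `]-oo, r]); last first.
  by apply/seteqP; split=> v /=; rewrite in_itv.
by rewrite -[X in measurable X]setTI; exact: measurable_lp_norm.
Qed.

Lemma lp_ball_fin_num : leb [set v | lp_norm p v <= 1] \is a fin_num.
Proof.
rewrite ge0_fin_numE; last exact: measure_ge0.
apply: (@le_lt_trans _ _ (leb [set v | forall i, `|v ord0 i| <= 1])).
  apply: le_measure; rewrite ?inE; [exact: measurable_lp_ball|exact: measurable_cube|].
  by move=> v /= h i; exact: le_trans (ler_coord_lp_norm v i p1) h.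
by rewrite lebesgue_rV_cube // ltry.
Qed.

Lemma lp_ballE : leb [set v | lp_norm p v <= 1] = (unit_ball_volume d p)%:E.
Proof. by rewrite /unit_ball_volume fineK // lp_ball_fin_num. Qed.

Hypothesis d0 : (0 < d)%N.

Lemma unit_ball_volume_gt0 : 0 < unit_ball_volume d p.
Proof.
rewrite -lte_fin -lp_ballE.
apply: (@lt_le_trans _ _ (leb [set v | forall i, `|v ord0 i| <= d%:R^-1])).
  by rewrite lebesgue_rV_cube ?invr_ge0 // lte_fin exprn_gt0 // mulr_gt0 // invr_gt0 ltr0n.
apply: le_measure; rewrite ?inE; [exact: measurable_cube|exact: measurable_lp_ball|].
move=> v /= h; apply: le_trans (lp_norm_le_max p1 _ h) _; rewrite ?invr_ge0 //.
by rewrite divff // pnatr_eq0 -lt0n.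
Qed.

Lemma lebesgue_rV_lp_ball (r : R) : 0 <= r ->
  leb [set v | lp_norm p v <= r] = (unit_ball_volume d p * r ^+ d)%:E.
Proof.
rewrite le_eqVlt => /orP[/eqP <-|r0].
  rewrite expr0n gtn_eqF // mulr0; apply/eqP; rewrite eq_le measure_ge0 andbT.
  apply: (@le_trans _ _ (leb [set v | forall i, `|v ord0 i| <= 0])).
    apply: le_measure; rewrite ?inE; [exact: measurable_lp_ball|exact: measurable_cube|].
    by move=> v /= h i; exact: le_trans (ler_coord_lp_norm v i p1) h.
  by rewrite lebesgue_rV_cube // mulr0 expr0n gtn_eqF.
rewrite (_ : [set _ | _] =
    (fun x => r^-1 *: x) @^-1` [set v : 'rV[R]_d | lp_norm p v <= 1]); last first.
  apply/seteqP; split => v /=; rewrite lp_normZ // gtr0_norm ?invr_gt0 //;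
    by rewrite ler_pdivrMl // mulr1.
rewrite lebesgue_rV_scale ?invr_gt0 //; last exact: measurable_lp_ball.
by rewrite lp_ballE -EFinM mulrC exprVn invrK.
Qed.

End lebesgue_rV.

(** * Regularity of the density *)

Section integral_bounds.
Context dd (T : measurableType dd) (R : realType) (m : {measure set T -> \bar R}).
Implicit Types g : T -> R.

Lemma integral_indic_le (c w : R) (W : set T) : 0 <= c -> measurable W ->
  (m W <= w%:E)%E -> (\int[m]_x (c * \1_W x)%:E <= (c * w)%:E)%E.
Proof.
move=> c0 mW mWw; under eq_integral do rewrite EFinM.
rewrite ge0_integralZl_EFin //; last by apply/measurable_EFinP/measurable_indic.
by rewrite integral_indic // setIT EFinM lee_pmul // measure_ge0.
Qed.

Lemma integralD_le g1 g2 (a b : R) :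
  measurable_fun setT g1 -> measurable_fun setT g2 ->
  (forall x, 0 <= g1 x) -> (forall x, 0 <= g2 x) ->
  (\int[m]_x (g1 x)%:E <= a%:E)%E -> (\int[m]_x (g2 x)%:E <= b%:E)%E ->
  (\int[m]_x (g1 x + g2 x)%:E <= (a + b)%:E)%E.
Proof.
move=> mg1 mg2 g10 g20 ga gb; under eq_integral do rewrite EFinD.
rewrite ge0_integralD //; last 4 first.
- by move=> x _; rewrite lee_fin.
- exact/measurable_EFinP.
- by move=> x _; rewrite lee_fin.
- exact/measurable_EFinP.
by rewrite EFinD leeD.
Qed.

Lemma integral_sum_le n (g : nat -> T -> R) (a : nat -> R) :
  (forall j, measurable_fun setT (g j)) -> (forall j x, 0 <= g j x) ->
  (forall j, (j < n)%N -> (\int[m]_x (g j x)%:E <= (a j)%:E)%E) ->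
  (\int[m]_x (\sum_(j < n) g j x)%:E <= (\sum_(j < n) a j)%:E)%E.
Proof.
move=> mg g0; elim: n => [|n IH] ga.
  under eq_integral do rewrite big_ord0; by rewrite integral0 big_ord0.
under eq_integral do rewrite big_ord_recr /=.
rewrite big_ord_recr /=; apply: integralD_le => //.
- exact: measurable_sum.
- by move=> x; exact: sumr_ge0.
- by apply: IH => j jn; apply: ga; exact: ltnW.
- exact: ga.
Qed.

Lemma integralZ_le g (c a : R) : 0 <= c -> measurable_fun setT g ->
  (forall x, 0 <= g x) -> (\int[m]_x (g x)%:E <= a%:E)%E ->
  (\int[m]_x (c * g x)%:E <= (c * a)%:E)%E.
Proof.
move=> c0 mg g0 ga; under eq_integral do rewrite EFinM.
rewrite ge0_integralZl_EFin //; last exact/measurable_EFinP.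
  by rewrite EFinM lee_pmul // integral_ge0 // => x _; rewrite lee_fin.
by move=> x _; rewrite lee_fin.
Qed.

End integral_bounds.

Section regularity.
Context {R : realType} {d : nat}.
Local Notation leb := (lebesgue_rV R d).
Implicit Types (f : 'rV[R]_d -> R) (x v : 'rV[R]_d).

Lemma ler_coord_enorm v i : `|v ord0 i| <= enorm v.
Proof.
rewrite /enorm -sqrtr_sqr ler_sqrt; last by apply: sumr_ge0 => j _; exact: sqr_ge0.
by rewrite (bigD1 i) //= lerDl sumr_ge0 // => j _; exact: sqr_ge0.
Qed.

Lemma ler_diag_spectral_norm (M : 'M[R]_d) i : `|M i i| <= spectral_norm M.
Proof.
have e1 : enorm (delta_mx ord0 i : 'rV[R]_d) <= 1.
  rewrite /enorm (bigD1 i) //= mxE !eqxx expr1n big1 ?addr0 ?sqrtr1 // => j ji.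
  by rewrite mxE (negbTE ji) andbF expr0n.
apply: (@le_trans _ _ (enorm (delta_mx ord0 i *m M))).
  apply: le_trans (ler_coord_enorm _ i).
  by rewrite -rowE mxE.
apply: ub_le_sup; last by exists (delta_mx ord0 i).
(* A [sup] dominates its elements only when the set is bounded above; on the unit ball every entry
   of v is at most 1, so the absolute column sums of M give a bound. *)
exists (Num.sqrt (\sum_(j < d) (\sum_(k < d) `|M k j|) ^+ 2)) => _ [v /= v1 <-].
rewrite /enorm ler_sqrt; last by apply: sumr_ge0 => j _; exact: sqr_ge0.
apply: ler_sum => j _; rewrite -[leLHS]real_normK ?num_real //.
rewrite ler_sqr ?nnegrE //; last exact: sumr_ge0.
rewrite mxE; apply: le_trans (ler_norm_sum _ _ _) _.
apply: ler_sum => k _; rewrite normrM ler_piMl //.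
exact: le_trans (ler_coord_enorm v k) v1.
Qed.

Lemma is_derive_line f x v t (df : R) : is_derive (x + t *: v) v f df ->
  is_derive t (1 : R) (fun s : R => f (x + s *: v)) df.
Proof.
move=> [h1 h2].
have E : (fun h : R => h^-1 *: (f (x + (h *: 1 + t) *: v) - f (x + t *: v))) =
         (fun h : R => h^-1 *: ((f \o shift (x + t *: v)) (h *: v) - f (x + t *: v))).
  apply/funext => h /=; congr (_ *: (f _ - _)).
  by rewrite scalerDl addrCA /GRing.scale /= mulr1.
by split; rewrite /derivable /derive /= /comp /= /shift /= E.
Qed.

(* Two applications of the mean value theorem to the first derivative control
   it on [0, l] by its mean and the oscillation l * Cd. *)
Lemma ler_increment_C2 (g g1 g2 : R -> R) (l s Ca Cd : R) : 0 < l -> 0 <= s <= l ->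
  (forall t : R, 0 <= t <= l -> is_derive t (1 : R) g (g1 t)) ->
  (forall t : R, 0 <= t <= l -> is_derive t (1 : R) g1 (g2 t)) ->
  (forall t : R, 0 <= t <= l -> `|g2 t| <= Cd) ->
  0 <= g 0 <= Ca -> 0 <= g l <= Ca ->
  `|g s - g 0| <= s * (Ca / l + Cd * l).
Proof.
move=> l0 /andP[s0 sl] dg dg1 g2C g0C glC.
have Cd0 : 0 <= Cd by apply: le_trans (g2C 0 _) => //; rewrite lexx ltW.
have cont (h h1 : R -> R) (a b : R) : 0 <= a -> b <= l ->
    (forall t : R, 0 <= t <= l -> is_derive t (1 : R) h (h1 t)) ->
    {within `[a, b], continuous h}.
  move=> a0 bl dh; apply: derivable_within_continuous => t.
  rewrite in_itv /= => /andP[at_ tb].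
  by have [] := dh t; rewrite ?(le_trans a0) //= (le_trans tb).
have mvt (h h1 : R -> R) (a b : R) : 0 <= a -> b <= l -> a < b ->
    (forall t : R, 0 <= t <= l -> is_derive t (1 : R) h (h1 t)) ->
    exists2 c : R, 0 <= c <= l & h b - h a = h1 c * (b - a).
  move=> a0 bl ab dh; have dh' (t : R) : t \in `]a, b[ -> is_derive t 1 h (h1 t).
    rewrite in_itv /= => /andP[at_ tb]; apply: dh.
    by rewrite (le_trans a0) ?ltW // (lt_le_trans tb).
  have [c] := MVT ab dh' (cont h h1 a b a0 bl dh).
  rewrite in_itv /= => /andP[ac cb] E; exists c => //.
  by rewrite (le_trans a0) ?ltW // (lt_le_trans cb).
have osc a b : 0 <= a <= l -> 0 <= b <= l -> `|g1 a - g1 b| <= Cd * l.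
  wlog ab : a b / b <= a.
    move=> H ha hb; case: (leP b a) => [/H|/ltW /H]; first exact.
    by rewrite distrC; apply.
  move=> /andP[a0 al] /andP[b0 bl]; move: ab; rewrite le_eqVlt => /orP[/eqP->|ba].
    by rewrite subrr normr0 mulr_ge0 // ltW.
  have [c cl ->] := mvt g1 g2 b a b0 al ba dg1.
  rewrite normrM ler_pM //; first exact: g2C.
  by rewrite gtr0_norm ?subr_gt0 // lerBlDr (le_trans al) // lerDl.
have [c0 c0l E0] := mvt g g1 0 l (lexx _) (lexx _) l0 dg.
have g1c0 : `|g1 c0| <= Ca / l.
  rewrite ler_pdivlMr // -[X in _ * X](gtr0_norm l0) -normrM.
  rewrite subr0 in E0; rewrite -E0 ler_norml; lra.
move: s0; rewrite le_eqVlt => /orP[/eqP<-|s0].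
  by rewrite subrr normr0 mul0r.
have [c cl ->] := mvt g g1 0 s (lexx _) sl s0 dg.
rewrite subr0 normrM (gtr0_norm s0) mulrC ler_wpM2l ?(ltW s0) //.
rewrite -[g1 c](subrK (g1 c0)) (le_trans (ler_normD _ _)) // addrC lerD //.
exact: osc.
Qed.

(** Every neighbourhood contains a cube of positive volume and so meets a set of full measure. This
    is how almost sure bounds on f become bounds at every regular point, where f is continuous. *)
Lemma ae_nbhs_ex (P : 'rV[R]_d -> Prop) (y : 'rV[R]_d) (U : set 'rV[R]_d) :
  {ae leb, forall x, P x} -> nbhs y U -> exists2 z, U z & P z.
Proof.
move=> [N [mN N0 PN]] Uy; apply: contrapT => noz.
move/nbhs_ballP: Uy => [e /= e0 eU].
have : leb ((fun x => x + - y) @^-1` [set v | forall i, `|v ord0 i| <= e / 2]) = 0%E.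
  apply/eqP; rewrite eq_le measure_ge0 andbT -N0; apply: le_measure; rewrite ?inE //.
    rewrite -[X in measurable X]setTI; apply: measurable_addv => //.
    exact: measurable_cube.
  move=> x /= xy; apply: PN => /= Px; apply: noz; exists x => //; apply: eU.
  rewrite -ball_normE /= [ltLHS]mx_normrE; apply/bigmax_ltP; split => // -[i0 i] _ /=.
  have := xy i; rewrite (ord1 i0) !mxE distrC => h; apply: le_lt_trans h _.
  by rewrite ltr_pdivrMr // ltr_pMr // ltr1n.
rewrite [LHS]lebesgue_rV_addv; last exact: measurable_cube.
rewrite [LHS]lebesgue_rV_cube; last by rewrite divr_ge0 // ltW.
by move/eqP; rewrite eqe expf_eq0 mulf_eq0 pnatr_eq0 /= gt_eqF ?andbF // divr_gt0.
Qed.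

Variables (f : 'rV[R]_d -> R) (Ca C0 Cd Ce : R).
Hypothesis mf : measurable_fun setT f.
Hypothesis f0 : forall x, 0 <= f x.
Hypothesis fCa : {ae leb, forall x, f x <= Ca}.
Hypothesis fC0 : {ae leb, forall x, f x = 0 \/ C0 <= f x}.
Hypothesis Ca0 : 0 < Ca.
Hypothesis C00 : 0 < C0.
Hypothesis Cd0 : 0 < Cd.
Hypothesis Ce0 : 0 < Ce.

Let regular x := twice_continuously_differentiable_at f x /\
      spectral_norm (hessian f x) < Cd.

Hypothesis hausB : (hausdorff_measure d.-1 [set x | ~ regular x] < Ce%:E)%E.

Let e_ i : 'rV[R]_d := delta_mx ord0 i.

Lemma regular_continuous x : regular x -> {for x, continuous f}.
Proof.
by move=> [[/nbhs_singleton[+ _] _] _]; exact: differentiable_continuous.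
Qed.

Lemma regular_le x : regular x -> f x <= Ca.
Proof.
move=> /regular_continuous fx; rewrite leNgt; apply/negP => h.
have [z /= z1] := ae_nbhs_ex fCa (fx _ (lt_nbhsr h)).
by rewrite leNgt z1.
Qed.

(** By continuity, a value strictly between 0 and C0 would persist on a neighbourhood, and that
    neighbourhood contains a point where the almost sure dichotomy holds. *)
Lemma regular_dichotomy x : regular x -> f x = 0 \/ C0 <= f x.
Proof.
move=> /regular_continuous fx; have [->|fx0] := eqVneq (f x) 0; [by left|right].
rewrite leNgt; apply/negP => h.
have fx1 : 0 < f x by rewrite lt_neqAle eq_sym fx0 f0.
have nU : \forall z \near f x, z \in `]0, C0[.
  by apply: near_in_itvoo; rewrite in_itv /= fx1.
have [z /=] := ae_nbhs_ex fC0 (fx _ nU); rewrite in_itv /= => /andP[z0 zC].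
by move=> [z1|]; [rewrite z1 ltxx in z0|rewrite leNgt zC].
Qed.

Lemma regular_line x i t : regular (x + t *: e_ i) ->
  [/\ is_derive t (1 : R) (fun s : R => f (x + s *: e_ i)) (partial i f (x + t *: e_ i)),
   is_derive t (1 : R) (fun s : R => partial i f (x + s *: e_ i))
     (partial i (partial i f) (x + t *: e_ i)) &
   `|partial i (partial i f) (x + t *: e_ i)| <= Cd].
Proof.
move=> [[/nbhs_singleton[df dpf] _] sC]; split.
- by apply: is_derive_line; apply: DeriveDef => //; exact: diff_derivable.
- by apply: is_derive_line; apply: DeriveDef => //; exact/diff_derivable/dpf.
- apply: ltW; apply: le_lt_trans sC.
  by have := ler_diag_spectral_norm (hessian f (x + t *: e_ i)) i; rewrite mxE.
Qed.

Let bad i (l : R) x := exists2 t, 0 <= t <= l & ~ regular (x + t *: e_ i).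

Lemma ler_increment_good x i (l s : R) : 0 < l -> 0 <= s <= l -> ~ bad i l x ->
  `|f (x + s *: e_ i) - f x| <= s * (Ca / l + Cd * l).
Proof.
move=> l0 sl nbad.
have reg t : 0 <= t <= l -> regular (x + t *: e_ i).
  by move=> tl; apply: contrapT => nr; apply: nbad; exists t.
have bnd t : 0 <= t <= l -> 0 <= f (x + t *: e_ i) <= Ca.
  by move=> /reg/regular_le ->; rewrite f0.
have := @ler_increment_C2 (fun t => f (x + t *: e_ i))
  (fun t => partial i f (x + t *: e_ i))
  (fun t => partial i (partial i f) (x + t *: e_ i)) l s Ca Cd l0 sl.
rewrite scale0r addr0; apply.
- by move=> t /reg/regular_line[].
- by move=> t /reg/regular_line[].
- by move=> t /reg/regular_line[].
- by have := bnd 0; rewrite scale0r addr0 lexx ltW //; apply.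
- by apply: bnd; rewrite ltW //= lexx.
Qed.

(* Every set of diameter D <= l in a cover of the irregular set is swept by a
   segment of length l into a box of volume (2D)^(d-1) (2D + l). *)
Lemma bad_cover i (l : R) : 0 < l -> exists W : set 'rV[R]_d,
  [/\ measurable W, bad i l `<=` W & (leb W <= (3 * 2 ^+ d.-1 * Ce * l)%:E)%E].
Proof.
move=> l0.
(* The measure is a supremum over all scales of the content; the scale l is chosen so that no
   covering set is wider than the segments are long. *)
have : (hausdorff_content d.-1 l [set x | ~ regular x] < Ce%:E)%E.
  apply: le_lt_trans hausB; apply: ereal_sup_ubound; exists l => //.
rewrite /hausdorff_content => /ereal_inf_lt[_ [U [coverU diamU] <-]] sumU.
pose D n := sup [set enorm (u.1 - u.2) | u in U n `*` U n].
have distD n x y : U n x -> U n y -> enorm (x - y) <= D n.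
  move=> Ux Uy; apply: ub_le_sup; last by exists (x, y).
  by exists l => _ [[a b] /= [Ua Ub] <-]; exact: (diamU n a b).
have D0 n x : U n x -> 0 <= D n <= l.
  move=> Ux; apply/andP; split; first by apply: le_trans (distD n x x _ _); rewrite ?sqrtr_ge0.
  apply: ge_sup; first by exists (enorm (x - x)); exists (x, x).
  by move=> _ [[a b] /= [Ua Ub] <-]; exact: (diamU n a b).
(* Segments leave x in the positive direction of axis i, so on that axis the box reaches l further
   down than [U n]. Its centre is an arbitrary point of [U n]; empty sets are treated apart, since
   [xget] would return 0 for them. *)
pose A n j : set R := let u := xget 0 (U n) in
  if j == i then `[u ord0 j - D n - l, u ord0 j + D n]%classic
  else `[u ord0 j - D n, u ord0 j + D n]%classic.
pose W n := if U n == set0 then set0 else [set v : 'rV[R]_d | forall j, A n j (v ord0 j)].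
have mA n j : measurable (A n j) by rewrite /A; case: ifP.
have mW n : measurable (W n).
  rewrite /W; case: ifP => // _.
  rewrite (_ : [set _ | _] = \bigcap_(j in [set: 'I_d])
    ((fun v : 'rV[R]_d => v ord0 j) @^-1` A n j)).
    apply: fin_bigcap_measurable => // j _.
    by rewrite -[X in measurable X]setTI; exact: measurable_coord.
  by apply/seteqP; split => v h j; [move=> _; exact: h|exact: (h j I)].
have lebW n : (leb (W n) <= (3 * 2 ^+ d.-1 * l)%:E * (hausdorff_weight d.-1 (U n))%:E)%E.
  rewrite /W /hausdorff_weight -/(D n); case: eqVneq => [_|Un].
    by rewrite measure0 mulr0 mule0.
  have Uu : U n (xget 0 (U n)) by apply: xgetPex; exact/set0P.
  have /andP[D0n Dl] := D0 n _ Uu.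
  rewrite (lebesgue_rV_boxE (mA n)) // mulr1 (bigD1 i) //=.
  rewrite (eq_bigr (fun=> (2 * D n)%:E)); last first.
    move=> j /negbTE ji; rewrite /A ji [LHS]lebesgue_measure_itv /= lte_fin.
    case: ifPn => [_|]; first by rewrite -EFinB; congr EFin; ring.
    by rewrite -leNgt => rr; congr EFin; lra.
  rewrite prodEFin prodr_const cardC1 card_ord.
  (* Since D <= l, the side 2 D + l is at most 3 l, which leaves D^(d-1), exactly the Hausdorff
     weight of [U n]. *)
  rewrite /A eqxx [X in (X * _)%E]lebesgue_measure_itv /= lte_fin ifT; last lra.
  rewrite -EFinD -!EFinM lee_fin exprMn.
  rewrite [leRHS](_ : _ = 3 * l * (2 ^+ d.-1 * D n ^+ d.-1)); last by ring.
  by apply: ler_wpM2r; [rewrite mulr_ge0 // exprn_ge0|lra].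
exists (\bigcup_n W n); split.
- exact: bigcupT_measurable.
- move=> x [t /andP[t0 tl] nreg].
  have [n _ Unx] := coverU _ nreg; exists n => //.
  rewrite /W; case: eqVneq => [U0|Un]; first by rewrite U0 in Unx.
  have Uu : U n (xget 0 (U n)) by apply: xgetPex; exact/set0P.
  move=> j; have := le_trans (ler_coord_enorm _ j) (distD n _ _ Unx Uu).
  rewrite !mxE eqxx /= /A ler_norml; case: eqVneq => [->|ji]; rewrite /= in_itv /=.
    rewrite mulr1; lra.
  rewrite mulr0 addr0; lra.
- apply: (@le_trans _ _ (\sum_(0 <= n <oo) leb (W n))%E).
    by apply: measure_sigma_subadditive => //; exact: bigcupT_measurable.
  apply: (@le_trans _ _ (\sum_(0 <= n <oo) ((3 * 2 ^+ d.-1 * l)%:E * (hausdorff_weight d.-1 (U n))%:E))%E).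
    exact: lee_nneseries.
  rewrite nneseriesZl; last first.
    move=> n _; rewrite lee_fin /hausdorff_weight -/(D n).
    case: eqVneq => [_|/set0P[u /D0/andP[+ _]]]; first by rewrite mulr0.
    by move=> Dn0; rewrite mulr1 exprn_ge0.
  rewrite (_ : 3 * _ * Ce * l = (3 * 2 ^+ d.-1 * l) * Ce); last by ring.
  rewrite EFinM; apply: lee_wpmul2l (ltW sumU).
  by rewrite lee_fin !mulr_ge0 ?exprn_ge0 // ltW.
Qed.

Definition increment (v x : 'rV[R]_d) : R := `|f (x + v) - f x|.

Lemma measurable_increment v : measurable_fun setT (increment v).
Proof.
apply: measurableT_comp => //; apply: measurable_funB => //.
by apply: measurableT_comp => //; exact: measurable_addv.
Qed.

(** Markov's inequality. With the dichotomy it gives finite volume to the support of f up to a null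
    set, so that a pointwise bound of order r there is integrable with integral of order r. *)
Lemma lebesgue_rV_support :
  (leb [set x | (C0 <= f x)%R] <= (C0^-1)%:E * \int[leb]_x (f x)%:E)%E.
Proof.
have mS : measurable [set x | C0 <= f x].
  rewrite (_ : [set _ | _] = f @^-1` `[C0, +oo[); last first.
    by apply/seteqP; split=> x /=; rewrite in_itv /= andbT.
  by rewrite -[X in measurable X]setTI; exact: mf.
rewrite -ge0_integralZl //=; last 3 first.
  - by apply/measurable_EFinP.
  - by move=> x _; rewrite lee_fin.
  - by rewrite lee_fin invr_ge0 ltW.
rewrite -(setIT [set x | C0 <= f x]) -integral_indic //.
apply: ge0_le_integral => //.
- by apply/measurable_EFinP/measurable_indic.
- by apply/measurable_EFinP/measurable_funM.
move=> x _; rewrite -EFinM lee_fin indicE; case: (boolP (x \in _)) => [|_].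
  by rewrite inE /= => h; rewrite ler_pdivlMl // mulr1.
by rewrite mulr_ge0 // invr_ge0 ltW.
Qed.

Let C1 := 3 * 2 ^+ d.-1 * Ce.

Lemma ae_addv (P : 'rV[R]_d -> Prop) (v : 'rV[R]_d) :
  {ae leb, forall x, P x} -> {ae leb, forall x, P (x + v)}.
Proof.
move=> [N [mN N0 PN]]; exists ((fun x => x + v) @^-1` N); split.
- by rewrite -[X in measurable X]setTI; exact: measurable_addv.
- by rewrite [LHS]lebesgue_rV_addv.
- by move=> x /= nP; exact: PN.
Qed.

(** A segment that is good at length 2^j r but bad at 2^(j+1) r has an increment of at most r (Ca /
    (2^j r) + Cd), and its origin lies in [W j.+1], of volume of order 2^j r: each dyadic length
    contributes order r, and the number m of lengths below 1 is the source of the logarithm. A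
    segment bad already at length r costs Ca on [W 0]. One that is good at length about 1 costs
    order r, charged to the points where f is at least C0 at one of the two ends. *)
Lemma increment_pointwise i (r s : R) (m : nat) (W : nat -> set 'rV[R]_d) :
  0 <= s <= r -> 0 < r -> 2 ^+ m * r <= 1 -> 1 <= 2 ^+ m.+1 * r ->
  (forall j, bad i (2 ^+ j * r) `<=` W j) ->
  {ae leb, forall x, increment (s *: e_ i) x <= Ca * \1_(W 0%N) x +
     \sum_(j < m) r * (Ca / (2 ^+ j * r) + Cd) * \1_(W j.+1) x +
     r * (2 * Ca + Cd) * (\1_[set x | C0 <= f x] x + \1_[set x | C0 <= f x] (x + s *: e_ i)) }.
Proof.
move=> /andP[s0 sr] r0 mr1 mr2 badW.
apply: filterS2 fCa (ae_addv (s *: e_ i) fCa) => x fxCa fxsCa.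
have jr0 j : 0 < 2 ^+ j * r by rewrite mulr_gt0 // exprn_gt0.
have jr1 j : (j <= m)%N -> 2 ^+ j * r <= 1.
  by move=> jm; apply: le_trans mr1; rewrite ler_pM2r // ler_eXn2l // ltr1n.
have sjr j : 0 <= s <= 2 ^+ j * r.
  rewrite s0 (le_trans sr) // ler_peMl ?(ltW r0) //.
  by rewrite exprn_ege1 // ler1n.
have term0 j : 0 <= r * (Ca / (2 ^+ j * r) + Cd).
  by rewrite mulr_ge0 ?(ltW r0) // addr_ge0 ?(ltW Cd0) // divr_ge0 ?(ltW Ca0) ?(ltW (jr0 j)).
have good j : (j <= m)%N -> ~ bad i (2 ^+ j * r) x ->
    increment (s *: e_ i) x <= r * (Ca / (2 ^+ j * r) + Cd).
  move=> jm /(ler_increment_good (jr0 j) (sjr j))/le_trans; apply.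
  apply: ler_pM => //.
    by rewrite addr_ge0 //; [apply: divr_ge0|apply: mulr_ge0]; exact: ltW.
  by rewrite lerD2l ler_piMr ?(ltW Cd0) // jr1.
have claim j : (j <= m)%N -> bad i (2 ^+ j * r) x -> increment (s *: e_ i) x <= Ca * \1_(W 0%N) x +
     \sum_(j < j) r * (Ca / (2 ^+ j * r) + Cd) * \1_(W j.+1) x.
  elim: j => [|j IH] jm bj.
    rewrite big_ord0 addr0 indicE mem_set ?mulr1; last exact: badW.
    by rewrite /increment ler_norml; have := f0 x; have := f0 (x + s *: e_ i); lra.
  rewrite big_ord_recr /= addrA; have [bj'|nbj] := pselect (bad i (2 ^+ j * r) x).
    by apply: le_trans (IH (ltnW jm) bj') _; rewrite lerDl mulr_ge0.
  apply: le_trans (good j (ltnW jm) nbj) _.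
  rewrite [\1_(W j.+1) x]indicE mem_set ?mulr1; last exact: badW.
  rewrite lerDr addr_ge0 //; first by rewrite mulr_ge0 // ltW.
  by apply: sumr_ge0 => k _; rewrite mulr_ge0.
have S0 : 0 <= \1_[set x | C0 <= f x] x + \1_[set x | C0 <= f x] (x + s *: e_ i) :> R.
  by rewrite addr_ge0.
have [bm|nbm] := pselect (bad i (2 ^+ m * r) x).
  apply: le_trans (claim m (leqnn m) bm) _; rewrite lerDl mulr_ge0 //.
  by rewrite mulr_ge0 ?(ltW r0) // addr_ge0 ?(ltW Cd0) // mulr_ge0 // ltW.
apply: (@le_trans _ _ (r * (2 * Ca + Cd) * (\1_[set x | C0 <= f x] x + \1_[set x | C0 <= f x] (x + s *: e_ i)))); last first.
  rewrite lerDr addr_ge0 //; first by rewrite mulr_ge0 // ltW.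
  by apply: sumr_ge0 => k _; rewrite mulr_ge0.
have reg t : 0 <= t <= 2 ^+ m * r -> regular (x + t *: e_ i).
  by move=> tl; apply: contrapT => nr; apply: nbm; exists t.
have K0 : 0 <= r * (2 * Ca + Cd).
  by rewrite mulr_ge0 ?(ltW r0) // addr_ge0 ?(ltW Cd0) // mulr_ge0 // ltW.
(* The hypothesis 1 <= 2^(m+1) r turns Ca / (2^m r) into at most 2 Ca. *)
have gm : increment (s *: e_ i) x <= r * (2 * Ca + Cd).
  apply: le_trans (good m (leqnn m) nbm) _; rewrite ler_wpM2l ?(ltW r0) // lerD2r.
  rewrite ler_pdivrMr // mulrAC mulrC ler_peMr ?(ltW Ca0) //.
  by rewrite mulrA -exprS.
(* Both ends are regular: either f vanishes at both and the increment is 0, or one of the two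
   indicators equals 1. *)
have := regular_dichotomy (reg 0 _); rewrite scale0r addr0 lexx (ltW (jr0 m)).
move=> /(_ isT) [fx0|fxC].
  have [fs0|fsC] := regular_dichotomy (reg s (sjr m)).
    by rewrite /increment fx0 fs0 subrr normr0 mulr_ge0.
  rewrite [\1__ (x + _)]indicE mem_set // mulrDr mulr1; apply: le_trans gm _.
  by rewrite lerDr mulr_ge0.
rewrite [\1__ x]indicE mem_set // mulrDr mulr1; apply: le_trans gm _.
by rewrite lerDl mulr_ge0.
Qed.

Lemma integral_increment_axis i (r s : R) (m : nat) :
  0 <= s <= r -> 0 < r -> 2 ^+ m * r <= 1 -> 1 <= 2 ^+ m.+1 * r ->
  (\int[leb]_x (f x)%:E = 1)%E ->
  (\int[leb]_x (increment (s *: e_ i) x)%:E <=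
     (Ca * (C1 * r) + m%:R * (2 * C1 * (Ca + Cd) * r) + 2 / C0 * (r * (2 * Ca + Cd)))%:E)%E.
Proof.
move=> sr r0 mr1 mr2 f1.
have jr0 j : 0 < 2 ^+ j * r by rewrite mulr_gt0 // exprn_gt0.
have [W WP] := choice (fun j => bad_cover i (jr0 j)).
have badW j : bad i (2 ^+ j * r) `<=` W j by have [] := WP j.
have mW j : measurable (W j) by have [] := WP j.
have lebW j : (leb (W j) <= (C1 * (2 ^+ j * r))%:E)%E by have [] := WP j.
have mS : measurable [set x | C0 <= f x].
  rewrite (_ : [set _ | _] = f @^-1` `[C0, +oo[); last first.
    by apply/seteqP; split=> x /=; rewrite in_itv /= andbT.
  by rewrite -[X in measurable X]setTI; exact: mf.
have lebS : (leb [set x | (C0 <= f x)%R] <= (C0^-1)%:E)%E.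
  by apply: le_trans lebesgue_rV_support _; rewrite f1 mule1.
have term0 j : 0 <= r * (Ca / (2 ^+ j * r) + Cd).
  by rewrite mulr_ge0 ?(ltW r0) // addr_ge0 ?(ltW Cd0) // divr_ge0 ?(ltW Ca0) ?(ltW (jr0 j)).
have K0 : 0 <= r * (2 * Ca + Cd).
  by rewrite mulr_ge0 ?(ltW r0) // addr_ge0 ?(ltW Cd0) // mulr_ge0 // ltW.
have mS1 : measurable_fun setT (\1_[set x | C0 <= f x] : 'rV[R]_d -> R).
  exact: measurable_indic.
have mSs : measurable_fun setT (fun x => \1_[set x | C0 <= f x] (x + s *: e_ i) : R).
  exact: (measurableT_comp mS1 (measurable_addv _)).
have mterm j : measurable_fun setT (fun x => r * (Ca / (2 ^+ j * r) + Cd) * \1_(W j.+1) x).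
  by apply: measurable_funM => //; exact: measurable_indic.
have sum0 x : 0 <= \sum_(j < m) r * (Ca / (2 ^+ j * r) + Cd) * \1_(W j.+1) x.
  by apply: sumr_ge0 => j _; rewrite mulr_ge0.
apply: (@le_trans _ _ (\int[leb]_x (Ca * \1_(W 0%N) x +
     \sum_(j < m) r * (Ca / (2 ^+ j * r) + Cd) * \1_(W j.+1) x +
     r * (2 * Ca + Cd) * (\1_[set x | C0 <= f x] x + \1_[set x | C0 <= f x] (x + s *: e_ i)))%:E)%E).
  apply: ae_ge0_le_integral => //.
  - by move=> x _; rewrite lee_fin; exact: normr_ge0.
  - by apply/measurable_EFinP; exact: measurable_increment.
  - move=> x _; rewrite lee_fin; apply: addr_ge0; last by rewrite mulr_ge0 // addr_ge0.
    by apply: addr_ge0 => //; rewrite mulr_ge0 // ltW.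
  - apply/measurable_EFinP; apply: measurable_funD.
      apply: measurable_funD; last exact: measurable_sum.
      by apply: measurable_funM => //; exact: measurable_indic.
    by apply: measurable_funM => //; exact: measurable_funD.
  - apply: filterS (increment_pointwise sr r0 mr1 mr2 badW) => x h _.
    by rewrite lee_fin.
apply: integralD_le.
- apply: measurable_funD; last exact: measurable_sum.
  by apply: measurable_funM => //; exact: measurable_indic.
- by apply: measurable_funM => //; exact: measurable_funD.
- by move=> x; rewrite addr_ge0 // mulr_ge0 // ltW.
- by move=> x; rewrite mulr_ge0 // addr_ge0.
- apply: integralD_le => //.
  + by apply: measurable_funM => //; exact: measurable_indic.
  + exact: measurable_sum.
  + by move=> x; rewrite mulr_ge0 // ltW.
  + by apply: integral_indic_le; rewrite ?(ltW Ca0) //; have := lebW 0%N; rewrite expr0 mul1r.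
  + apply: (@le_trans _ _ (\sum_(j < m) r * (Ca / (2 ^+ j * r) + Cd) * (C1 * (2 ^+ j.+1 * r)))%:E).
      apply: (@integral_sum_le _ _ _ _ m
        (fun j x => r * (Ca / (2 ^+ j * r) + Cd) * \1_(W j.+1) x)
        (fun j => r * (Ca / (2 ^+ j * r) + Cd) * (C1 * (2 ^+ j.+1 * r)))) => //.
        by move=> j x; rewrite mulr_ge0.
      by move=> j _; apply: integral_indic_le; [exact: term0|exact: mW|exact: lebW].
    rewrite lee_fin (_ : m%:R * _ = \sum_(j < m) (2 * C1 * (Ca + Cd) * r)); last first.
      by rewrite sumr_const card_ord mulr_natl.
    apply: ler_sum => j _.
    have C10 : 0 <= C1 by rewrite /C1 !mulr_ge0 ?exprn_ge0 // ltW.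
    rewrite [leLHS](_ : _ = 2 * C1 * r * (Ca + Cd * (2 ^+ j * r))); last first.
      by rewrite exprS; field; rewrite !gt_eqF //= exprn_gt0.
    rewrite [leRHS]mulrAC; apply: ler_wpM2l; first by rewrite !mulr_ge0 // ltW.
    rewrite lerD2l.
    rewrite ler_piMr ?(ltW Cd0) //; apply: le_trans mr1.
    by rewrite ler_pM2r // ler_eXn2l ?ltr1n // ltnW.
- rewrite [X in (_ <= X%:E)%E]mulrC; apply: integralZ_le => //.
  + exact: measurable_funD.
  + rewrite (_ : 2 / C0 = C0^-1 + C0^-1); last by rewrite mulr_natl mulr2n.
    have lebS1 : (\int[leb]_x (\1_[set x | C0 <= f x] x)%:E <= (C0^-1)%:E)%E.
      by rewrite integral_indic // setIT.
    apply: integralD_le => //.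
    rewrite (ge0_integral_lebesgue_rV_addv (s *: e_ i)
      (h := fun x => (\1_[set x | C0 <= f x] x)%:E)) //.
    exact/measurable_EFinP.
Qed.

(** The triangle inequality through x + w, followed by translation invariance. Increments along the
    axes therefore control increments in all directions, at the cost of a factor d. *)
Lemma integral_incrementD (v w : 'rV[R]_d) :
  (\int[leb]_x (increment (v + w) x)%:E <=
   \int[leb]_x (increment v x)%:E + \int[leb]_x (increment w x)%:E)%E.
Proof.
have inc0 u x : (0 <= (increment u x)%:E)%E by rewrite lee_fin; exact: normr_ge0.
have minc u : measurable_fun setT (fun x => (increment u x)%:E).
  by apply/measurable_EFinP; exact: measurable_increment.
have mincD : measurable_fun setT (fun x => (increment v (x + w))%:E).
  exact: (measurableT_comp (minc v) (measurable_addv w)).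
rewrite -(ge0_integral_lebesgue_rV_addv w (minc v) (inc0 v)) -ge0_integralD //.
apply: ge0_le_integral => //; first exact: emeasurable_funD.
move=> x _; rewrite -EFinD lee_fin /increment -addrA [w + v]addrC.
exact: ler_distD.
Qed.

Lemma integral_increment0 : (\int[leb]_x (increment 0 x)%:E = 0)%E.
Proof.
rewrite -[RHS](@integral0 _ _ _ leb setT); apply: eq_integral => x _.
by rewrite /increment addr0 subrr normr0.
Qed.

Lemma integral_incrementN (v : 'rV[R]_d) :
  (\int[leb]_x (increment (- v) x)%:E = \int[leb]_x (increment v x)%:E)%E.
Proof.
rewrite -[RHS](ge0_integral_lebesgue_rV_addv (- v)
  (h := fun x => (increment v x)%:E)).
- by apply: eq_integral => x _; rewrite /increment subrK distrC.
- by apply/measurable_EFinP; exact: measurable_increment.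
- by move=> x; rewrite lee_fin; exact: normr_ge0.
Qed.

Hypothesis f1 : (\int[leb]_x (f x)%:E = 1)%E.

Let A (r : R) (m : nat) : R := Ca * (C1 * r) + m%:R * (2 * C1 * (Ca + Cd) * r) +
  2 / C0 * (r * (2 * Ca + Cd)).

Lemma integral_increment (r : R) (m : nat) (v : 'rV[R]_d) :
  0 < r -> 2 ^+ m * r <= 1 -> 1 <= 2 ^+ m.+1 * r ->
  (forall i, `|v ord0 i| <= r) ->
  (\int[leb]_x (increment v x)%:E <= (d%:R * A r m)%:E)%E.
Proof.
move=> r0 mr1 mr2 vr.
have axis i : (\int[leb]_x (increment (v ord0 i *: e_ i) x)%:E <= (A r m)%:E)%E.
  have [v0|v0] := leP 0 (v ord0 i).
    apply: integral_increment_axis => //; rewrite v0.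
    by apply: le_trans (vr i); exact: ler_norm.
  rewrite -[v ord0 i]opprK scaleNr integral_incrementN.
  apply: integral_increment_axis => //; rewrite oppr_ge0 ltW //=.
  by apply: le_trans (vr i); rewrite ltr0_norm.
have key (t : seq 'I_d) :
    (\int[leb]_x (increment (\sum_(j <- t) v ord0 j *: e_ j) x)%:E <=
     ((size t)%:R * A r m)%:E)%E.
  elim: t => [|i t IH]; first by rewrite big_nil mul0r integral_increment0.
  rewrite big_cons; apply: le_trans (integral_incrementD _ _) _.
  by rewrite /= -natr1 addrC mulrDl mul1r EFinD leeD.
rewrite [v]row_sum_delta; have := key (index_enum 'I_d).
by rewrite {2}/index_enum -enumT -cardT card_ord.
Qed.

Variable p : \bar R.
Hypothesis p1 : (1 <= p)%E.
Hypothesis d0 : (0 < d)%N.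
Let c := unit_ball_volume d p.

(** The difference is an integral of increments over displacements h in the ball. After the exchange
    of integrals each h contributes the L1 norm of its increment, and the coordinates of h are at
    most r because the l_p norm dominates them. *)
Lemma integral_ball_average (r : R) (m : nat) (P : 'rV[R]_d -> R) :
  0 < r -> 2 ^+ m * r <= 1 -> 1 <= 2 ^+ m.+1 * r ->
  measurable_fun setT P ->
  (forall x, (\int[leb]_(y in [set y | (lp_norm p (y - x) <= r)%R]) (f y)%:E = (P x)%:E)%E) ->
  (\int[leb]_x (`|P x - f x * (c * r ^+ d)|)%:E <=
     (c * r ^+ d * (d%:R * A r m))%:E)%E.
Proof.
move=> r0 mr1 mr2 mP PE.
pose B := [set v : 'rV[R]_d | lp_norm p v <= r].
have mB : measurable B by exact: measurable_lp_ball.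
have lebB : leb B = (c * r ^+ d)%:E by apply: lebesgue_rV_lp_ball => //; exact: ltW.
have mxh : measurable_fun setT (fun u : 'rV[R]_d * 'rV[R]_d => u.1 + u.2).
  apply/measurable_fun_rVP => i; under eq_fun do rewrite mxE.
  by apply: measurable_funD; apply: (measurableT_comp (measurable_coord i)).
pose G (u : 'rV[R]_d * 'rV[R]_d) : \bar R := (increment u.2 u.1 * \1_B u.2)%:E.
have mG : measurable_fun setT G.
  apply/measurable_EFinP; apply: measurable_funM.
    apply: measurableT_comp => //; apply: measurable_funB.
      exact: measurableT_comp.
    exact: measurableT_comp.
  by apply: measurableT_comp => //; exact: measurable_indic.
have G0 u : (0 <= G u)%E.
  by rewrite lee_fin mulr_ge0 //; exact: normr_ge0.
have PE' x : (P x)%:E = (\int[leb]_h (f (x + h) * \1_B h)%:E)%E.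
  rewrite -PE integral_mkcond -[LHS](ge0_integral_lebesgue_rV_addv x).
  - apply: eq_integral => h _; rewrite patchE indicE.
    rewrite [X in if X then _ else _](_ : _ = (h \in B)); last first.
      by apply/idP/idP; rewrite !inE /B /= addrK.
    by case: ifP => _; rewrite ?mulr1 ?mulr0 // addrC.
  - apply/(measurable_restrictT _ _).1 => //.
      by rewrite -[X in measurable X]setTI; exact: (measurable_addv (- x) measurableT mB).
    by apply/measurable_EFinP; exact: measurable_funS mf.
  - by move=> y; rewrite patchE; case: ifP => // _; rewrite lee_fin.
have m1B : measurable_fun setT (\1_B : 'rV[R]_d -> R) by exact: measurable_indic.
have QE x : (f x * (c * r ^+ d))%:E = (\int[leb]_h (f x * \1_B h)%:E)%E.
  under eq_integral do rewrite EFinM.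
  rewrite ge0_integralZl_EFin //; last exact/measurable_EFinP.
  by rewrite integral_indic // setIT EFinM -lebB.
have mfx x : measurable_fun setT (fun h => f (x + h)).
  under eq_fun do rewrite addrC.
  exact: (measurableT_comp mf (measurable_addv x)).
have mincx x : measurable_fun setT (fun h => increment h x).
  by apply: measurableT_comp => //; exact: measurable_funB.
have mM1 (g : 'rV[R]_d -> R) : measurable_fun setT g ->
    measurable_fun setT (fun h => (g h * \1_B h)%:E).
  by move=> mg; apply/measurable_EFinP; exact: measurable_funM.
have mf1 x := mM1 _ (mfx x).
have mf2 x : measurable_fun setT (fun h => (f x * \1_B h)%:E) by exact: mM1.
have pw x : ((`|P x - f x * (c * r ^+ d)|)%:E <= \int[leb]_h G (x, h))%E.
  (* The absolute value is split into two inequalities between integrals of nonnegative functions,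
     so that only an infinite right-hand side has to be set apart. *)
  have [->|/eqP Ify] := eqVneq (\int[leb]_h G (x, h))%E +oo%E; first by rewrite leey.
  have I0 : (0 <= \int[leb]_h G (x, h))%E by apply: integral_ge0.
  have Ifin : (\int[leb]_h G (x, h))%E \is a fin_num by rewrite ge0_fin_numE // ltey; apply/eqP.
  have mG1 : measurable_fun setT (fun h => G (x, h)).
    exact: mM1 (mincx x).
  have h1 : ((P x)%:E <= (f x * (c * r ^+ d))%:E + \int[leb]_h G (x, h))%E.
    rewrite PE' QE -ge0_integralD //; last by move=> h _; rewrite lee_fin mulr_ge0.
    apply: ge0_le_integral => //.
    - by move=> h _; rewrite lee_fin mulr_ge0.
    - exact: emeasurable_funD.
    - move=> h _; rewrite -EFinD lee_fin -mulrDl ler_wpM2r // /increment /=.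
      by rewrite -lerBlDl ler_norm.
  have h2 : ((f x * (c * r ^+ d))%:E <= (P x)%:E + \int[leb]_h G (x, h))%E.
    rewrite PE' QE -ge0_integralD //; last by move=> h _; rewrite lee_fin mulr_ge0.
    apply: ge0_le_integral => //.
    - by move=> h _; rewrite lee_fin mulr_ge0.
    - exact: emeasurable_funD.
    - move=> h _; rewrite -EFinD lee_fin -mulrDl ler_wpM2r // /increment /=.
      by rewrite -lerBlDl distrC ler_norm.
  move: h1 h2; rewrite -(fineK Ifin) -!EFinD !lee_fin ler_norml; lra.
apply: (@le_trans _ _ (\int[leb]_x \int[leb]_h G (x, h))%E).
  apply: ge0_le_integral => //.
  - by apply/measurable_EFinP/measurableT_comp => //; apply: measurable_funB => //; exact: measurable_funM.
  - exact: measurable_fun_fubini_tonelli_F.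
rewrite (fubini_tonelli _ mG G0).
have GE h : (\int[leb]_x G (x, h) = (\1_B h)%:E * \int[leb]_x (increment h x)%:E)%E.
  rewrite -ge0_integralZl_EFin //.
  - by apply: eq_integral => x _; rewrite /G /= mulrC EFinM.
  - by move=> x _; rewrite lee_fin; exact: normr_ge0.
  - by apply/measurable_EFinP; exact: measurable_increment.
have A0 : 0 <= d%:R * A r m.
  have C10 : 0 <= C1 by rewrite /C1 !mulr_ge0 ?exprn_ge0 // ltW.
  have Ca' := ltW Ca0; have C0' := ltW C00; have Cd' := ltW Cd0; have r' := ltW r0.
  apply: mulr_ge0 => //; rewrite /A; apply: addr_ge0; first apply: addr_ge0.
  - by apply: mulr_ge0 => //; exact: mulr_ge0.
  - apply: mulr_ge0 => //; apply: mulr_ge0 => //; apply: mulr_ge0; last exact: addr_ge0.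
    exact: mulr_ge0.
  - apply: mulr_ge0; first exact: divr_ge0.
    by apply: mulr_ge0 => //; apply: addr_ge0 => //; exact: mulr_ge0.
apply: (@le_trans _ _ (\int[leb]_h ((d%:R * A r m) * \1_B h)%:E)%E); last first.
  by rewrite [c * _ * _]mulrC; apply: integral_indic_le => //; rewrite -lebB.
apply: ge0_le_integral => //.
- by move=> h _; exact: integral_ge0.
- exact: measurable_fun_fubini_tonelli_G.
- by apply/measurable_EFinP/measurable_funM.
- move=> h _; rewrite GE [_ * \1_B h]mulrC EFinM.
  have [hB|hB] := boolP (h \in B); last by rewrite indicE (negbTE hB) !mul0e.
  apply: lee_wpmul2l; first by rewrite lee_fin.
  apply: integral_increment => // i.
  by apply: le_trans (ler_coord_lp_norm _ _ p1) _; move: hB; rewrite inE.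
Qed.

End regularity.

Section density.
Context {R : realType} {d : nat}.
Local Notation leb := (lebesgue_rV R d).
Variable f : 'rV[R]_d -> R.
Hypothesis mf : measurable_fun setT f.
Hypothesis f0 : forall x, 0 <= f x.

(* The exponential decay forces f to be at least C0 wherever it is positive:
   the mass of {f <= c} is at most e^(bc) Cc e^(-C0 b), which vanishes for
   c < C0 as b grows. *)
Lemma ae_dichotomy (Cc C0 : R) : 0 < C0 -> 0 < Cc ->
  (forall b : R, 1 < b ->
     (\int[leb]_x (f x * expR (- (b * f x)))%:E <= (Cc * expR (- (C0 * b)))%:E)%E) ->
  {ae leb, forall x, f x = 0 \/ C0 <= f x}.
Proof.
move=> C00 Cc0 hb.
have mS c : measurable [set x | f x <= c].
  rewrite (_ : [set _ | _] = f @^-1` `]-oo, c]); last first.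
    by apply/seteqP; split=> x /=; rewrite in_itv.
  by rewrite -[X in measurable X]setTI; exact: mf.
have null c : c < C0 -> (\int[leb]_x (f x * \1_[set x | f x <= c] x)%:E = 0)%E.
  move=> cC; apply/eqP; rewrite eq_le integral_ge0 ?andbT; last first.
    by move=> x _; rewrite lee_fin mulr_ge0.
  have bnd b : 1 < b -> (\int[leb]_x (f x * \1_[set x | f x <= c] x)%:E <=
      (Cc * expR (- ((C0 - c) * b)))%:E)%E.
    move=> b1; have b0 : 0 < b by apply: lt_trans b1.
    apply: (@le_trans _ _ (\int[leb]_x (expR (b * c) * (f x * expR (- (b * f x))))%:E)%E).
      apply: ge0_le_integral => //.
      - by move=> x _; rewrite lee_fin mulr_ge0.
      - by apply/measurable_EFinP/measurable_funM => //; exact: measurable_indic.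
      - apply/measurable_EFinP/measurable_funM => //; apply: measurable_funM => //.
        apply: measurableT_comp => //; apply: measurableT_comp => //.
        exact: measurable_funM.
      move=> x _; rewrite lee_fin mulrCA ler_wpM2l // -expRD indicE.
      case: (boolP (x \in _)) => [|_]; last exact: expR_ge0.
      rewrite inE /= => fxc; rewrite -expR0 ler_expR -mulrBr mulr_ge0 ?(ltW b0) //.
      by rewrite subr_ge0.
    apply: (@le_trans _ _ (expR (b * c) * (Cc * expR (- (C0 * b))))%:E).
      apply: integralZ_le; last exact: hb.
      - exact: expR_ge0.
      - apply: measurable_funM => //; apply: measurableT_comp => //.
        by apply: measurableT_comp => //; exact: measurable_funM.
      - by move=> x; rewrite mulr_ge0 // expR_ge0.
    rewrite lee_fin mulrCA -expRD ler_wpM2l ?(ltW Cc0) // ler_expR.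
    by rewrite mulrBl opprB (mulrC b) addrC.
  apply/lee_addgt0Pr => e e0; rewrite add0e.
  (* As exp y >= 1 + y, any b beyond Cc / ((C0 - c) e) brings the bound below e; the maximum with 2
     meets the constraint 1 < b. *)
  pose b := Num.max 2 (Cc / ((C0 - c) * e)).
  have b1 : 1 < b by rewrite lt_max ltr1n.
  have Cc1 : 0 < C0 - c by rewrite subr_gt0.
  apply: le_trans (bnd b b1) _; rewrite lee_fin expRN ler_pdivrMr ?expR_gt0 //.
  have h : Cc / ((C0 - c) * e) <= b by rewrite le_max lexx orbT.
  rewrite ler_pdivrMr ?mulr_gt0 // in h.
  apply: le_trans h _; rewrite mulrA mulrC [b * _]mulrC ler_wpM2l ?(ltW e0) //.
  by apply: le_trans (expR_ge1Dx _); rewrite lerDr.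
(* The condition f < C0 is the countable union of the conditions f <= C0 - 1/(n+1), to each of which
   [null] applies. *)
have Pn n : {ae leb, forall x, f x * \1_[set x | f x <= C0 - n.+1%:R^-1] x = 0}.
  have cn : C0 - n.+1%:R^-1 < C0 by rewrite ltrBlDr ltrDl invr_gt0.
  have mg : measurable_fun setT
      (fun x => (f x * \1_[set x | f x <= C0 - n.+1%:R^-1] x)%:E).
    by apply/measurable_EFinP/measurable_funM => //; exact: measurable_indic.
  have /(ae_eq_integral_abs _ measurableT mg) : (\int[leb]_x
      `|(f x * \1_[set x | f x <= C0 - n.+1%:R^-1] x)%:E| = 0)%E.
    rewrite -[RHS](null _ cn); apply: eq_integral => x _.
    by rewrite gee0_abs // lee_fin mulr_ge0.
  by move=> h; apply: filterS h => x h; apply: EFin_inj; exact: h.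
have := ae_foralln Pn.
apply: filterS => x Px; have [->|fx0] := eqVneq (f x) 0; [by left|right].
rewrite leNgt; apply/negP => /ltr_add_invr[n fxn].
have := Px n; rewrite indicE mem_set ?mulr1; first exact/eqP.
by rewrite /= lerBrDr ltW.
Qed.

Lemma half_le_ln2 : (2^-1 : R) <= ln 2.
Proof.
rewrite -ler_expR lnK ?posrE // -[_^-1]opprK expRN invf_ple ?posrE ?expR_gt0 //.
by apply: le_trans (expR_ge1Dx _); lra.
Qed.

(** Here m is the integer part of the binary logarithm of 1/r; the factor 2 comes from ln 2 >=
    1/2. *)
Lemma dyadic_scale (r : R) : 0 < r -> r <= 1 ->
  exists m, [/\ 2 ^+ m * r <= 1, 1 <= 2 ^+ m.+1 * r & m%:R <= 2 * ln r^-1].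
Proof.
move=> r0 r1; have ri1 : 1 <= r^-1 by rewrite invf_ge1.
have n0 : (0 < Num.truncn r^-1)%N by rewrite truncn_gt0.
have /andP[h1 h2] := trunc_log_bounds (isT : 1 < 2)%N n0.
set m := trunc_log 2 _ in h1 h2; exists m.
have mr : 2 ^+ m <= r^-1.
  rewrite -natrX; apply: le_trans (_ : (Num.truncn r^-1)%:R <= _); first by rewrite ler_nat.
  by rewrite truncn_le // (le_trans _ ri1).
split; first by rewrite -ler_pdivlMr // div1r.
- rewrite -ler_pdivrMr // div1r ltW //; apply: lt_le_trans (truncnS_gt _) _.
  by rewrite -natrX ler_nat.
- have : ln (2 ^+ m) <= ln r^-1 by rewrite ler_ln ?posrE ?exprn_gt0 ?invr_gt0.
  rewrite lnXn // => h; have := half_le_ln2.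
  have : 0 <= m%:R :> R by [].
  rewrite -[ln 2 *+ m]mulr_natr in h; nra.
Qed.

End density.

(* Assumption A enters the argument only through these consequences; the last
   one compares the mass of a small ball with its volume in L1 norm. *)
Lemma assumption_A_consequences (R : realType) (d : nat) (f : 'rV[R]_d -> R)
    (p : \bar R) :
  (0 < d)%N -> (1 <= p)%E -> is_density f -> assumption_A f ->
  exists Ca C0 K : R, [/\ 0 < Ca, 0 < C0 & 0 < K] /\
  [/\ {ae lebesgue_rV R d, forall x, f x <= Ca},
      {ae lebesgue_rV R d, forall x, f x = 0 \/ C0 <= f x} &
      forall (r : R) (P : 'rV[R]_d -> R), 0 < r -> r <= 1 -> measurable_fun setT P ->
       (forall x, (\int[lebesgue_rV R d]_(y in [set y | (lp_norm p (y - x) <= r)%R]) (f y)%:E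
           = (P x)%:E)%E) ->
       (\int[lebesgue_rV R d]_x (`|P x - f x * (unit_ball_volume d p * r ^+ d)|)%:E <=
         (unit_ball_volume d p * r ^+ d * (K * (r * (1 + ln r^-1))))%:E)%E].
Proof.
move=> d0 p1 [mf f0 f1] [Ca [Cb [Cc [Cd [Ce [C0 [[Ca0 Cb0 Cc0 [Cd0 Ce0 C00]]]]]]]]].
move=> [fCa _ hc _ hausB].
have fC0 := ae_dichotomy mf f0 C00 Cc0 hc.
pose C1 : R := 3 * 2 ^+ d.-1 * Ce.
have C10 : 0 < C1 by rewrite /C1 !mulr_gt0 ?exprn_gt0.
pose a1 := Ca * C1; pose a2 := 2 * C1 * (Ca + Cd); pose a3 := 2 / C0 * (2 * Ca + Cd).
have a10 : 0 < a1 by exact: mulr_gt0.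
have a20 : 0 < a2 by apply: mulr_gt0; [exact: mulr_gt0|exact: addr_gt0].
have a30 : 0 < a3.
  by apply: mulr_gt0; [exact: divr_gt0|apply: addr_gt0 => //; exact: mulr_gt0].
exists Ca, C0, (d%:R * (a1 + 2 * a2 + a3)); split.
  by split => //; rewrite mulr_gt0 ?ltr0n // addr_gt0 // addr_gt0 // mulr_gt0.
split => // r P r0 r1 mP PE.
have [m [mr1 mr2 mr3]] := dyadic_scale r0 r1.
apply: le_trans (integral_ball_average mf f0 fCa fC0 Ca0 C00 Cd0 Ce0 hausB f1 p1 d0 r0 mr1 mr2 mP PE) _.
rewrite lee_fin; apply: ler_wpM2l.
  by rewrite mulr_ge0 ?exprn_ge0 ?(ltW r0) // ltW // unit_ball_volume_gt0.
rewrite -/C1 -[leRHS]mulrA; apply: ler_wpM2l => //.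
have -> : Ca * (C1 * r) + m%:R * (2 * C1 * (Ca + Cd) * r) + 2 / C0 * (r * (2 * Ca + Cd)) =
  r * (a1 + m%:R * a2 + a3) by rewrite /a1 /a2 /a3; ring.
rewrite [leRHS]mulrCA; apply: ler_wpM2l; first exact: ltW.
clearbody a1 a2 a3.
have l0 : 0 <= ln r^-1 by rewrite ln_ge0 // invf_ge1.
have : m%:R * a2 <= 2 * ln r^-1 * a2 by rewrite ler_wpM2r // ltW.
nra.
Qed.

(** * Independent samples and the Efron-Stein inequality *)

Section product_generators.

Lemma measurable_prod_gen d1 (T1 : measurableType d1) d2 (T2 : measurableType d2)
    (G1 : set (set T1)) (G2 : set (set T2)) :
  @measurable d1 T1 = <<s G1 >> -> @measurable d2 T2 = <<s G2 >> ->
  G1 setT -> G2 setT ->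
  @measurable _ (T1 * T2)%type =
    <<s [set C | exists A B, [/\ G1 A, G2 B & C = A `*` B]] >>.
Proof.
move=> m1 m2 G1T G2T; apply/seteqP; split; last first.
  apply: smallest_sub; first exact: sigma_algebra_measurable.
  move=> _ [A [B [GA GB ->]]]; apply: measurableX.
    by rewrite m1; exact: sub_sigma_algebra.
  by rewrite m2; exact: sub_sigma_algebra.
apply: smallest_sub; first exact: smallest_sigma_algebra.
rewrite m1 m2 -!g_sigma_preimageE => C [|].
  apply: smallest_sub; first exact: smallest_sigma_algebra.
  move=> _ [A GA <-]; apply: sub_sigma_algebra; exists A, setT; split => //.
  by apply/seteqP; split => -[x y] /= [].
apply: smallest_sub; first exact: smallest_sigma_algebra.
move=> _ [A GA <-]; apply: sub_sigma_algebra; exists setT, A; split => //.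
Qed.

End product_generators.

Section iid_law.
Context dV (V : measurableType dV) (R : realType) (N : nat) (mu : probability V R).
Local Notation VN := (N.-tuple V).

(** The product law is characterized by its values on boxes instead of being constructed, so that
    the law of the given sample can be used directly. C stands for any set with the same points as
    the box, which spares rewriting sets under the measure. *)
Definition iid_law (nu : probability VN R) :=
  forall (A : 'I_N -> set V) (C : set VN), (forall i, measurable (A i)) ->
    (forall z, C z <-> forall i, A i (tnth z i)) -> nu C = (\prod_(i < N) mu (A i))%E.

Variable nu : probability VN R.
Hypothesis nuP : iid_law nu.

Definition swap (S : pred 'I_N) (u : VN * VN) : VN * VN :=
  ([tuple if S i then tnth u.2 i else tnth u.1 i | i < N],
   [tuple if S i then tnth u.1 i else tnth u.2 i | i < N]).

Lemma measurable_swap S : measurable_fun setT (swap S).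
Proof.
have m i : measurable_fun setT (fun u : VN * VN => tnth u.1 i).
  by apply: (measurableT_comp (@measurable_tnth _ _ _ i)).
have m' i : measurable_fun setT (fun u : VN * VN => tnth u.2 i).
  by apply: (measurableT_comp (@measurable_tnth _ _ _ i)).
apply: measurable_fun_pair; apply/measurable_fun_tnthP => i.
  rewrite (_ : _ \o _ = fun u : VN * VN => if S i then tnth u.2 i else tnth u.1 i).
    by case: (S i).
  by apply/funext => u; rewrite /= tnth_mktuple.
rewrite (_ : _ \o _ = fun u : VN * VN => if S i then tnth u.1 i else tnth u.2 i).
  by case: (S i).
by apply/funext => u; rewrite /= tnth_mktuple.
Qed.

Let boxes : set (set VN) := [set C | exists A : 'I_N -> set V,
  (forall i, measurable (A i)) /\ C = [set z | forall i, A i (tnth z i)]].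

Lemma measurable_tuple_box (A : 'I_N -> set V) : (forall i, measurable (A i)) ->
  measurable [set z : VN | forall i, A i (tnth z i)].
Proof.
move=> mA; have -> : [set z : VN | forall i, A i (tnth z i)] =
    \bigcap_(i in [set: 'I_N]) ((fun z : VN => tnth z i) @^-1` A i).
  by apply/seteqP; split => v h i; [move=> _; exact: h|exact: (h i I)].
apply: fin_bigcap_measurable => // i _.
by rewrite -[X in measurable X]setTI; exact: measurable_tnth.
Qed.

Let boxesI : setI_closed boxes.
Proof.
move=> _ _ [a [ma ->]] [b [mb ->]]; exists (fun i => a i `&` b i); split.
  by move=> i; exact: measurableI.
apply/seteqP; split => z; first by move=> /= [h1 h2] i; split.
by move=> h; split => i; have [] := h i.
Qed.

(** On products of boxes the exchange of coordinates between two independent copies only permutes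
    the factors. Independence is used mostly in this form, both to condition on one coordinate and
    to prove the Efron-Stein inequality. *)
Lemma swap_invariant S A : measurable A -> (nu \x nu)%E (swap S @^-1` A) = (nu \x nu)%E A.
Proof.
move=> mA; rewrite -[LHS](image_measureE _ (measurable_swap S)).
have mVN : @measurable _ VN = <<s boxes >> by exact: g_sigma_preimage_box.
have bT : boxes setT.
  by exists (fun=> setT); split => //; apply/seteqP; split.
apply: (measure_unique _ (fun=> setT) (measurable_prod_gen mVN mVN bT bT)) => //.
- move=> _ _ [A1 [B1 [a1 b1 ->]]] [A2 [B2 [a2 b2 ->]]].
  by rewrite -setXI; do 2 eexists; split; [exact: boxesI a1 a2|exact: boxesI b1 b2|].
- by move=> _; exists setT, setT; split => //; rewrite setXTT.
- by rewrite bigcup_const.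
- move=> _ [A' [B' [[a [ma aE]] [b [mb bE]] ->]]].
  rewrite [LHS]/= /image_measure /= /pushforward.
  pose a' i := if S i then b i else a i; pose b' i := if S i then a i else b i.
  have ma' i : measurable (a' i) by rewrite /a'; case: ifP.
  have mb' i : measurable (b' i) by rewrite /b'; case: ifP.
  have -> : swap S @^-1` (A' `*` B') =
      [set z : VN | forall i, a' i (tnth z i)] `*` [set z : VN | forall i, b' i (tnth z i)].
    rewrite aE bE; apply/seteqP; split => -[z1 z2] /= [h1 h2]; split => i.
    + by have := h1 i; have := h2 i; rewrite !tnth_mktuple /a'; case: ifP.
    + by have := h1 i; have := h2 i; rewrite !tnth_mktuple /b'; case: ifP.
    + by have := h1 i; have := h2 i; rewrite !tnth_mktuple /a' /b'; case: ifP.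
    + by have := h1 i; have := h2 i; rewrite !tnth_mktuple /a' /b'; case: ifP.
  have mA' : measurable A' by rewrite aE; exact: measurable_tuple_box.
  have mB' : measurable B' by rewrite bE; exact: measurable_tuple_box.
  rewrite !product_measure1E //; try exact: measurable_tuple_box.
  transitivity ((\prod_i mu (a' i)) * (\prod_i mu (b' i)))%E.
    by congr (_ * _)%E; apply: nuP.
  transitivity ((\prod_i mu (a i)) * (\prod_i mu (b i)))%E; last first.
    by congr (_ * _)%E; apply/esym/nuP => // z; rewrite ?aE ?bE.
  rewrite -!big_split /=; apply: eq_bigr => i _; rewrite /a' /b'; case: ifP => // _.
  by rewrite muleC.
- move=> _; rewrite /image_measure /= /pushforward /= preimage_setT.
  rewrite -setXTT product_measure1E //.
  apply: (@le_lt_trans _ _ (1 * 1)%E); last by rewrite mule1 ltry.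
  by apply: lee_pmul => //; exact: probability_le1.
Qed.

Lemma ge0_integral_swap S (G : VN * VN -> \bar R) : measurable_fun setT G ->
  (forall u, (0 <= G u)%E) ->
  (\int[nu \x nu]_u G (swap S u) = \int[nu \x nu]_u G u)%E.
Proof.
move=> mG G0.
rewrite -(ge0_integral_image_measure (nu \x nu)%E (measurable_swap S) mG G0).
by apply: eq_measure_integral => A mA _; exact: swap_invariant.
Qed.

Definition resample (i : 'I_N) (z : VN) (x : V) : VN :=
  [tuple if j == i then x else tnth z j | j < N].

Lemma swap1 i u : swap (pred1 i) u =
  (resample i u.1 (tnth u.2 i), resample i u.2 (tnth u.1 i)).
Proof.
by congr pair; apply: eq_from_tnth => j; rewrite !tnth_mktuple /=; case: eqP => [->|].
Qed.

Lemma iid_marginal i (B : set V) : measurable B ->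
  nu ((fun z : VN => tnth z i) @^-1` B) = mu B.
Proof.
move=> mB; rewrite (@nuP (fun j => if j == i then B else setT)).
- rewrite (bigD1 i) //= eqxx big1 ?mule1 // => j /negbTE ->; exact: probability_setT.
- by move=> j; case: ifP.
- move=> z; split => [Bz j|/(_ i)]; last by rewrite eqxx.
  by case: eqP => [->|].
Qed.

Lemma ge0_integral_marginal i (h : V -> \bar R) : measurable_fun setT h ->
  (forall x, (0 <= h x)%E) -> (\int[nu]_z h (tnth z i) = \int[mu]_x h x)%E.
Proof.
move=> mh h0; have mt : measurable_fun setT (fun z : VN => tnth z i).
  exact: measurable_tnth.
rewrite -(ge0_integral_image_measure nu mt mh h0).
by apply: eq_measure_integral => A mA _; exact: iid_marginal.
Qed.

Lemma measurable_resample i : measurable_fun setT (fun u : VN * V => resample i u.1 u.2).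
Proof.
apply/measurable_fun_tnthP => j.
rewrite (_ : _ \o _ = fun u : VN * V => if j == i then u.2 else tnth u.1 j); last first.
  by apply/funext => u; rewrite /= tnth_mktuple.
case: (j == i); first exact: measurable_snd.
exact: (measurableT_comp (@measurable_tnth _ _ _ j)).
Qed.

(** This is conditioning on the i-th coordinate: it is swapped with that of a second copy, whose
    marginal is [mu], and Tonelli's theorem separates the two integrals. *)
Lemma ge0_integral_resample i (G : VN -> \bar R) : measurable_fun setT G ->
  (forall z, (0 <= G z)%E) ->
  (\int[nu]_z G z = \int[mu]_x \int[nu]_z G (resample i z x))%E.
Proof.
move=> mG G0.
have mGr : measurable_fun setT (fun u : VN * V => G (resample i u.1 u.2)).
  exact: (measurableT_comp mG (measurable_resample i)).
have mG1 : measurable_fun setT (fun u : VN * VN => G u.1).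
  exact: (measurableT_comp mG measurable_fst).
have mG2 : measurable_fun setT (fun u : VN * VN => G (resample i u.1 (tnth u.2 i))).
  apply: (measurableT_comp mGr (g := fun u : VN * VN => (u.1, tnth u.2 i))).
  by apply: measurable_fun_pair => //; exact: (measurableT_comp (@measurable_tnth _ _ _ i)).
transitivity (\int[nu \x nu]_u G u.1)%E.
  rewrite fubini_tonelli1 //; apply: eq_integral => z _.
  rewrite /fubini_F /= integral_cst //.
  by rewrite [X in (_ * X)%E](@probability_setT _ _ _ nu) mule1.
rewrite -(ge0_integral_swap (pred1 i) mG1) //.
under eq_integral do rewrite swap1 /=.
rewrite (fubini_tonelli2 _ mG2) //.
rewrite -(ge0_integral_marginal i) //.
- have := measurable_fun_fubini_tonelli_G (m1 := nu) _ mGr (fun=> G0 _); exact.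
- by move=> x; exact: integral_ge0.
Qed.

Lemma bounded_integrable d (T : measurableType d) (P : probability T R)
    (g : T -> R) (B : R) : measurable_fun setT g -> (forall x, `|g x| <= B) ->
  P.-integrable setT (EFin \o g).
Proof.
move=> mg gB; apply: (@le_integrable _ _ _ P _ measurableT _ (cst B%:E)).
- exact/measurable_EFinP.
- move=> x _; rewrite /= lee_fin; apply: le_trans (gB x) (ler_norm _).
- exact: finite_measure_integrable_cst.
Qed.

End iid_law.

Section efron_stein.
Context dV (V : measurableType dV) (R : realType) (N : nat) (mu : probability V R).
Local Notation VN := (N.-tuple V).
Variable nu : probability VN R.
Hypothesis nuP : iid_law mu nu.
Variables (F : VN -> R) (B : R).
Hypothesis mF : measurable_fun setT F.
Hypothesis FB : forall z, `|F z| <= B.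

Let lam : probability (VN * VN)%type R := (nu \x nu)%E.
Let E (g : VN * VN -> R) : R := \int[lam]_u g u.
Let bm (g : VN * VN -> R) := measurable_fun setT g /\ exists b, forall u, `|g u| <= b.

Let bm_int g : bm g -> lam.-integrable setT (EFin \o g).
Proof. by move=> [mg [b gb]]; exact: bounded_integrable mg gb. Qed.

Let bmB g h : bm g -> bm h -> bm (fun u => g u - h u).
Proof.
move=> [mg [b gb]] [mh [c hc]]; split; first exact: measurable_funB.
by exists (b + c) => u; rewrite (le_trans (ler_normB _ _)) // lerD.
Qed.

Let bmD g h : bm g -> bm h -> bm (fun u => g u + h u).
Proof.
move=> [mg [b gb]] [mh [c hc]]; split; first exact: measurable_funD.
by exists (b + c) => u; rewrite (le_trans (ler_normD _ _)) // lerD.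
Qed.

Let bmM g h : bm g -> bm h -> bm (fun u => g u * h u).
Proof.
move=> [mg [b gb]] [mh [c hc]]; split; first exact: measurable_funM.
by exists (b * c) => u; rewrite normrM ler_pM.
Qed.

Let bm_swap S g : bm g -> bm (fun u => g (swap S u)).
Proof.
move=> [mg [b gb]]; split; last by exists b.
exact: (measurableT_comp mg (measurable_swap S)).
Qed.

Let ED g h : bm g -> bm h -> E (fun u => g u + h u) = E g + E h.
Proof. by move=> bg bh; rewrite /E RintegralD //; exact: bm_int. Qed.

Let EB g h : bm g -> bm h -> E (fun u => g u - h u) = E g - E h.
Proof. by move=> bg bh; rewrite /E RintegralB //; exact: bm_int. Qed.

Let E_le g h : bm g -> bm h -> (forall u, g u <= h u) -> E g <= E h.
Proof. by move=> bg bh gh; apply: le_Rintegral => //; exact: bm_int. Qed.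

Let E_swap S g : bm g -> E (fun u => g (swap S u)) = E g.
Proof.
move=> bg; rewrite /E /Rintegral; congr fine.
have mg : measurable_fun setT (EFin \o g) by case: bg => mg _; exact/measurable_EFinP.
have := @integral_pushforward _ _ _ _ R (swap S) (measurable_swap S) (nu \x nu)%E setT (EFin \o g) mg.
rewrite preimage_setT => H.
transitivity (\int[image_measure (nu \x nu)%E (measurable_swap S)]_u (g u)%:E)%E.
  by rewrite [RHS]H //; exact: (bm_int (bm_swap S bg)).
by apply: eq_measure_integral => A mA _; exact: (swap_invariant nuP S mA).
Qed.

Let bmF1 : bm (fun u => F u.1).
Proof. by split; [exact: (measurableT_comp mF measurable_fst)|exists B]. Qed.

Let bmF2 : bm (fun u => F u.2).
Proof. by split; [exact: (measurableT_comp mF measurable_snd)|exists B]. Qed.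

(** The functions [G k] interpolate from F of the first copy at k = 0 to F of the second at k = N.
    Swapping the single coordinate k exchanges [G k] and [G k.+1], and swapping the coordinates
    below k carries their difference to [H k]. *)
Let lo k : pred 'I_N := fun i => (i < k)%N.
Let at_ k : pred 'I_N := fun i => (i == k :> nat).
Let G k u := F (swap (lo k) u).1.
Let H k u := F u.1 - F (swap (at_ k) u).1.

Let bmG k : bm (G k).
Proof. exact: (bm_swap (lo k) bmF1). Qed.

Let bmH k : bm (H k).
Proof. by apply: bmB => //; exact: (bm_swap (at_ k) bmF1). Qed.

Let G_at k u : G k (swap (at_ k) u) = G k.+1 u.
Proof.
congr F; apply: eq_from_tnth => i; rewrite !tnth_mktuple /lo /at_ ltnS.
by case: (ltngtP i k).
Qed.

Let GS_at k u : G k.+1 (swap (at_ k) u) = G k u.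
Proof.
congr F; apply: eq_from_tnth => i; rewrite !tnth_mktuple /lo /at_ ltnS.
by case: (ltngtP i k).
Qed.

Let G_lo k u : G k (swap (lo k) u) = F u.1.
Proof.
congr F; apply: eq_from_tnth => i; rewrite !tnth_mktuple /lo.
by case: (ltngtP i k).
Qed.

Let GS_lo k u : G k.+1 (swap (lo k) u) = F (swap (at_ k) u).1.
Proof.
congr F; apply: eq_from_tnth => i; rewrite !tnth_mktuple /lo /at_ ltnS.
by case: (ltngtP i k).
Qed.

Let EZ2 g : bm g -> E (fun u => g u + g u) = 2 * E g.
Proof. by move=> bg; rewrite ED // mulr_natl mulr2n. Qed.

(** Swapping coordinate k changes the sign of the difference D of [G k] and [G k.+1], so twice the
    left side is E (H D). Then 2 H D <= H^2 + D^2, and D^2 has the same mean as H^2 by the swap of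
    the coordinates below k. *)
Let term k : E (fun u => F u.1 * (G k u - G k.+1 u)) <= 2^-1 * E (fun u => H k u * H k u).
Proof.
have bGG : bm (fun u => G k u - G k.+1 u) by exact: bmB.
have bT : bm (fun u => F u.1 * (G k u - G k.+1 u)) by exact: bmM.
have bHH : bm (fun u => H k u * H k u) by exact: bmM.
have bGG2 : bm (fun u => (G k u - G k.+1 u) * (G k u - G k.+1 u)) by exact: bmM.
have bHG : bm (fun u => H k u * (G k u - G k.+1 u)) by exact: bmM.
set T := E _; have T2 : 2 * T = E (fun u => H k u * (G k u - G k.+1 u)).
  rewrite mulr_natl mulr2n {2}/T -(E_swap (at_ k) bT) /T -ED //; last exact: bm_swap bT.
  congr E; apply/funext => u; rewrite G_at GS_at /H; ring.
have T3 : 2 * E (fun u => H k u * (G k u - G k.+1 u)) <=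
    E (fun u => H k u * H k u + (G k u - G k.+1 u) * (G k u - G k.+1 u)).
  rewrite -EZ2 //; apply: E_le; [exact: bmD|exact: bmD|] => u.
  by have := sqr_ge0 (H k u - (G k u - G k.+1 u)); rewrite expr2; lra.
have T4 : E (fun u => (G k u - G k.+1 u) * (G k u - G k.+1 u)) = E (fun u => H k u * H k u).
  rewrite -(E_swap (lo k) bGG2); congr E; apply/funext => u.
  by rewrite G_lo GS_lo.
rewrite ED // T4 -T2 in T3; lra.
Qed.

Let telescope n : E (fun u => F u.1 * (F u.1 - G n u)) <=
  \sum_(k < n) 2^-1 * E (fun u => H k u * H k u).
Proof.
elim: n => [|n IH].
  rewrite big_ord0 (_ : (fun u => _) = fun=> 0); last first.
    apply/funext => u; rewrite (_ : G 0 u = F u.1) ?subrr ?mulr0 //.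
    by congr F; apply: eq_from_tnth => i; rewrite tnth_mktuple.
  by rewrite /E Rintegral_cst // mul0r.
rewrite big_ord_recr /=; apply: le_trans (lerD IH (term n)).
rewrite -ED; try by apply: bmM => //; exact: bmB.
apply: E_le => [||u]; try by [apply: bmM => //; exact: bmB|
  apply: bmD; apply: bmM => //; exact: bmB].
by rewrite -mulrDr; lra.
Qed.

Let mean : R := \int[nu]_z F z.

Let iF : nu.-integrable setT (EFin \o F).
Proof. exact: bounded_integrable mF FB. Qed.

Let meanE : (\int[nu]_z (F z)%:E)%E = mean%:E.
Proof. by rewrite /mean /Rintegral fineK //; exact: integrable_fin_num. Qed.

Let EF1F2 : E (fun u => F u.1 * F u.2) = mean * mean.
Proof.
rewrite /E /Rintegral -(integral12_prod_meas1 (bm_int (bmM bmF1 bmF2))).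
rewrite (_ : (\int[nu]_x _)%E = (mean * mean)%:E) //.
transitivity (\int[nu]_x ((F x)%:E * mean%:E))%E.
  by apply: eq_integral => z _; rewrite /fubini_F /= -meanE -integralZl.
by rewrite integralZr // meanE.
Qed.

Let EF1 : E (fun u => F u.1) = mean.
Proof.
rewrite /E /Rintegral -(integral12_prod_meas1 (bm_int bmF1)).
rewrite (_ : (\int[nu]_x _)%E = mean%:E) // -meanE.
apply: eq_integral => z _; rewrite /fubini_F /= integral_cst //.
by rewrite [X in (_ * X)%E](@probability_setT _ _ _ nu) mule1.
Qed.

(** For two independent copies z and z' the variance is the mean of F(z) (F(z) - F(z')), which
    telescopes along the interpolation [G]. *)
Lemma efron_stein :
  (\int[nu]_z ((F z - mean) ^+ 2)%:E <=
   \sum_(k < N) (2^-1)%:E * \int[nu \x nu]_u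
     ((F u.1 - F (resample k u.1 (tnth u.2 k))) ^+ 2)%:E)%E.
Proof.
have bmc c : bm (fun=> c) by split => //; exists `|c|.
have bS : bm (fun u => (F u.1 - mean) * (F u.1 - mean)).
  by apply: bmM; apply: bmB.
have fineE g : bm g -> (\int[nu \x nu]_u (g u)%:E)%E = (E g)%:E.
  by move=> bg; rewrite /E /Rintegral fineK //; exact: integrable_fin_num (bm_int bg).
have -> : (\int[nu]_z ((F z - mean) ^+ 2)%:E = \int[nu \x nu]_u ((F u.1 - mean) * (F u.1 - mean))%:E)%E.
  rewrite fubini_tonelli1 /=.
  - apply: eq_integral => z _; rewrite /fubini_F /= integral_cst //.
    by rewrite [X in (_ * X)%E](@probability_setT _ _ _ nu) mule1 expr2.
  - by apply/measurable_EFinP; case: bS.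
  - by move=> u; rewrite lee_fin -expr2 sqr_ge0.
have -> : (\sum_(k < N) (2^-1)%:E * \int[nu \x nu]_u
     ((F u.1 - F (resample k u.1 (tnth u.2 k))) ^+ 2)%:E =
     (\sum_(k < N) 2^-1 * E (fun u => H k u * H k u))%:E)%E.
  rewrite -sumEFin; apply: eq_bigr => k _; rewrite EFinM -fineE; last exact: bmM.
  congr (_ * _)%E; apply: eq_integral => u _; congr EFin.
  by rewrite expr2 /H (_ : at_ k = pred1 k) ?swap1.
rewrite fineE // lee_fin.
apply: le_trans (telescope N).
rewrite (_ : (fun u => F u.1 * (F u.1 - G N u)) = fun u => F u.1 * F u.1 - F u.1 * F u.2); last first.
  apply/funext => u; rewrite mulrBr; congr (_ - _ * F _).
  by apply: eq_from_tnth => i; rewrite tnth_mktuple /lo ltn_ord.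
rewrite EB ?EF1F2; [|exact: bmM|exact: bmM].
rewrite (_ : (fun u => (F u.1 - mean) * (F u.1 - mean)) =
  fun u => (F u.1 * F u.1 + mean * mean) - (mean * F u.1 + mean * F u.1)); last first.
  by apply/funext => u; ring.
have bmF : bm (fun u => mean * F u.1) by exact: bmM.
have bFF : bm (fun u => F u.1 * F u.1) by exact: bmM.
rewrite EB; [|exact: bmD|exact: bmD].
rewrite ED // EZ2 //.
have -> : E (fun=> mean * mean) = mean * mean.
  rewrite /E Rintegral_cst // (_ : fine _ = 1) ?mulr1 //.
  by rewrite [X in fine X](@probability_setT _ _ _ lam).
have -> : E (fun u => mean * F u.1) = mean * mean.
  by rewrite /E RintegralZl //; [rewrite -[X in _ * X]/(E _) EF1|exact: bm_int].
lra.
Qed.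

End efron_stein.

(** The probability that a binomial variable with m trials of success probability p is less than k.
    The recursion conditions on one trial; both the counting argument and the Poisson comparison
    follow it. *)
Fixpoint binom_lt (R : realType) (k m : nat) (p : R) : R :=
  match k, m with
  | 0, _ => 0
  | _.+1, 0 => 1
  | k'.+1, m'.+1 => p * binom_lt k' m' p + (1 - p) * binom_lt k m' p
  end.

Lemma measurable_count_lt d (T : measurableType d) (I : Type) (b : I -> T -> bool)
    k (s : seq I) : (forall j, measurable [set z | b j z]) ->
  measurable [set z | (count (b^~ z) s < k)%N].
Proof.
move=> mb; elim: s k => [|j s IH] k.
  rewrite (_ : [set _ | _] = if (0 < k)%N then setT else set0); first by case: ifP.
  by case: ifP => k0; apply/seteqP; split => z //=; rewrite k0.
rewrite (_ : [set _ | _] =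
  ([set z | b j z] `&` [set z | (count (b^~ z) s < k.-1)%N]) `|`
  (~` [set z | b j z] `&` [set z | (count (b^~ z) s < k)%N])).
  by apply: measurableU; apply: measurableI => //; exact: measurableC.
apply/seteqP; split => z /=; case: (boolP (b j z)) => zB.
- by rewrite add1n => h; left; split => //; rewrite -ltnS prednK // (leq_trans _ h).
- by rewrite add0n => h; right.
- by move=> [[_ h]|[/(_ isT)]//]; rewrite add1n -ltn_predRL.
- by move=> [[//]|[]]; rewrite add0n.
Qed.

(** * Binomial law of the number of sample points in a set *)

Section counting.
Context dV (V : measurableType dV) (R : realType) (N : nat) (mu : probability V R).
Local Notation VN := (N.-tuple V).
Variable nu : probability VN R.
Hypothesis nuP : iid_law mu nu.

Lemma measurable_tnth_in i (B : set V) : measurable B ->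
  measurable [set z : VN | tnth z i \in B].
Proof.
move=> mB; rewrite (_ : [set _ | _] = (fun z : VN => tnth z i) @^-1` B).
  by rewrite -[X in measurable X]setTI; exact: measurable_tnth.
by apply/seteqP; split => z /=; rewrite inE.
Qed.

Lemma resampleE i (z : VN) (x : V) j :
  tnth (resample i z x) j = if j == i then x else tnth z j.
Proof. by rewrite tnth_mktuple. Qed.

(** That C does not depend on coordinate i is expressed as invariance under resampling it;
    conditioning on that coordinate then factors the measure. *)
Lemma indep_coord i (B : set V) (C : set VN) : measurable B -> measurable C ->
  (forall z x, C (resample i z x) <-> C z) ->
  nu ([set z | tnth z i \in B] `&` C) = (mu B * nu C)%E.
Proof.
move=> mB mC Cres; have mBi := measurable_tnth_in i mB.
have mBC := measurableI _ _ mBi mC.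
rewrite -(setIT (_ `&` C)) -integral_indic //.
rewrite (ge0_integral_resample nuP i); last 2 first.
- by apply/measurable_EFinP/measurable_indic.
- by move=> z; rewrite lee_fin.
transitivity (\int[mu]_x ((\1_B x)%:E * nu C))%E.
  apply: eq_integral => x _; rewrite -(setIT C) -integral_indic // -ge0_integralZl_EFin //.
  - apply: eq_integral => z _; rewrite -EFinM; congr EFin.
    rewrite !indicE -natrM mulnb; congr (nat_of_bool _)%:R.
    apply/idP/andP; rewrite !inE /= resampleE eqxx inE.
      by move=> [xB [/Cres Cz _]].
    by move=> [xB Cz]; split => //; split => //; exact/Cres.
  - by apply/measurable_EFinP/measurable_indic.
rewrite ge0_integralZr //.
- by rewrite integral_indic // setIT.
- by apply/measurable_EFinP/measurable_indic.
Qed.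

Lemma count_lt_law (B : set V) (p : R) k (s : seq 'I_N) : measurable B ->
  mu B = p%:E -> uniq s ->
  nu [set z | (count (fun j => tnth z j \in B) s < k)%N] = (binom_lt k (size s) p)%:E.
Proof.
move=> mB muB; elim: s k => [|j s IH] [|k] /=.
- by move=> _; rewrite (_ : [set _ | _] = set0) ?measure0 //; apply/seteqP; split.
- move=> _; rewrite (_ : [set _ | _] = setT); first exact: probability_setT.
  by apply/seteqP; split.
- by move=> _; rewrite (_ : [set _ | _] = set0) ?measure0 //; apply/seteqP; split.
move=> /andP[js us].
have mC k' : measurable [set z : VN | (count (fun j => tnth z j \in B) s < k')%N].
  by apply: measurable_count_lt => i; exact: measurable_tnth_in.
have mBj := measurable_tnth_in j mB.
have Cres k' z x : (count (fun i => tnth (resample j z x) i \in B) s < k')%N <->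
    (count (fun i => tnth z i \in B) s < k')%N.
  rewrite (@eq_in_count _ _ (fun i => tnth z i \in B)) // => i si.
  by rewrite resampleE; case: eqP => // ij; rewrite -ij si in js.
rewrite (_ : [set _ | _] =
  ([set z : VN | tnth z j \in B] `&` [set z : VN | (count (fun j => tnth z j \in B) s < k)%N]) `|`
  ([set z : VN | tnth z j \in ~` B] `&` [set z : VN | (count (fun j => tnth z j \in B) s < k.+1)%N])); last first.
  apply/seteqP; split => z /=; rewrite in_setC; case: (boolP (tnth z j \in B)) => zB.
  - by rewrite add1n ltnS => h; left.
  - by rewrite add0n => h; right.
  - by move=> [[_ h]|[//]]; rewrite add1n.
  - by move=> [[//]|[_]]; rewrite add0n.
rewrite measureU; last 3 first.
- by apply: measurableI => //; exact: mC.
- by apply: measurableI; [exact: measurable_tnth_in (measurableC mB)|exact: mC].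
- by apply/seteqP; split => // z /= [[h1 _] [h2 _]]; move: h2; rewrite in_setC h1.
have E k' (D : set V) : measurable D ->
    nu ([set z | tnth z j \in D] `&` [set z | (count (fun j => tnth z j \in B) s < k')%N])
    = (mu D * (binom_lt k' (size s) p)%:E)%E.
  move=> mD; rewrite indep_coord //; first by rewrite IH.
  by move=> z x; exact: Cres.
transitivity ((mu B * (binom_lt k (size s) p)%:E) +
    (mu (~` B) * (binom_lt k.+1 (size s) p)%:E))%E.
  by congr (_ + _)%E; apply: E => //; exact: measurableC.
by rewrite probability_setC // muB -EFinB -!EFinM -EFinD.
Qed.

Lemma indep_pair i j (B : set V) (p : R) : measurable B -> mu B = p%:E -> i != j ->
  nu ([set z | tnth z i \in B] `&` [set z | tnth z j \in B]) = (p * p)%:E.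
Proof.
move=> mB muB ij; have mBj := measurable_tnth_in j mB.
rewrite indep_coord //.
  rewrite muB EFinM; congr (_ * _)%E.
  rewrite (_ : [set _ | _] = (fun z : VN => tnth z j) @^-1` B).
    by rewrite (iid_marginal nuP).
  by apply/seteqP; split => z /=; rewrite inE.
by move=> z x /=; rewrite resampleE eq_sym (negbTE ij).
Qed.

End counting.

Section density.
Context d (T : measurableType d) (R : realType) (m : {measure set T -> \bar R}).
Variable w : T -> R.
Hypothesis mw : measurable_fun setT w.
Hypothesis w0 : forall x, 0 <= w x.

Import HBNNSimple.

Lemma ge0_integral_density (nu : {measure set T -> \bar R}) (h : T -> \bar R) :
  (forall A, measurable A -> nu A = \int[m]_(x in A) (w x)%:E)%E ->
  measurable_fun setT h -> (forall x, (0 <= h x)%E) ->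
  (\int[nu]_x h x = \int[m]_x (h x * (w x)%:E))%E.
Proof.
move=> nuE mh h0; pose f := nnsfun_approx measurableT mh.
have mEw : measurable_fun setT (fun x => (w x)%:E) by apply/measurable_EFinP.
have -> : (\int[nu]_x h x = limn (fun n => \int[nu]_x (f n x)%:E))%E.
  rewrite -monotone_convergence //.
  - by apply: eq_integral => x _; apply/esym/cvg_lim => //; exact: cvg_nnsfun_approx.
  - by move=> n; exact/measurable_EFinP/measurable_funP.
  - by move=> n x _; rewrite lee_fin.
  - by move=> x _ a b ab; rewrite lee_fin; exact/lefP/nd_nnsfun_approx.
have -> : (\int[m]_x (h x * (w x)%:E) = limn (fun n => \int[m]_x ((f n x)%:E * (w x)%:E)))%E.
  rewrite -monotone_convergence //.
  - apply: eq_integral => x _; apply/esym/cvg_lim => //; apply: cvgeZr => //.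
    exact: cvg_nnsfun_approx.
  - by move=> n; apply/emeasurable_funM => //; exact/measurable_EFinP/measurable_funP.
  - by move=> n x _; rewrite mule_ge0 ?lee_fin.
  - by move=> x _ a b ab; rewrite lee_wpmul2r ?lee_fin //; exact/lefP/nd_nnsfun_approx.
congr (limn _); apply/funext => n.
have mind r : measurable_fun setT (\1_(f n @^-1` [set r]) : T -> R) by exact: measurable_indic.
transitivity (\sum_(r \in range (f n)) \int[nu]_x (r * \1_(f n @^-1` [set r]) x)%:E)%E.
  under eq_integral do rewrite fimfunE -fsumEFin //.
  rewrite ge0_integral_fsum //.
  - by move=> r; exact/measurable_EFinP/measurable_funM.
  - by move=> r x _; rewrite nnfun_muleindic_ge0.
transitivity (\sum_(r \in range (f n)) \int[m]_x ((r * \1_(f n @^-1` [set r]) x)%:E * (w x)%:E))%E; last first.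
  rewrite -ge0_integral_fsum //.
  - apply: eq_integral => x _; rewrite fimfunE -fsumEFin // ge0_mule_fsuml //.
    by move=> r; rewrite nnfun_muleindic_ge0.
  - by move=> r; apply: emeasurable_funM => //; exact/measurable_EFinP/measurable_funM.
  - by move=> r x _; apply: mule_ge0; [rewrite EFinM nnfun_muleindic_ge0|rewrite lee_fin].
apply: eq_fsbigr => r; rewrite inE => -[x _ <-]; have r0 : 0 <= f n x by [].
have mA : measurable (f n @^-1` [set f n x]) by [].
under eq_integral do rewrite EFinM.
rewrite ge0_integralZl_EFin //; last exact/measurable_EFinP.
under [RHS]eq_integral do rewrite EFinM -muleA.
rewrite ge0_integralZl_EFin //; last 2 first.
- by move=> y _; rewrite mule_ge0 ?lee_fin.
- by apply: emeasurable_funM => //; exact/measurable_EFinP.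
congr (_ * _)%E; rewrite integral_indic // setIT nuE //.
rewrite integral_mkcond; apply: eq_integral => y _; rewrite patchE indicE.
by case: ifP => _; rewrite ?mul1e ?mul0e.
Qed.

Hypothesis w1 : (\int[m]_x (w x)%:E = 1)%E.

Let D (A : set T) : \bar R := (\int[m]_(x in A) (w x)%:E)%E.

Let D0 : D set0 = 0%E.
Proof. by rewrite /D integral_set0. Qed.

Let D_ge0 A : (0 <= D A)%E.
Proof. by apply: integral_ge0 => x _; rewrite lee_fin. Qed.

Let D_sigma_additive : semi_sigma_additive D.
Proof.
move=> /= F mF tF mUF; rewrite /D; apply: cvg_toP.
  apply: ereal_nondecreasing_is_cvgn => a b ab.
  apply: lee_sum_nneg_natr => // k _ _; apply: integral_ge0 => /= x Fkx.
  by rewrite lee_fin.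
rewrite ge0_integral_bigcup //=.
- by apply/measurable_funTS/measurable_EFinP.
- by move=> x _; rewrite lee_fin.
Qed.

Let Dm : {measure set T -> \bar R} :=
  HB.pack_for {measure set T -> \bar R} D
    (isMeasure.Build _ _ _ D D0 D_ge0 D_sigma_additive).

Definition density_prob : probability T R :=
  HB.pack_for (probability T R) (Measure.sort Dm)
    (Measure_isProbability.Build _ _ _ Dm w1).

Lemma density_probE A : density_prob A = (\int[m]_(x in A) (w x)%:E)%E.
Proof. by []. Qed.

Lemma ge0_integral_density_prob h : measurable_fun setT h -> (forall x, (0 <= h x)%E) ->
  (\int[density_prob]_x h x = \int[m]_x (h x * (w x)%:E))%E.
Proof. exact: ge0_integral_density. Qed.

End density.

(** * Poisson and Gamma laws *)

Section poisson_gamma.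
Context {R : realType}.
Implicit Types (k m : nat) (s t u p : R).

(** One formula in two roles: the weight of k under the Poisson law of mean s, and the density at s
    of the Gamma law with parameter k + 1. *)
Definition gamma_pdf k s : R := s ^+ k / k`!%:R * expR (- s).

Definition poisson_lt k s : R := \sum_(j < k) gamma_pdf j s.

Lemma gamma_pdf_ge0 k s : 0 <= s -> 0 <= gamma_pdf k s.
Proof. by move=> s0; rewrite mulr_ge0 ?expR_ge0 // divr_ge0 // exprn_ge0. Qed.

Lemma is_derive_expRN s : is_derive s (1 : R) (fun x => expR (- x)) (- expR (- s)).
Proof. by apply: is_derive_eq; rewrite mulrN1. Qed.

Lemma is_derive_gamma_pdf0 s : is_derive s (1 : R) (gamma_pdf 0) (- gamma_pdf 0 s).
Proof.
rewrite (_ : gamma_pdf 0 = fun x => expR (- x)); last first.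
  by apply/funext => x; rewrite /gamma_pdf expr0 fact0 divr1 mul1r.
exact: is_derive_expRN.
Qed.

Lemma is_derive_gamma_pdfS k s :
  is_derive s (1 : R) (gamma_pdf k.+1) (gamma_pdf k s - gamma_pdf k.+1 s).
Proof.
have h := is_derive_expRN s.
have hX : is_derive s (1 : R) (fun x : R => x ^+ k.+1) (k.+1%:R * s ^+ k).
  rewrite (_ : (fun x : R => _) = (@idfun R) ^+ k.+1); last by apply/funext => x; rewrite fctE.
  have [d1 d2] := is_deriveX (f := @idfun R) (x := s) (v := 1) k.+1 (is_derive_id s (1 : R)).
  by split => //; rewrite d2 /GRing.scale /= mulr1.
have [d1 d2] := is_deriveZ (k.+1)`!%:R^-1 (is_deriveM hX h).
have E : gamma_pdf k.+1 = (k.+1)`!%:R^-1 *: ((fun x => x ^+ k.+1) * (fun x => expR (- x))).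
  by apply/funext => x; rewrite /gamma_pdf mulrAC mulrC.
split; rewrite E // -{2}E d2 /GRing.scale /= /gamma_pdf factS natrM.
have k0 : k`!%:R != 0 :> R by rewrite pnatr_eq0 -lt0n fact_gt0.
have k1 : k.+1%:R != 0 :> R by rewrite pnatr_eq0.
rewrite exprS; move: (k.+1%:R) (k`!%:R) k0 k1 => K1 K2 K20 K10.
by field; rewrite K20 K10.
Qed.

(** The derivatives of the weights telescope to the last one. Hence the probability that a Poisson
    variable of mean s is at most k is also the probability that a Gamma variable with parameter k +
    1 exceeds s, which links counts of points to U. *)
Lemma is_derive_poisson_lt k s :
  is_derive s (1 : R) (poisson_lt k.+1) (- gamma_pdf k s).
Proof.
elim: k => [|k IH].
  rewrite (_ : poisson_lt 1 = gamma_pdf 0); first exact: is_derive_gamma_pdf0.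
  by apply/funext => x; rewrite /poisson_lt big_ord1.
rewrite (_ : poisson_lt k.+2 = poisson_lt k.+1 + gamma_pdf k.+1); last first.
  by apply/funext => x; rewrite /poisson_lt big_ord_recr.
have [d1 d2] := is_deriveD IH (is_derive_gamma_pdfS k s).
by split => //; rewrite d2; ring.
Qed.

Lemma poisson_ltS k s : poisson_lt k.+1 s = poisson_lt k s + gamma_pdf k s.
Proof. by rewrite /poisson_lt big_ord_recr. Qed.

Lemma poisson_lt0 k : poisson_lt k.+1 0 = 1.
Proof.
rewrite /poisson_lt big_ord_recl big1 ?addr0.
  by rewrite /gamma_pdf expr0 fact0 divr1 oppr0 expR0 mulr1.
by move=> i _; rewrite /gamma_pdf expr0n /= !mul0r.
Qed.

Lemma poisson_lt_ge0 k s : 0 <= s -> 0 <= poisson_lt k s.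
Proof. by move=> s0; apply: sumr_ge0 => i _; exact: gamma_pdf_ge0. Qed.

Lemma poisson_lt_MVT k s t : s <= t ->
  exists2 c, s <= c <= t & poisson_lt k.+1 s - poisson_lt k.+1 t = gamma_pdf k c * (t - s).
Proof.
rewrite le_eqVlt => /orP[/eqP ->|st].
  by exists t; rewrite ?lexx // !subrr mulr0.
have dF x : x \in `]s, t[ -> is_derive x 1 (poisson_lt k.+1) (- gamma_pdf k x).
  by move=> _; exact: is_derive_poisson_lt.
have cF : {within `[s, t], continuous (poisson_lt k.+1)}.
  apply: derivable_within_continuous => x _.
  by have [] := is_derive_poisson_lt k x.
have [c] := MVT st dF cF; rewrite in_itv /= => /andP[sc ct] E.
by exists c; rewrite ?(ltW sc) ?(ltW ct) //; lra.
Qed.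

Lemma poisson_lt_le1 k s : 0 <= s -> poisson_lt k s <= 1.
Proof.
case: k => [|k] s0; first by rewrite /poisson_lt big_ord0.
have [c /andP[c0 _]] := poisson_lt_MVT k s0; rewrite poisson_lt0 subr0.
have := mulr_ge0 (gamma_pdf_ge0 k c0) s0; lra.
Qed.

Lemma gamma_pdf_le1 k s : 0 <= s -> gamma_pdf k s <= 1.
Proof.
move=> s0; have := poisson_lt_le1 k.+1 s0; rewrite poisson_ltS.
by have := poisson_lt_ge0 k s0; lra.
Qed.

Lemma poisson_lt_lip k s t : 0 <= s -> 0 <= t ->
  `|poisson_lt k s - poisson_lt k t| <= `|s - t|.
Proof.
case: k => [|k]; first by move=> *; rewrite /poisson_lt !big_ord0 subrr normr0.
wlog st : s t / s <= t.
  move=> H s0 t0; have [/H|/ltW /H] := leP s t; first exact.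
  by rewrite distrC (distrC s); apply.
move=> s0 t0; have [c /andP[sc _] ->] := poisson_lt_MVT k st.
have c0 := le_trans s0 sc.
rewrite distrC normrM [`|t - s|]ger0_norm ?subr_ge0 // ler_piMl ?subr_ge0 //.
by rewrite ger0_norm ?gamma_pdf_le1 ?gamma_pdf_ge0.
Qed.

(** If s < t/2, the relative distance is at least 1/2 and the bound exceeds 1. Otherwise the mean
    value theorem applies at a point c >= t/2, where the derivative [gamma_pdf k.-1 c] equals k
    [gamma_pdf k c] / c and is at most 2 k / t. The denominator t is what later cancels the density
    weight. *)
Lemma poisson_lt_rel k s t : (0 < k)%N -> 0 <= s -> 0 < t ->
  `|poisson_lt k s - poisson_lt k t| <= 2 * k%:R * (`|s - t| / t).
Proof.
case: k => [//|k] _ s0 t0.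
have [st|st] := ltP s (t / 2).
  apply: (@le_trans _ _ 1).
    have := poisson_lt_ge0 k.+1 s0; have := poisson_lt_ge0 k.+1 (ltW t0).
    have := poisson_lt_le1 k.+1 s0; have := poisson_lt_le1 k.+1 (ltW t0).
    by rewrite ler_norml; lra.
  apply: (@le_trans _ _ (2 * (`|s - t| / t))).
    rewrite mulrA ler_pdivlMr // mul1r ltr0_norm; lra.
  by rewrite ler_wpM2r ?divr_ge0 ?(ltW t0) // ler_peMr // ler1n.
have key c : t / 2 <= c -> gamma_pdf k c <= 2 * k.+1%:R / t.
  move=> tc; have c0 : 0 < c by apply: lt_le_trans tc; rewrite divr_gt0.
  have := gamma_pdf_le1 k.+1 (ltW c0).
  have -> : gamma_pdf k.+1 c = gamma_pdf k c * c / k.+1%:R.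
    rewrite /gamma_pdf factS natrM exprS; field.
    by rewrite nat1r !pnatr_eq0 /= -lt0n fact_gt0.
  rewrite ler_pdivrMr ?ltr0n // mul1r => h.
  have g0 := gamma_pdf_ge0 k (ltW c0); rewrite ler_pdivlMr //.
  have : gamma_pdf k c * t <= gamma_pdf k c * (2 * c) by rewrite ler_wpM2l //; lra.
  lra.
rewrite mulrA mulrAC.
have [sl|ts] := leP s t.
  have [c /andP[sc _] ->] := poisson_lt_MVT k sl.
  rewrite normrM distrC [`|s - t|]distrC ler_wpM2r //.
  rewrite ger0_norm; [apply: key; lra|apply: gamma_pdf_ge0; lra].
have [c /andP[sc _] E] := poisson_lt_MVT k (ltW ts).
rewrite distrC E normrM ler_wpM2r //.
rewrite ger0_norm; [apply: key; lra|apply: gamma_pdf_ge0; lra].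
Qed.

Lemma gamma_pdf_lip k s t : 0 <= s -> s <= t ->
  `|gamma_pdf k t - gamma_pdf k s| <= t - s.
Proof.
move=> s0; rewrite le_eqVlt => /orP[/eqP ->|st]; first by rewrite !subrr normr0.
pose g1 x := if k is j.+1 then gamma_pdf j x - gamma_pdf j.+1 x else - gamma_pdf 0 x.
have dg (x : R) : is_derive x (1 : R) (gamma_pdf k) (g1 x).
  by rewrite /g1; case: (k) => [|j]; [exact: is_derive_gamma_pdf0|exact: is_derive_gamma_pdfS].
have cg : {within `[s, t], continuous (gamma_pdf k)}.
  by apply: derivable_within_continuous => x _; have [] := dg x.
have [c] := MVT st (fun x _ => dg x) cg; rewrite in_itv /= => /andP[sc _] ->.
have c0 : 0 <= c by rewrite (le_trans s0) // ltW.
rewrite normrM (gtr0_norm (x := t - s)) ?subr_gt0 // ler_piMl ?subr_ge0 ?(ltW st) //.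
rewrite /g1; case: (k) => [|j].
  by rewrite normrN ger0_norm ?gamma_pdf_ge0 // gamma_pdf_le1.
have := gamma_pdf_ge0 j c0; have := gamma_pdf_le1 j c0.
have := gamma_pdf_ge0 j.+1 c0; have := gamma_pdf_le1 j.+1 c0.
by rewrite ler_norml; lra.
Qed.

(* The binomial recursion reproduces the Poisson one up to a second-order
   Taylor remainder at each step. *)
Lemma binom_lt_poisson k m p : 0 <= p <= 1 ->
  `|binom_lt k m p - poisson_lt k (m%:R * p)| <= m%:R * p ^+ 2.
Proof.
move=> /andP[p0 p1]; elim: m k => [|m IH] [|k].
- by rewrite /poisson_lt /= big_ord0 subrr normr0 mul0r.
- by rewrite /= mul0r poisson_lt0 subrr normr0 mul0r.
- by rewrite /poisson_lt /= big_ord0 subrr normr0 mulr_ge0 // sqr_ge0.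
rewrite [binom_lt _ _ _]/= -natr1 !mulrDl !mul1r.
set s := m%:R * p; have s0 : 0 <= s by rewrite mulr_ge0.
have sp : s <= s + p by rewrite lerDl.
have [c /andP[sc cp] E] := poisson_lt_MVT k sp.
have h1 := IH k; have h2 := IH k.+1.
have h3 : `|gamma_pdf k c - gamma_pdf k s| <= p.
  by apply: le_trans (gamma_pdf_lip k s0 sc) _; lra.
rewrite (_ : _ - _ = p * (binom_lt k m p - poisson_lt k s) +
   (1 - p) * (binom_lt k.+1 m p - poisson_lt k.+1 s) + p * (gamma_pdf k c - gamma_pdf k s)); last first.
  have -> : poisson_lt k.+1 (s + p) = poisson_lt k.+1 s - gamma_pdf k c * p.
    by move: E; rewrite (addrC s p) addrK => E; rewrite -E; ring.
  by rewrite poisson_ltS; ring.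
apply: le_trans (ler_normD _ _) _; apply: lerD; last first.
  by rewrite normrM expr2 ger0_norm // ler_wpM2l.
apply: le_trans (ler_normD _ _) _.
rewrite !normrM (ger0_norm p0) (ger0_norm (x := 1 - p)) ?subr_ge0 //.
rewrite [leRHS](_ : _ = p * (m%:R * p ^+ 2) + (1 - p) * (m%:R * p ^+ 2)); last by ring.
by rewrite lerD // ler_wpM2l // subr_ge0.
Qed.

Lemma continuous_gamma_pdf k : continuous (gamma_pdf k).
Proof.
move=> x; apply: differentiable_continuous; apply/derivable1_diffP.
case: k => [|k]; first by have [] := is_derive_gamma_pdf0 x.
by have [] := is_derive_gamma_pdfS k x.
Qed.

Lemma poisson_lt_bound k s : 0 < s -> poisson_lt k s <= k%:R * k%:R / s.
Proof.
move=> s0; rewrite -mulrA -[X in X%:R * _]card_ord mulr_natl -sumr_const.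
apply: ler_sum => j _; have := gamma_pdf_le1 j.+1 (ltW s0).
have -> : gamma_pdf j.+1 s = gamma_pdf j s * s / j.+1%:R.
  rewrite /gamma_pdf factS natrM exprS; field.
  by rewrite nat1r !pnatr_eq0 /= -lt0n fact_gt0.
rewrite ler_pdivrMr ?ltr0n // mul1r -ler_pdivlMr // => /le_trans; apply.
by rewrite ler_wpM2r ?invr_ge0 ?(ltW s0) // ler_nat.
Qed.

Lemma poisson_lt_cvg0 k (b : R) : 0 < b -> poisson_lt k (b * x) @[x --> +oo] --> 0.
Proof.
move=> b0; apply/cvgrPdist_le => e e0; near=> x.
have x0 : 0 < x by near: x; exact: nbhs_pinfty_gt.
have bx0 : 0 < b * x by rewrite mulr_gt0.
rewrite sub0r normrN ger0_norm ?poisson_lt_ge0 ?(ltW bx0) //.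
apply: le_trans (poisson_lt_bound k bx0) _.
rewrite ler_pdivrMr // mulrCA -ler_pdivrMl //.
rewrite -ler_pdivrMl // ; near: x; apply: nbhs_pinfty_ge; exact: num_real.
Unshelve. all: by end_near. Qed.

Lemma is_derive_poisson_scale k (b u : R) :
  is_derive u (1 : R) (fun x => - poisson_lt k.+1 (b * x)) (b * gamma_pdf k (b * u)).
Proof.
have h1 : is_derive u (1 : R) (fun x : R => b * x) b.
  by apply: is_derive_eq; rewrite /GRing.scale /= mulr1.
have h := is_derive1_comp (is_derive_poisson_lt k (b * u)) h1.
have [d1 d2] := is_deriveN h.
by split => //; rewrite [LHS]d2; ring.
Qed.

Lemma integral_gamma_pdf k t : 0 <= t ->
  (\int[lebesgue_measure]_(u in `[0%R, t]) (gamma_pdf k u)%:E = (1 - poisson_lt k.+1 t)%:E)%E.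
Proof.
rewrite le_eqVlt => /orP[/eqP <-|t0].
  by rewrite set_itv1 integral_set1 poisson_lt0 subrr.
have dF (x : R) := is_derive_poisson_scale k 1 x.
have cF (x : R) : {for x, continuous (fun x : R => - poisson_lt k.+1 (1 * x))}.
  by apply: differentiable_continuous; apply/derivable1_diffP; have [] := dF x.
rewrite (@continuous_FTC2 _ _ (fun x => - poisson_lt k.+1 (1 * x))) //.
- by rewrite !mul1r poisson_lt0 -EFinB; congr EFin; ring.
- by apply: continuous_subspaceT => x; exact: continuous_gamma_pdf.
- split.
  + by move=> x _; have [] := dF x.
  + by apply: cvg_at_right_filter; exact: cF.
  + by apply: cvg_at_left_filter; exact: cF.
- by move=> x _; rewrite derive1E; have [_ ->] := dF x; rewrite !mul1r.
Qed.

Lemma integral_gamma_pdf_scale k (b : R) : 0 < b ->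
  (\int[lebesgue_measure]_(u in `[0%R, +oo[) (b * gamma_pdf k (b * u))%:E = 1)%E.
Proof.
move=> b0; have dF (x : R) := is_derive_poisson_scale k b x.
have cF (x : R) : {for x, continuous (fun x : R => - poisson_lt k.+1 (b * x))}.
  by apply: differentiable_continuous; apply/derivable1_diffP; have [] := dF x.
have cg (x : R) : {for x, continuous (fun x : R => b * gamma_pdf k (b * x))}.
  apply: continuousM; first exact: cst_continuous.
  apply: continuous_comp; last exact: continuous_gamma_pdf.
  by apply: continuousM => //; exact: cst_continuous.
rewrite (@ge0_continuous_FTC2y _ _ (fun x => - poisson_lt k.+1 (b * x)) _ 0) //.
- by rewrite mulr0 poisson_lt0 EFinN oppeK add0e.
- by move=> x x0; rewrite mulr_ge0 ?(ltW b0) // gamma_pdf_ge0 // mulr_ge0 // ltW.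
- exact: continuous_subspaceT.
- by rewrite -oppr0; apply: cvgN; exact: poisson_lt_cvg0.
- by apply: cvg_at_right_filter; exact: cF.
- by move=> x _; rewrite derive1E; have [_ ->] := dF x.
Qed.

End poisson_gamma.

Section gamma_prob.
Context {R : realType}.
Local Notation leb := (@lebesgue_measure R).
Implicit Types (k : nat) (t u x : R).

Lemma measurable_gamma_pdf k : measurable_fun setT (@gamma_pdf R k).
Proof. by apply: continuous_measurable_fun; exact: continuous_gamma_pdf. Qed.

(** For odd k the function [gamma_pdf k] is negative on the negative axis; the indicator makes it a
    density on the whole line. *)
Definition gamma_density k u : R := gamma_pdf k u * \1_(`[0, +oo[) u.

Lemma measurable_gamma_density k : measurable_fun setT (gamma_density k).
Proof. by apply: measurable_funM; [exact: measurable_gamma_pdf|exact: measurable_indic]. Qed.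

Lemma gamma_density_ge0 k u : 0 <= gamma_density k u.
Proof.
rewrite /gamma_density indicE; case: (boolP (u \in _)) => [|_]; last by rewrite mulr0.
by rewrite inE /= in_itv /= andbT => u0; rewrite mulr1 gamma_pdf_ge0.
Qed.

Lemma integral_gamma_density k (A : set R) (h : R -> \bar R) :
  measurable A -> measurable_fun setT h ->
  (\int[leb]_(u in A) (h u * (gamma_density k u)%:E) =
   \int[leb]_(u in A `&` `[0%R, +oo[) (h u * (gamma_pdf k u)%:E))%E.
Proof.
move=> mA mh; rewrite [RHS]integral_mkcondr; apply: eq_integral => u _.
rewrite patchE /gamma_density indicE; case: ifP => _; first by rewrite mulr1.
by rewrite mulr0 mule0.
Qed.

Lemma integral_gamma_density1 k : (\int[leb]_u (gamma_density k u)%:E = 1)%E.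
Proof.
have := integral_gamma_density k measurableT (measurable_cst (1%E : \bar R)).
rewrite setTI; under eq_integral do rewrite mul1e.
move=> ->; rewrite -[RHS](@integral_gamma_pdf_scale R k 1) //.
by apply: eq_integral => u _; rewrite mul1e !mul1r.
Qed.

(** The usual parameter of this Gamma law is k + 1, so for the k-th neighbour it is taken at
    [k.-1]. *)
Definition gamma_prob k : probability (measurableTypeR R) R :=
  density_prob (m := leb) (w := gamma_density k)
    (measurable_gamma_density k) (gamma_density_ge0 k) (integral_gamma_density1 k).

Lemma ge0_integral_gamma_prob k (h : R -> \bar R) : measurable_fun setT h ->
  (forall u, (0 <= h u)%E) ->
  (\int[gamma_prob k]_u h u = \int[leb]_(u in `[0%R, +oo[) (h u * (gamma_pdf k u)%:E))%E.
Proof.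
move=> mh h0; rewrite [LHS]ge0_integral_density_prob //.
by rewrite integral_gamma_density // setTI.
Qed.

Lemma gamma_prob_itv k t : 0 <= t ->
  gamma_prob k `]-oo, t]%classic = (1 - poisson_lt k.+1 t)%:E.
Proof.
move=> t0; rewrite -integral_gamma_pdf // [LHS]density_probE.
have := integral_gamma_density k (measurable_itv `]-oo, t]) (measurable_cst (1%E : \bar R)).
rewrite /cst /=; under eq_integral do rewrite mul1e.
move=> ->; rewrite (_ : _ `&` _ = `[0, t]%classic).
  by apply: eq_integral => u _; rewrite mul1e.
apply/seteqP; split => u /=; rewrite !in_itv /= ?andbT; first by move=> [-> ->].
by move=> /andP[-> ->].
Qed.

Lemma integral_powR_near0 :
  (\int[leb]_(u in `]0%R, 1%R]) (u `^ (- (3 / 4)))%:E <= 4%:E)%E.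
Proof.
(* The power is singular at 0, so the interval is exhausted from the right; starting at 1/2 keeps
   every left end strictly below 1. The primitive 4 u^(1/4) gives the constant 4. *)
pose F (n : nat) : set R := `[n.+2%:R^-1, 1]%classic.
have mF n : measurable (F n) by exact: measurable_itv.
have ndF : nondecreasing_seq F.
  move=> a b ab; rewrite subsetEset => u; rewrite /F /= !in_itv /= => /andP[h ->].
  rewrite andbT; apply: le_trans h.
  by rewrite lef_pV2 ?posrE ?ltr0n // ler_nat !ltnS.
have -> : `]0, 1]%classic = \bigcup_n F n.
  apply/seteqP; split => u /=; last first.
    move=> [n _]; rewrite /F /= !in_itv /= => /andP[h ->]; rewrite andbT.
    by apply: lt_le_trans h; rewrite invr_gt0.
  rewrite in_itv /= => /andP[u0 u1].
  have [n un] := ltr_add_invr u0; exists n => //.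
  rewrite /F /= in_itv /= u1 andbT ltW //; rewrite add0r in un.
  apply: le_lt_trans un; rewrite lef_pV2 ?posrE ?ltr0n //.
  by rewrite ler_nat.
have mp : measurable_fun setT (fun u => (u `^ (- (3 / 4)))%:E).
  by apply/measurable_EFinP; exact: measurable_powR.
have cvgF := @ge0_nondecreasing_set_cvg_integral _ (measurableTypeR R) _ F _ lebesgue_measure ndF mF
  (fun n => measurable_funS measurableT (@subsetT _ _) mp)
  (fun n x _ => powR_ge0 x (- (3 / 4))).
rewrite -(cvg_lim _ cvgF) //; apply: lime_le; first by apply/cvg_ex; eexists; exact: cvgF.
near=> n; pose a : R := n.+2%:R^-1.
have a0 : 0 < a by rewrite invr_gt0.
have a1 : a < 1 by rewrite invf_lt1 // ltr1n.
have dP (x y : R) : 0 < x -> is_derive x (1 : R) (fun u => u `^ y) (y * x `^ (y - 1)).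
  move=> x0; split; first by apply: derivable_powR; rewrite in_itv /= x0.
  by rewrite -derive1E powR_derive1 // in_itv /= x0.
pose G (u : R) := 4 * u `^ (4^-1).
have dG (x : R) : 0 < x -> is_derive x (1 : R) G (x `^ (- (3 / 4))).
  move=> x0; have [d1 d2] := is_deriveZ 4 (dP x (4^-1) x0); split => //.
  rewrite [LHS]d2 /GRing.scale /= mulrA (_ : 4 * (4^-1) = 1 :> R); last by field.
  by rewrite mul1r; congr (x `^ _); field.
have cG (x : R) : 0 < x -> {for x, continuous G}.
  by move=> x0; apply: differentiable_continuous; apply/derivable1_diffP; have [] := dG x x0.
rewrite (@continuous_FTC2 _ _ G) //.
- rewrite -EFinB lee_fin /G powR1 mulr1 lerBlDr lerDl mulr_ge0 // powR_ge0.
- apply: derivable_within_continuous => x; rewrite in_itv /= => /andP[ax _].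
  by apply: derivable_powR; rewrite in_itv /= andbT; exact: lt_le_trans ax.
- split.
  + by move=> x; rewrite in_itv /= => /andP[ax _]; have [] := dG x (lt_trans a0 ax).
  + by apply: cvg_at_right_filter; exact: cG.
  + by apply: cvg_at_left_filter; exact: cG.
- move=> x; rewrite in_itv /= => /andP[ax _]; rewrite derive1E.
  by have [_ ->] := dG x (lt_trans a0 ax).
Unshelve. all: by end_near. Qed.

(** The exponent -3/4 is still integrable at 0, yet dominates u^(-1/4) |ln u|: one majorant serves
    the logarithm, the derivative of the Gamma integral and the truncation at 1/N. *)
Definition near0 u : R := u `^ (- (3 / 4)) * \1_(`]0, 1]) u.

Lemma near0_ge0 u : 0 <= near0 u.
Proof. by rewrite mulr_ge0 // powR_ge0. Qed.

Lemma measurable_near0 : measurable_fun setT near0.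
Proof. by apply: measurable_funM; [exact: measurable_powR|exact: measurable_indic]. Qed.

Lemma near0E u : 0 < u <= 1 -> near0 u = u `^ (- (3 / 4)).
Proof. by move=> u01; rewrite /near0 indicE mem_set ?mulr1 //= in_itv. Qed.

Lemma integral_near0 : (\int[leb]_(u in `[0%R, +oo[) (near0 u)%:E <= 4%:E)%E.
Proof.
apply: le_trans integral_powR_near0; rewrite [leRHS]integral_mkcond.
apply: (@le_trans _ _ (\int[leb]_u (near0 u)%:E)%E).
  apply: ge0_subset_integral => //; first by apply/measurable_EFinP; exact: measurable_near0.
  by move=> u _; rewrite lee_fin near0_ge0.
apply: ge0_le_integral => //.
- by move=> u _; rewrite lee_fin near0_ge0.
- by apply/measurable_EFinP; exact: measurable_near0.
- apply/(measurable_restrictT _ _).1 => //.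
  by apply/measurable_EFinP; apply: measurable_funTS; exact: measurable_powR.
- move=> u _; rewrite patchE /near0 indicE.
  by case: ifP => _; rewrite ?mulr1 ?mulr0.
Qed.

(** Sublinearity of ln at u^(-1/2) gives |ln u| <= 2 u^(-1/2), and the exponents -1/2 and -1/4 add
    up to -3/4. *)
Lemma norm_ln_le_near0 u : 0 < u <= 1 -> `|ln u| * u `^ (- (4^-1)) <= 2 * near0 u.
Proof.
move=> u01; rewrite near0E //; case/andP: u01 => u0 u1.
have h : `|ln u| <= 2 * u `^ (- (2^-1)).
  rewrite ler0_norm ?ln_le0 // -lnV ?posrE //.
  have -> : u^-1 = (u `^ (- (2^-1))) ^+ 2.
    by rewrite -powR_mulrn ?powR_ge0 // -powRrM -powR_inv1 ?(ltW u0) //; apply: (f_equal (powR u)); field.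
  rewrite lnXn ?powR_gt0 // -[leLHS]mulr_natl ler_wpM2l //.
  by apply: ltW; apply: lt_le_trans (ln_sublinear _) _; rewrite ?powR_gt0.
apply: le_trans (ler_wpM2r (powR_ge0 _ _) h) _.
rewrite -mulrA ler_wpM2l // -powRD; last by rewrite (gt_eqF u0) implybT.
by have -> : - 2^-1 - 4^-1 = - (3 / 4) :> R by field.
Qed.

Lemma norm_ln_le u : 0 < u -> `|ln u| <= 2 * near0 u + u.
Proof.
move=> u0; have [u1|u1] := leP u 1.
  rewrite -[leLHS]addr0 lerD ?(ltW u0) //; apply: le_trans (norm_ln_le_near0 _); rewrite ?u0 //.
  have : u `^ 0 <= u `^ (- 4^-1) by apply: ger_powR; rewrite ?u0 //; lra.
  by rewrite powRr0 => ?; rewrite ler_peMr.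
rewrite ger0_norm ?ln_ge0 ?(ltW u1) //.
apply: le_trans (ltW (ln_sublinear u0)) _.
by rewrite lerDr mulr_ge0 // near0_ge0.
Qed.

Lemma gamma_moment_near0 k :
  (\int[gamma_prob k]_u (near0 u)%:E <= 4%:E)%E.
Proof.
rewrite ge0_integral_gamma_prob.
- have mpos : measurable_fun (`[0, +oo[%classic : set R) (fun u => (near0 u)%:E).
    by apply/measurable_EFinP; apply: measurable_funTS; exact: measurable_near0.
  apply: le_trans integral_near0; apply: ge0_le_integral => //.
  + move=> u; rewrite /= in_itv /= andbT => u0.
    by rewrite mule_ge0 // lee_fin ?near0_ge0 // gamma_pdf_ge0.
  + apply: emeasurable_funM => //; apply/measurable_EFinP; apply: measurable_funTS.
    exact: measurable_gamma_pdf.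
  + move=> u; rewrite /= in_itv /= andbT => u0.
    by rewrite -EFinM lee_fin ler_piMr ?near0_ge0 // gamma_pdf_le1.
- by apply/measurable_EFinP; exact: measurable_near0.
- by move=> u; rewrite lee_fin near0_ge0.
Qed.

(** The weight exp (u/2) uses half of the decay of exp (-u). On u >= ln N it is at least N^(1/2), so
    this moment bounds the tail contribution to the bias by order N^(-1/2). *)
Lemma gamma_moment_exp k :
  (\int[gamma_prob k]_u (`|u| * expR (u / 2))%:E = (k.+1%:R * 2 ^+ k.+2)%:E)%E.
Proof.
rewrite ge0_integral_gamma_prob.
- transitivity (\int[leb]_(u in `[0%R, +oo[)
      ((k.+1%:R * 2 ^+ k.+2)%:E * (2^-1 * gamma_pdf k.+1 (2^-1 * u))%:E))%E.
    apply: eq_integral => u; rewrite inE /= in_itv /= andbT => u0.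
    rewrite -!EFinM ger0_norm //; congr EFin.
    rewrite /gamma_pdf factS natrM exprMn exprVn !exprS.
    have -> : expR (- u) = expR (- (2^-1 * u)) * (expR (u / 2))^-1.
      by rewrite -expRN -expRD; congr expR; field.
    have := expR_gt0 (u / 2); have : (2 : R) ^+ k != 0 by rewrite expf_eq0 pnatr_eq0 andbF.
    have : k`!%:R != 0 :> R by rewrite pnatr_eq0 -lt0n fact_gt0.
    have : k.+1%:R != 0 :> R by rewrite pnatr_eq0.
    move: (k.+1%:R) (k`!%:R) (2 ^+ k) (expR (u / 2)) (expR _) => a b c e e' a0 b0 c0 /gt_eqF/negbT e0.
    by field; rewrite e0 a0 b0 c0.
  rewrite ge0_integralZl_EFin //.
  + by rewrite integral_gamma_pdf_scale ?invr_gt0 // mule1.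
  + move=> u; rewrite /= in_itv /= andbT => u0.
    by rewrite lee_fin mulr_ge0 ?invr_ge0 // gamma_pdf_ge0 // mulr_ge0 ?invr_ge0.
  + apply/measurable_EFinP; apply: measurable_funM => //; apply: measurable_funTS.
    apply: (measurableT_comp (measurable_gamma_pdf k.+1)).
    exact: measurable_funM.
- apply/measurable_EFinP; apply: measurable_funM => //; apply: measurableT_comp => //.
  exact: measurable_funM.
- by move=> u; rewrite lee_fin mulr_ge0 // expR_ge0.
Qed.

End gamma_prob.

(** * Logarithmic mean of the Gamma law *)

Section digamma.
Context {R : realType}.
Local Notation leb := (@lebesgue_measure R).
Implicit Types (k : nat) (t u x : R).

Lemma integral_gamma_prob k (h : R -> R) : measurable_fun setT h ->
  (\int[gamma_prob k]_u (h u)%:E =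
   \int[leb]_(u in `[0%R, +oo[) (h u * gamma_pdf k u)%:E)%E.
Proof.
move=> mh; rewrite [LHS]integralE [RHS]integralE.
congr (_ - _)%E.
- rewrite ge0_integral_gamma_prob //.
  + apply: eq_integral => u; rewrite inE /= in_itv /= andbT => u0.
    rewrite !funeposE -!EFin_max -EFinM; congr EFin.
    by rewrite maxr_pMl ?gamma_pdf_ge0 // mul0r.
  + by apply: measurable_funepos; apply/measurable_EFinP.
- rewrite ge0_integral_gamma_prob //.
  + apply: eq_integral => u; rewrite inE /= in_itv /= andbT => u0.
    rewrite !funenegE -!EFinN -!EFin_max -EFinM; congr EFin.
    by rewrite maxr_pMl ?gamma_pdf_ge0 // mul0r mulNr.
  + by apply: measurable_funeneg; apply/measurable_EFinP.
Qed.

Lemma powR_natS k t : 0 < t -> t `^ (k.+1%:R - 1) = t ^+ k.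
Proof. by move=> t0; rewrite -natr1 addrK powR_mulrn // ltW. Qed.

Lemma Gamma_nat k : Gamma k.+1%:R = k`!%:R :> R.
Proof.
rewrite /Gamma /Rintegral.
transitivity (fine (k`!%:R%:E * \int[leb]_(u in `[0%R, +oo[) (1 * gamma_pdf k (1 * u))%:E)%E); last first.
  by rewrite integral_gamma_pdf_scale // mule1.
congr fine; rewrite -integral_itv_obnd_cbnd; last first.
  apply/measurable_EFinP; apply: measurable_funM => //.
  apply: measurable_funTS.
  by apply: (measurableT_comp (measurable_gamma_pdf k)); exact: measurable_funM.
rewrite -ge0_integralZl_EFin //; last 2 first.
- move=> t; rewrite /= in_itv /= andbT => t0.
  by rewrite lee_fin !mul1r gamma_pdf_ge0 // ltW.
- apply/measurable_EFinP; apply: measurable_funM => //.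
  apply: measurable_funTS.
  by apply: (measurableT_comp (measurable_gamma_pdf k)); exact: measurable_funM.
apply: eq_integral => t; rewrite inE /= in_itv /= andbT => t0.
rewrite -EFinM powR_natS // !mul1r /gamma_pdf; congr EFin; field.
by rewrite pnatr_eq0 -lt0n fact_gt0.
Qed.

Let f x t : R := t `^ (x - 1) * expR (- t).

Let is_derive_f x t : 0 < t ->
  is_derive x (1 : R) (f ^~ t) (ln t * (t `^ (x - 1) * expR (- t))).
Proof.
move=> t0.
have h1 : is_derive x (1 : R) (fun y : R => (y - 1) * ln t) (ln t).
  apply: is_derive_eq; rewrite /GRing.scale /=; ring.
have h2 := @is_derive1_comp R expR (fun y : R => (y - 1) * ln t) x _ _ (is_derive_expR _) h1.
have [d1 d2] := is_deriveZ (expR (- t)) h2.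
have E : f ^~ t = expR (- t) \*: (expR \o (fun y : R => (y - 1) * ln t)).
  by apply/funext => y; rewrite /f /powR gt_eqF //= /GRing.scale /= mulrC.
rewrite E; split => //.
by rewrite [LHS]d2 /GRing.scale /= /powR gt_eqF //=; ring.
Qed.

(** A common majorant of t^(x-1) exp (-t) and its x-derivative for x within 1/4 of k + 1, as
    differentiation under the integral requires: [near0] covers t <= 1 and the two Gamma weights
    cover t > 1. The absolute values keep it nonnegative for negative t. *)
Let G k t : R := 2 * near0 t + ((k.+1)`!%:R * `|gamma_pdf k.+1 t| + (k.+2)`!%:R * `|gamma_pdf k.+2 t|).

Let G_ge0 k t : 0 <= G k t.
Proof.
apply: addr_ge0; first by apply: mulr_ge0 => //; exact: near0_ge0.
by apply: addr_ge0; apply: mulr_ge0.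
Qed.

Let mG k : measurable_fun setT (G k).
Proof.
apply: measurable_funD; first by apply: measurable_funM => //; exact: measurable_near0.
by apply: measurable_funD; apply: measurable_funM => //;
  apply: measurableT_comp => //; exact: measurable_gamma_pdf.
Qed.

Let intG k : leb.-integrable `]0, +oo[ (EFin \o G k).
Proof.
have sub : `]0%R, +oo[%classic `<=` (`[0%R, +oo[%classic : set R).
  by move=> t /=; rewrite !in_itv /= !andbT => /ltW.
have restr (h : R -> \bar R) : leb.-integrable `[0%R, +oo[ h -> leb.-integrable `]0%R, +oo[ h.
  exact: (@integrableS _ (measurableTypeR R) R leb `[0%R, +oo[%classic `]0%R, +oo[%classic h).
have i1 : leb.-integrable `]0, +oo[ (fun t => (near0 t)%:E).
  apply: restr; apply/integrableP; split.
    by apply/measurable_EFinP; apply: measurable_funTS; exact: measurable_near0.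
  under eq_integral do rewrite gee0_abs ?lee_fin ?near0_ge0 //.
  by apply: le_lt_trans integral_near0 _; rewrite ltry.
have i2 j : leb.-integrable `]0, +oo[ (fun t => `|(gamma_pdf j t)%:E|%E).
  apply: restr; apply: integrable_abse; apply/integrableP; split.
    by apply/measurable_EFinP; apply: measurable_funTS; exact: measurable_gamma_pdf.
  have -> : (\int[leb]_(t in `[0%R, +oo[) `|(gamma_pdf j t)%:E| = 1)%E; last by rewrite ltry.
  rewrite -[RHS](@integral_gamma_pdf_scale R j 1) //; apply: eq_integral => t.
  rewrite inE /= in_itv /= andbT => t0; rewrite !mul1r ger0_norm //.
  exact: gamma_pdf_ge0.
have mI : measurable (`]0%R, +oo[%classic : set R) by exact: measurable_itv.
have mO : measurable (`]0%R, +oo[%classic : set (measurableTypeR R)) by exact: measurable_itv.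
have j1 := integrableZl mO 2 i1.
have j2 := integrableZl mO (k.+1)`!%:R (i2 k.+1).
have j3 := integrableZl mO (k.+2)`!%:R (i2 k.+2).
have j4 := integrableD mO j1 (integrableD mO j2 j3).
by apply: eq_integrable j4.
Qed.

Let powexp j t : t ^+ j * expR (- t) = j`!%:R * gamma_pdf j t.
Proof. by rewrite /gamma_pdf; field; rewrite pnatr_eq0 -lt0n fact_gt0. Qed.

Let fG k x t : k.+1%:R - 4^-1 < x < k.+1%:R + 4^-1 -> 0 < t ->
  t `^ (x - 1) * expR (- t) <= G k t /\ `|ln t * (t `^ (x - 1) * expR (- t))| <= G k t.
Proof.
rewrite -natr1 => /andP[x1 x2] t0; have k0 : 0 <= k%:R :> R by [].
have e1 : expR (- t) <= 1 by rewrite -expR0 ler_expR oppr_le0 ltW.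
have g1 := gamma_pdf_ge0 k.+1 (ltW t0); have g2 := gamma_pdf_ge0 k.+2 (ltW t0).
have n0 := near0_ge0 t.
rewrite /G (ger0_norm g1) (ger0_norm g2) -!powexp.
have p1 : 0 <= t ^+ k.+1 * expR (- t) by rewrite mulr_ge0 ?expR_ge0 // exprn_ge0 // ltW.
have p2 : 0 <= t ^+ k.+2 * expR (- t) by rewrite mulr_ge0 ?expR_ge0 // exprn_ge0 // ltW.
rewrite normrM (ger0_norm (x := _ * expR _)); last by rewrite mulr_ge0 ?powR_ge0 ?expR_ge0.
have [t1|t1] := leP t 1.
  have tx : t `^ (x - 1) * expR (- t) <= t `^ (- 4^-1).
    apply: (@le_trans _ _ (t `^ (x - 1))); first by rewrite ler_piMr ?powR_ge0.
    by apply: ger_powR; rewrite ?t0 //; lra.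
  split.
    apply: le_trans tx _; apply: (@le_trans _ _ (near0 t)); last lra.
    by rewrite near0E ?t0 //; apply: ger_powR; rewrite ?t0 //; lra.
  apply: (@le_trans _ _ (`|ln t| * t `^ (- 4^-1))); first by rewrite ler_wpM2l.
  apply: le_trans (norm_ln_le_near0 _) _; rewrite ?t0 //.
  by rewrite lerDl addr_ge0.
have tx : t `^ (x - 1) <= t ^+ k.+1.
  rewrite -powR_mulrn ?(ltW t0) //; apply: ler_powR; first exact: ltW.
  rewrite -natr1; lra.
have tx' : t `^ (x - 1) * expR (- t) <= t ^+ k.+1 * expR (- t) by rewrite ler_wpM2r ?expR_ge0.
split; first lra.
apply: (@le_trans _ _ (t ^+ k.+2 * expR (- t))); last lra.
rewrite [t ^+ k.+2]exprS -mulrA; apply: ler_pM => //.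
  by rewrite mulr_ge0 ?powR_ge0 ?expR_ge0.
by rewrite ger0_norm ?ln_ge0 ?(ltW t1) // ltW // ln_sublinear.
Qed.

Let mf x : measurable_fun setT (fun t => t `^ (x - 1) * expR (- t)).
Proof. by apply: measurable_funM; [exact: measurable_powR|exact: measurableT_comp]. Qed.

Lemma derive1_Gamma_nat k :
  derive1 (@Gamma R) k.+1%:R = \int[leb]_(t in `]0, +oo[) (ln t * (t `^ (k.+1%:R - 1) * expR (- t))).
Proof.
have a0 : (`](k.+1%:R - 4^-1 : R), (k.+1%:R + 4^-1)[%classic : set R) k.+1%:R.
  by rewrite /= in_itv /=; apply/andP; split; lra.
have mB : measurable (`]0, +oo[%classic : set R) by exact: measurable_itv.
have d1E x t : 0 < t -> partial1of2 f x t = ln t * (t `^ (x - 1) * expR (- t)).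
  by move=> t0; rewrite partial1of2E; have [_ ->] := is_derive_f x t0.
have := @differentiation_under_integral R _ _ leb f _ mB _ _ _ a0 _ _ (G k) (G_ge0 k) (intG k) _.
rewrite /Gamma => ->.
- by apply: eq_Rintegral => t; rewrite inE /= in_itv /= andbT => t0; rewrite d1E.
- move=> x; rewrite /= in_itv /= => xI.
  apply: (le_integrable _ _ _ (intG k)) => //.
    by apply/measurable_EFinP; apply: measurable_funTS; exact: mf.
  move=> t; rewrite /= in_itv /= andbT => t0; rewrite lee_fin [leRHS]ger0_norm //.
  rewrite ger0_norm; first by have [] := fG xI t0.
  by rewrite mulr_ge0 ?powR_ge0 ?expR_ge0.
- by move=> x t _; rewrite /= in_itv /= andbT => t0; have [] := is_derive_f x t0.
- move=> x t; rewrite /= !in_itv /= andbT => xI t0; rewrite d1E //.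
  by have [] := fG xI t0.
Qed.

Lemma gamma_prob_ln k : (gamma_prob k).-integrable setT (fun u : R => (ln u)%:E) /\
  (\int[gamma_prob k]_u (ln (u : R))%:E = (digamma (k.+1%:R))%:E)%E.
Proof.
have E : (\int[gamma_prob k]_u (ln u)%:E = \int[leb]_(u in `[0%R, +oo[) (ln u * gamma_pdf k u)%:E)%E.
  exact: (integral_gamma_prob k (@measurable_ln R)).
have mln : measurable_fun setT (fun u : R => (ln u)%:E) by apply/measurable_EFinP; exact: measurable_ln.
have lnle u : `|ln u| <= 2 * near0 u + `|u| * expR (u / 2).
  have [u0|u0] := leP u 0.
    rewrite (ln0 u0) normr0; apply: addr_ge0; apply: mulr_ge0 => //; exact: near0_ge0.
  apply: le_trans (norm_ln_le u0) _; rewrite lerD2l gtr0_norm //.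
  by rewrite ler_peMr ?(ltW u0) // -expR0 ler_expR divr_ge0 // ltW.
have mn : measurable_fun setT (fun u : R => 2 * near0 u).
  by apply: measurable_funM => //; exact: measurable_near0.
have me : measurable_fun setT (fun u : R => `|u| * expR (u / 2)).
  by apply: measurable_funM => //; apply: measurableT_comp => //; exact: measurable_funM.
split.
  apply/integrableP; split => //.
  apply: (@le_lt_trans _ _ (2 * 4 + k.+1%:R * 2 ^+ k.+2)%:E); last by rewrite ltry.
  apply: (@le_trans _ _ (\int[gamma_prob k]_u (2 * near0 u + `|u| * expR (u / 2))%:E)%E).
    apply: ge0_le_integral => //.
    - exact: measurableT_comp.
    - by apply/measurable_EFinP; apply: measurable_funD; [exact: mn|exact: me].
    - by move=> u _; rewrite /= lee_fin.
  apply: integralD_le => //.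
  - by move=> u; apply: mulr_ge0 => //; exact: near0_ge0.
  - apply: integralZ_le => //; [exact: measurable_near0|exact: near0_ge0|exact: gamma_moment_near0].
  - by rewrite gamma_moment_exp.
rewrite E -integral_itv_obnd_cbnd; last first.
  apply/measurable_EFinP; apply: measurable_funM; apply: measurable_funTS.
    exact: measurable_ln.
  exact: measurable_gamma_pdf.
rewrite /digamma derive1_Gamma_nat Gamma_nat /Rintegral.
set h := fun t : R => ln t * (t `^ (k.+1%:R - 1) * expR (- t)).
have mI : measurable (`]0%R, +oo[%classic : set (measurableTypeR R)) by exact: measurable_itv.
have ih : leb.-integrable `]0%R, +oo[ (EFin \o h).
  apply: (le_integrable _ _ _ (intG k)) => //.
    apply/measurable_EFinP; apply: measurable_funTS.
    by apply: measurable_funM; [exact: measurable_ln|exact: mf].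
  move=> t; rewrite /= in_itv /= andbT => t0; rewrite lee_fin [leRHS]ger0_norm //.
  by have [] := @fG k k.+1%:R t _ t0; [apply/andP; split; lra|].
transitivity ((k`!%:R^-1)%:E * \int[leb]_(x in `]0%R, +oo[) (h x)%:E)%E; last first.
  rewrite mulrC EFinM; congr (_ * _)%E; rewrite fineK //.
  exact: (integrable_fin_num mI ih).
rewrite -(integralZl mI ih); apply: eq_integral => t.
rewrite inE /= in_itv /= andbT => t0; rewrite -EFinM /h powR_natS //; congr EFin.
by rewrite powexp; field; rewrite pnatr_eq0 -lt0n fact_gt0.
Qed.

End digamma.

(** * Nearest neighbour distances *)

Section knn.
Context {R : realType} {d : nat}.
Local Notation V := 'rV[R]_d.
Variables (k : nat) (p : \bar R).
Hypothesis k0 : (0 < k)%N.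
Hypothesis p1 : (1 <= p)%E.
Variable N : nat.
Hypothesis kN : (k < N)%N.
Implicit Types (x : 'I_N -> V) (z : N.-tuple V) (i j : 'I_N) (r : R).

Definition others i := [seq j <- enum 'I_N | j != i].

Lemma mem_others i j : (j \in others i) = (j != i).
Proof. by rewrite mem_filter mem_enum andbT. Qed.

Lemma uniq_others i : uniq (others i).
Proof. by rewrite filter_uniq // enum_uniq. Qed.

Lemma size_others i : size (others i) = N.-1.
Proof.
rewrite /others -(rem_filter i (enum_uniq 'I_N)) size_rem ?mem_enum //.
by rewrite size_enum_ord.
Qed.

Let size_dist x i : (k.-1 < size [seq lp_norm p (x j - x i) | j <- others i])%N.
Proof. by rewrite size_map size_others -ltnS !prednK // (ltn_trans _ kN). Qed.

(** The sorting in the definition is replaced here by a count, which suits independent points. As 1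
    <= k < N, the index k - 1 lies inside the list of N - 1 distances and the default of [nth] is
    never read. *)
Lemma knn_dist_le x i r : (knn_dist k p x i <= r) =
  (k <= count (fun j => lp_norm p (x j - x i) <= r)%R (others i))%N.
Proof.
rewrite /knn_dist -/(others i); set s := map _ _.
have sz : (k.-1 < size (sort <=%R s))%N by rewrite size_sort; exact: size_dist.
have ss : sorted <=%O (sort <=%R s) by apply: sort_sorted; exact: le_total.
have cE : count (<= r)%R (sort <=%R s) = count (fun j => lp_norm p (x j - x i) <= r)%R (others i).
  by rewrite (permP (permEl (perm_sort _ _))) count_map.
rewrite -cE; apply/idP/idP => h.
  rewrite leqNgt; apply/negP => ch.
  have := @nth_count_gt _ _ r 0 _ k.-1 ss; rewrite sz andbT => /(_ _)/wrap[].
    by rewrite -ltnS prednK.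
  by move=> H; rewrite leNgt H in h.
by apply: nth_count_le => //; rewrite prednK.
Qed.

Lemma knn_dist_mem x i : exists2 j, j != i & knn_dist k p x i = lp_norm p (x j - x i).
Proof.
have /(mem_nth 0) : (k.-1 < size (sort <=%R [seq lp_norm p (x j - x i) | j <- others i]))%N.
  by rewrite size_sort; exact: size_dist.
rewrite mem_sort => /mapP[j]; rewrite mem_others => ji h.
by exists j.
Qed.

Lemma knn_dist_ge0 x i : 0 <= knn_dist k p x i.
Proof. by have [j _ ->] := knn_dist_mem x i; exact: lp_norm_ge0. Qed.

Lemma measurable_lp_dist i j :
  measurable_fun setT (fun z => lp_norm p (tnth z j - tnth z i)).
Proof.
apply: (measurableT_comp (measurable_lp_norm p)); apply/measurable_fun_rVP => l.
rewrite (_ : (fun _ => _) = fun z => tnth z j ord0 l - tnth z i ord0 l); last first.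
  by apply/funext => z; rewrite !mxE.
by apply: measurable_funB; apply: (measurableT_comp (measurable_coord l)); exact: measurable_tnth.
Qed.

Lemma measurable_le_fun dd (T : measurableType dd) (g : T -> R) r :
  measurable_fun setT g -> measurable [set z | g z <= r].
Proof.
move=> mg; rewrite (_ : [set _ | _] = g @^-1` `]-oo, r]); last first.
  by apply/seteqP; split=> v /=; rewrite in_itv.
by rewrite -[X in measurable X]setTI; exact: mg.
Qed.

Lemma measurable_knn_dist i : measurable_fun setT (fun z => knn_dist k p (tnth z) i).
Proof.
apply: (measurability _ (RGenOInfty.measurableE R)) => _ [_ [r ->] <-].
rewrite setTI (_ : _ @^-1` _ =
  [set z | (count (fun j => lp_norm p (tnth z j - tnth z i) <= r)%R (others i) < k)%N]).
  apply: (@measurable_count_lt _ _ _ (fun j z => lp_norm p (tnth z j - tnth z i) <= r)%R) => j.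
  by apply: measurable_le_fun; exact: measurable_lp_dist.
apply/seteqP; split => z /=; rewrite in_itv /= andbT ltnNge -knn_dist_le -ltNge //.
Qed.

End knn.

Section ball_prob.
Context {R : realType} {d : nat}.
Local Notation V := 'rV[R]_d.
Local Notation leb := (lebesgue_rV R d).
Variables (k : nat) (p : \bar R).
Hypothesis k0 : (0 < k)%N.
Hypothesis p1 : (1 <= p)%E.
Hypothesis d0 : (0 < d)%N.
Variables (f : V -> R) (Ca : R).
Hypothesis mf : measurable_fun setT f.
Hypothesis f0 : forall x, 0 <= f x.
Hypothesis f1 : (\int[leb]_x (f x)%:E = 1)%E.
Hypothesis Ca0 : 0 <= Ca.
Hypothesis fCa : {ae leb, forall x, f x <= Ca}.

Let mu := density_prob mf f0 f1.
Let c := unit_ball_volume d p.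

Lemma measurable_lp_ball_at r (x : V) : measurable [set y : V | lp_norm p (y - x) <= r].
Proof.
apply: measurable_le_fun.
exact: (measurableT_comp (measurable_lp_norm p) (measurable_addv (- x))).
Qed.

Lemma lebesgue_rV_lp_ball_at r (x : V) : 0 <= r ->
  leb [set y : V | lp_norm p (y - x) <= r] = (c * r ^+ d)%:E.
Proof.
move=> r0; rewrite -(lebesgue_rV_lp_ball p1 d0 r0).
by rewrite -[RHS](lebesgue_rV_addv (- x)) //; exact: measurable_lp_ball.
Qed.

Definition ball_prob (r : R) (x : V) : R := fine (mu [set y | lp_norm p (y - x) <= r]).

Lemma ball_probE r x : mu [set y | lp_norm p (y - x) <= r] = (ball_prob r x)%:E.
Proof. by rewrite /ball_prob fineK // fin_num_measure //; exact: measurable_lp_ball_at. Qed.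

Lemma integral_ball_prob r x :
  (\int[leb]_(y in [set y | (lp_norm p (y - x) <= r)%R]) (f y)%:E = (ball_prob r x)%:E)%E.
Proof. by rewrite -ball_probE [RHS]density_probE. Qed.

Lemma ball_prob01 r x : 0 <= ball_prob r x <= 1.
Proof.
rewrite -2!lee_fin -ball_probE; apply/andP; split; first exact: measure_ge0.
by apply: probability_le1; exact: measurable_lp_ball_at.
Qed.

Lemma ball_prob_le r x : 0 <= r -> ball_prob r x <= Ca * (c * r ^+ d).
Proof.
move=> r0; rewrite -lee_fin -integral_ball_prob.
apply: (@le_trans _ _ (\int[leb]_(y in [set y | (lp_norm p (y - x) <= r)%R]) (cst Ca%:E) y)%E).
  apply: ae_ge0_le_integral => //.
  - exact: measurable_lp_ball_at.
  - by move=> y _; rewrite lee_fin.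
  - by apply/measurable_EFinP; exact: measurable_funTS.
  - by apply: filterS fCa => y h _; rewrite lee_fin.
rewrite integral_cst; last exact: measurable_lp_ball_at.
by rewrite EFinM -(lebesgue_rV_lp_ball_at x r0).
Qed.

Lemma measurable_lp_sub :
  measurable_fun setT (fun u : V * V => lp_norm p (u.2 - u.1)).
Proof.
apply: (measurableT_comp (measurable_lp_norm p)); apply/measurable_fun_rVP => l.
rewrite (_ : (fun _ => _) = fun u : V * V => u.2 ord0 l - u.1 ord0 l); last first.
  by apply/funext => z; rewrite !mxE.
apply: measurable_funB.
  exact: (measurableT_comp (measurable_coord l) measurable_snd).
exact: (measurableT_comp (measurable_coord l) measurable_fst).
Qed.

Lemma measurable_ball_prob r : measurable_fun setT (ball_prob r).
Proof.
apply/measurable_EFinP.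
have mA : measurable [set u : V * V | lp_norm p (u.2 - u.1) <= r].
  by apply: measurable_le_fun; exact: measurable_lp_sub.
have := measurable_fun_xsection mu mA; congr (measurable_fun _ _).
apply/funext => x; rewrite /= -ball_probE; congr (mu _).
by apply/seteqP; split => y; rewrite /xsection /= inE.
Qed.

Variable N : nat.
Hypothesis kN : (k < N)%N.
Variable nu : probability (N.-tuple V) R.
Hypothesis nuP : iid_law mu nu.

Lemma probability_resample i (A : set (N.-tuple V)) : measurable A ->
  nu A = (\int[mu]_x nu [set z | A (resample i z x)])%E.
Proof.
move=> mA; rewrite -[in LHS](setIT A) -integral_indic // (ge0_integral_resample nuP i).
- apply: eq_integral => x _; have mAx : measurable [set z | A (resample i z x)].
    have mr : measurable_fun setT (fun z : N.-tuple V => resample i z x).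
      apply: (measurableT_comp (measurable_resample i) (g := fun z : N.-tuple V => (z, x))).
      exact: measurable_fun_pair.
    by rewrite -[X in measurable X]setTI; exact: mr.
  by rewrite -[in RHS](setIT [set z | _]) -integral_indic.
- by apply/measurable_EFinP/measurable_indic.
- by move=> z; rewrite lee_fin.
Qed.

Lemma pair_dist_le i j r : i != j -> 0 <= r ->
  (nu [set z | (lp_norm p (tnth z j - tnth z i) <= r)%R] <= (Ca * (c * r ^+ d))%:E)%E.
Proof.
move=> ij r0; rewrite (probability_resample i); last first.
  by apply: measurable_le_fun; exact: measurable_lp_dist.
apply: (@le_trans _ _ (\int[mu]_x (cst (Ca * (c * r ^+ d))%:E) x)%E); last first.
  by rewrite integral_cst // [X in (_ * X)%E](@probability_setT _ _ _ mu) mule1.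
rewrite (_ : (\int[mu]_x _)%E = \int[mu]_x (ball_prob r x)%:E)%E.
  apply: ge0_le_integral => //.
  - by move=> x _; rewrite lee_fin; have /andP[] := ball_prob01 r x.
  - by apply/measurable_EFinP; exact: measurable_ball_prob.
  - by move=> x _; rewrite lee_fin ball_prob_le.
apply: eq_integral => x _; rewrite -ball_probE.
rewrite -[RHS](iid_marginal nuP j); last exact: measurable_lp_ball_at.
congr (nu _); apply/seteqP; split => z /=;
  by rewrite !resampleE eqxx [j == i]eq_sym (negbTE ij).
Qed.

Lemma knn_law i r :
  (nu [set z | (knn_dist k p (tnth z) i <= r)%R] =
   \int[mu]_x (1 - binom_lt k N.-1 (ball_prob r x))%:E)%E.
Proof.
rewrite (probability_resample i); last first.
  by apply: measurable_le_fun; exact: measurable_knn_dist.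
apply: eq_integral => x _.
pose B := [set y : V | lp_norm p (y - x) <= r].
have mB : measurable B by exact: measurable_lp_ball_at.
have mC : measurable [set z : N.-tuple V | (count (fun j => tnth z j \in B) (others i) < k)%N].
  by apply: measurable_count_lt => j; exact: measurable_tnth_in.
have countE z : count (fun j => lp_norm p (tnth (resample i z x) j - tnth (resample i z x) i) <= r)%R (others i)
    = count (fun j => tnth z j \in B) (others i).
  apply: eq_in_count => j; rewrite mem_others !resampleE eqxx => /negbTE ->.
  by apply/idP/idP => [?|]; [rewrite inE|rewrite inE].
transitivity (nu (~` [set z : N.-tuple V | (count (fun j => tnth z j \in B) (others i) < k)%N])); last first.
  rewrite probability_setC //.
  rewrite EFinB; congr (_ - _)%E.
  rewrite (count_lt_law nuP _ mB (ball_probE r x)) ?uniq_others //.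
  by rewrite size_others.
congr (nu _); apply/seteqP; split => z /=; rewrite knn_dist_le //.
  by rewrite countE leqNgt => /negP.
move=> /negP h; rewrite countE leqNgt.
exact: h.
Qed.

End ball_prob.

Section series_bound.
Context {R : realType}.

Let q : R := expR (- 2^-1).

(** A bound for the series of (m+1)^2 exp (-m): since m + 1 <= 4 exp (m/4), it is dominated by 16
    times the geometric series of ratio exp (-1/2). *)
Definition sqr_exp_sum : R := 16 / (1 - q).

Let q01 : 0 < q < 1.
Proof. by rewrite expR_gt0 /= expR_lt1 oppr_lt0. Qed.

Lemma sqr_exp_sum_gt0 : 0 < sqr_exp_sum.
Proof. by rewrite divr_gt0 // subr_gt0; case/andP: q01. Qed.

Lemma sqr_expR_le m : m.+1%:R ^+ 2 * expR (- m%:R) <= 16 * q ^+ m :> R.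
Proof.
have m0 : 0 <= m%:R :> R by [].
have e0 := expR_gt0 (m%:R / 4 : R).
have h : m.+1%:R <= 4 * expR (m%:R / 4) :> R.
  have := expR_ge1Dx (m%:R / 4 : R); rewrite -(natr1 m); lra.
have -> : q ^+ m = expR (m%:R / 4) ^+ 2 * expR (- m%:R).
  by rewrite -!expRM_natl -expRD; congr expR; field.
rewrite mulrA ler_wpM2r ?expR_ge0 // (_ : 16 = 4 ^+ 2); last by ring.
by rewrite -exprMn ler_pXn2r // nnegrE ?mulr_ge0 // ltW.
Qed.

Lemma nneseries_sqr_expR (b : R) : 0 <= b ->
  (\sum_(0 <= m <oo) (m.+1%:R ^+ 2 * (b * expR (- m%:R)))%:E <= (b * sqr_exp_sum)%:E)%E.
Proof.
move=> b0; apply: lime_le.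
  apply: is_cvg_nneseries => m _ _.
  by rewrite lee_fin mulr_ge0 ?sqr_ge0 // mulr_ge0 // expR_ge0.
apply: nearW => n; rewrite sumEFin lee_fin.
case/andP: q01 => q0 q1.
have := geometric_le_lim n (ler0n R 16) q0; rewrite gtr0_norm // => /(_ q1).
move=> /(ler_wpM2l b0); apply: le_trans.
rewrite /series /= mulr_sumr; apply: ler_sum => m _.
by rewrite mulrCA ler_wpM2l // sqr_expR_le.
Qed.

End series_bound.

Section scale_radius.
Context {R : realType} {d : nat}.
Variable p : \bar R.
Hypothesis p1 : (1 <= p)%E.
Hypothesis d0 : (0 < d)%N.
Variable N : nat.
Hypothesis N0 : (0 < N)%N.
Local Notation c := (unit_ball_volume d p).

(* If rho is the k-th nearest neighbour distance, then
   log N + log c_(d,p) + d log rho is ln (scaled rho). *)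
Definition scaled (r : R) : R := N%:R * (c * r ^+ d).
Definition scale_radius (t : R) : R := (t / (N%:R * c)) `^ d%:R^-1.

Let c0 : 0 < c. Proof. exact: unit_ball_volume_gt0. Qed.

Let Nc0 : 0 < N%:R * c. Proof. by rewrite mulr_gt0 // ltr0n. Qed.

Lemma scale_radius_ge0 t : 0 <= scale_radius t. Proof. exact: powR_ge0. Qed.

Lemma scale_radius_gt0 t : 0 < t -> 0 < scale_radius t.
Proof. by move=> t0; rewrite powR_gt0 // divr_gt0. Qed.

Lemma scale_radiusX t : 0 <= t -> scale_radius t ^+ d = t / (N%:R * c).
Proof.
move=> t0; rewrite -powR_mulrn ?scale_radius_ge0 // -powRrM mulVf ?powRr1 //.
  by rewrite divr_ge0 // ltW.
by rewrite pnatr_eq0 gtn_eqF.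
Qed.

Lemma scaled_radius t : 0 <= t -> scaled (scale_radius t) = t.
Proof. by move=> t0; rewrite /scaled scale_radiusX // mulrA mulrC divfK // gt_eqF. Qed.

Lemma volume_radius t : 0 <= t -> c * scale_radius t ^+ d = t / N%:R.
Proof.
move=> t0; rewrite scale_radiusX //; field.
by rewrite pnatr_eq0 gtn_eqF // gt_eqF.
Qed.

Lemma le_scaled r s : 0 <= r -> 0 <= s -> (scaled r <= scaled s) = (r <= s).
Proof.
by move=> r0 s0; rewrite /scaled !mulrA ler_pM2l // ler_pXn2r.
Qed.

Lemma scaled_le r t : 0 <= r -> 0 <= t -> (scaled r <= t) = (r <= scale_radius t).
Proof.
by move=> r0 t0; rewrite -{1}(scaled_radius t0) le_scaled ?scale_radius_ge0.
Qed.

Lemma measurable_scaled : measurable_fun setT scaled.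
Proof. by apply: measurable_funM => //; apply: measurable_funM => //; exact: measurable_funX. Qed.

End scale_radius.

(* The truncation at e removes the logarithmic singularity of the estimator at
   coinciding points; it is applied with e = 1 / N. *)
Definition log_trunc (R : realType) (psi T e t : R) : R :=
  if t <= T then ln (Num.max t e) - psi else 0.

Section log_trunc.
Context {R : realType}.
Variables (psi T e : R).

Lemma measurable_log_trunc : measurable_fun setT (log_trunc psi T e).
Proof.
apply: measurable_fun_ifT => //; first exact: measurable_fun_ler.
apply: measurable_funB => //; apply: (measurableT_comp (@measurable_ln R)).
exact: measurable_maxr.
Qed.

Lemma log_trunc_bound t : 0 < e -> e <= T -> e <= 1 ->
  `|log_trunc psi T e t| <= `|psi| + `|ln T| - ln e.
Proof.
move=> e0 eT e1; have le0 : ln e <= 0 by rewrite ln_le0.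
have a0 := normr_ge0 psi; have a1 := normr_ge0 (ln T).
rewrite /log_trunc; case: ifP => tT; last by rewrite normr0; lra.
have m1 : ln e <= ln (Num.max t e).
  by rewrite ler_ln ?posrE ?lt_max ?e0 ?orbT // le_max lexx orbT.
have m2 : ln (Num.max t e) <= ln T.
  by rewrite ler_ln ?posrE ?lt_max ?e0 ?orbT // ?ge_max ?tT // (lt_le_trans e0).
have := ler_norm (ln T); have := ler_norm psi; have := ler_norm (- psi).
rewrite normrN ler_norml => ? ? ?; apply/andP; split; lra.
Qed.

End log_trunc.

Section truncation_error.
Context {R : realType} {d : nat}.
Local Notation V := 'rV[R]_d.
Local Notation leb := (lebesgue_rV R d).
Variables (k : nat) (p : \bar R) (delta : R).
Hypothesis k0 : (0 < k)%N.
Hypothesis p1 : (1 <= p)%E.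
Hypothesis d0 : (0 < d)%N.
Variable N : nat.
Hypothesis kN : (k < N)%N.
Local Notation c := (unit_ball_volume d p).
Local Notation psi := (digamma k%:R).
Local Notation T := (c * ln N%:R `^ (1 + delta) : R).
Hypothesis NT : N%:R^-1 <= T.

Let N0 : (0 < N)%N. Proof. exact: leq_ltn_trans kN. Qed.
Let NR0 : 0 < N%:R :> R. Proof. by rewrite ltr0n. Qed.
Let c0 : 0 < c. Proof. exact: unit_ball_volume_gt0. Qed.
Let T0 : 0 < T. Proof. by apply: lt_le_trans NT; rewrite invr_gt0. Qed.

Lemma truncation_radiusE : truncation_radius d delta N = scale_radius (d := d) p N T.
Proof.
rewrite /truncation_radius /scale_radius; congr (_ `^ _); field.
by rewrite pnatr_eq0 gtn_eqF // gt_eqF.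
Qed.

Definition knn_scaled (x : 'I_N -> V) i := scaled (d := d) p N (knn_dist k p x i).

Lemma knn_scaled_le x i t : 0 <= t -> (knn_scaled x i <= t) = (knn_dist k p x i <= scale_radius (d := d) p N t).
Proof. by move=> t0; apply: scaled_le => //; exact: knn_dist_ge0. Qed.

(** With tau the scaled distance, the error is -ln (N tau) if 0 < tau < 1/N and 0 for larger tau. If
    m is its integer part, then tau <= exp (-m) / N, an event whose probability is summable against
    (m+1)^2. *)
Lemma tKL_term_error x i :
  exists m : nat, (tKL_term k p delta x i - log_trunc psi T N%:R^-1 (knn_scaled x i)) ^+ 2 <=
    m.+1%:R ^+ 2 * (knn_dist k p x i <= scale_radius (d := d) p N (expR (- m%:R) / N%:R))%R%:R.
Proof.
have r0 := knn_dist_ge0 p k0 kN x i.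
rewrite /tKL_term truncation_radiusE -knn_scaled_le ?(ltW T0) //.
rewrite /log_trunc; case: ifP => tT; last first.
  by exists 0; rewrite subrr expr0n mulr_ge0 ?sqr_ge0.
(* At coinciding points the convention [ln 0 = 0] makes the error arbitrary; any m that dominates it
   will do, as distance 0 is below every radius. *)
have [rho0|rho0] := eqVneq (knn_dist k p x i) 0.
  set D := (_ - _ : R); exists (Num.truncn `|D|).
  rewrite rho0 scale_radius_ge0 mulr1 -real_normK ?num_real // ler_pXn2r ?nnegrE //.
  by apply: ltW; have /andP[] := truncn_itv (normr_ge0 D).
have {}rho0 : 0 < knn_dist k p x i by rewrite lt_def rho0.
have s0 : 0 < knn_scaled x i by rewrite mulr_gt0 // mulr_gt0 // exprn_gt0.
have -> : - psi + ln N%:R + ln c + d%:R * ln (knn_dist k p x i) = ln (knn_scaled x i) - psi.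
  rewrite /knn_scaled /scaled lnM ?posrE ?mulr_gt0 ?exprn_gt0 // lnM ?posrE ?exprn_gt0 //.
  by rewrite lnXn // -mulr_natl; ring.
have [h|h] := leP N%:R^-1 (knn_scaled x i).
  by exists 0; rewrite subrr expr0n mulr_ge0 ?sqr_ge0.
set D := (_ - _ : R); have DE : D = - - ln (N%:R * knn_scaled x i).
  by rewrite /D lnM ?posrE // lnV ?posrE //; ring.
have D0 : 0 <= - ln (N%:R * knn_scaled x i).
  by rewrite oppr_ge0 ln_le0 // -ler_pdivlMl // mulr1 ltW.
exists (Num.truncn (- ln (N%:R * knn_scaled x i))).
have /andP[h1 h2] := truncn_itv D0.
rewrite -knn_scaled_le ?divr_ge0 ?expR_ge0 //.
have -> : knn_scaled x i <= expR (- (Num.truncn (- ln (N%:R * knn_scaled x i)))%:R) / N%:R.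
  rewrite ler_pdivlMr // mulrC.
  rewrite -ler_ln ?posrE ?(mulr_gt0 NR0 s0) ?expR_gt0 // expRK.
  by rewrite lerNr.
by rewrite mulr1 DE sqrrN ler_pXn2r ?nnegrE // ltW.
Qed.

Lemma measurable_knn_scaled i : measurable_fun setT (fun z : N.-tuple V => knn_scaled (tnth z) i).
Proof.
apply: (measurableT_comp (measurable_scaled p N)).
exact: measurable_knn_dist.
Qed.

Lemma measurable_tKL_term i :
  measurable_fun setT (fun z : N.-tuple V => tKL_term k p delta (tnth z) i).
Proof.
have mk : measurable_fun setT (fun z : N.-tuple V => knn_dist k p (tnth z) i).
  exact: measurable_knn_dist.
rewrite /tKL_term; apply: measurable_fun_ifT => //.
  exact: measurable_fun_ler.
apply: measurable_funD => //; apply: measurable_funM => //.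
exact: (measurableT_comp (@measurable_ln R)).
Qed.

Lemma measurable_trunc_term i :
  measurable_fun setT (fun z : N.-tuple V => log_trunc psi T N%:R^-1 (knn_scaled (tnth z) i)).
Proof.
exact: (measurableT_comp (measurable_log_trunc _ _ _) (measurable_knn_scaled i)).
Qed.

Variables (f : V -> R) (Ca : R).
Hypothesis mf : measurable_fun setT f.
Hypothesis f0 : forall x, 0 <= f x.
Hypothesis f1 : (\int[leb]_x (f x)%:E = 1)%E.
Hypothesis Ca0 : 0 <= Ca.
Hypothesis fCa : {ae leb, forall x, f x <= Ca}.
Local Notation mu := (density_prob mf f0 f1).
Variable nu : probability (N.-tuple V) R.
Hypothesis nuP : iid_law mu nu.

(** The k-th distance is one of the N - 1 distances to other points, so the error is bounded by a
    sum over j and m. A given pair is that close with probability at most Ca exp (-m) / N^2, whence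
    order 1/N in total. *)
Lemma term_error i :
  (\int[nu]_z ((tKL_term k p delta (tnth z) i -
      log_trunc psi T N%:R^-1 (knn_scaled (tnth z) i)) ^+ 2)%:E
   <= (Ca * sqr_exp_sum / N%:R)%:E)%E.
Proof.
pose b (j : 'I_N) (m : nat) (z : N.-tuple V) : \bar R := (m.+1%:R ^+ 2 *
  \1_[set z | lp_norm p (tnth z j - tnth z i) <= scale_radius (d := d) p N (expR (- m%:R) / N%:R)] z)%:E.
have mA j m : measurable [set z : N.-tuple V | lp_norm p (tnth z j - tnth z i) <=
    scale_radius (d := d) p N (expR (- m%:R) / N%:R)].
  by apply: measurable_le_fun; exact: measurable_lp_dist.
have mb j m : measurable_fun setT (b j m).
  by apply/measurable_EFinP; apply: measurable_funM => //; exact: measurable_indic.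
have b0 j m z : (0 <= b j m z)%E by rewrite lee_fin mulr_ge0 // sqr_ge0.
have mbs j : measurable_fun setT (fun z => \sum_(0 <= m <oo) b j m z)%E.
  by apply: ge0_emeasurable_sum.
have bs0 j z : (0 <= \sum_(0 <= m <oo) b j m z)%E by apply: nneseries_ge0.
apply: (@le_trans _ _ (\int[nu]_z \sum_(j <- others i) \sum_(0 <= m <oo) b j m z)%E).
  apply: ge0_le_integral => //.
  - by move=> z _; rewrite lee_fin sqr_ge0.
  - apply/measurable_EFinP; apply: measurable_funX; apply: measurable_funB.
      exact: measurable_tKL_term.
    exact: measurable_trunc_term.
  - by apply: emeasurable_sum.
  - move=> z _; have [m hm] := tKL_term_error (tnth z) i.
    have [j ji rE] := knn_dist_mem p k0 kN (tnth z) i.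
    apply: (@le_trans _ _ (b j m z)).
      rewrite lee_fin; apply: le_trans hm _; rewrite ler_wpM2l ?sqr_ge0 //.
      rewrite rE indicE ler_nat; case: (leP (lp_norm _ _)) => // h.
      by rewrite mem_set.
    apply: (@le_trans _ _ (\sum_(0 <= m <oo) b j m z)%E).
      apply: le_trans (nneseries_lim_ge m.+1 _) => //.
      by rewrite big_nat_recr //= leeDr // sume_ge0.
    rewrite (big_rem j) ?mem_others //= leeDl // sume_ge0 //.
rewrite ge0_integral_sum //.
have cE : (\sum_(j <- others i) (Ca / N%:R ^+ 2 * sqr_exp_sum)%:E <= (Ca * sqr_exp_sum / N%:R)%:E :> \bar R)%E.
  rewrite sumEFin lee_fin big_const_seq count_predT size_others iter_addr_0 -[leLHS]mulr_natl.
  have S0 := sqr_exp_sum_gt0 (R := R).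
  apply: (@le_trans _ _ (N%:R * (Ca / N%:R ^+ 2 * sqr_exp_sum))).
    rewrite ler_wpM2r //.
      by rewrite mulr_ge0 ?(ltW S0) // divr_ge0 ?sqr_ge0.
    by rewrite ler_nat leq_pred.
  rewrite le_eqVlt; apply/orP; left; apply/eqP; field.
  by rewrite pnatr_eq0 gtn_eqF.
apply: le_trans cE.
rewrite big_seq [leRHS]big_seq; apply: lee_sum => j; rewrite mem_others => ji.
rewrite integral_nneseries //.
apply: le_trans (nneseries_sqr_expR _).
  apply: lee_nneseries => m _.
    by move=> _; exact: integral_ge0.
  rewrite /b; under eq_integral do rewrite EFinM.
  rewrite ge0_integralZl_EFin ?sqr_ge0 //; last by apply/measurable_EFinP/measurable_indic.
  rewrite integral_indic // setIT [leRHS]EFinM; apply: lee_wpmul2l; first by rewrite lee_fin sqr_ge0.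
  apply: le_trans (pair_dist_le p1 d0 Ca0 fCa nuP _ _) _; rewrite 1?eq_sym ?scale_radius_ge0 //.
  have e0 : 0 <= expR (- m%:R) / N%:R :> R by rewrite divr_ge0 ?expR_ge0.
  rewrite lee_fin (volume_radius p1 d0 N0 e0).
  rewrite le_eqVlt; apply/orP; left; apply/eqP; field.
  by rewrite pnatr_eq0 gtn_eqF.
by rewrite divr_ge0 ?sqr_ge0.
Qed.

End truncation_error.

(** * Variance of the truncated estimator *)

Section variance.
Context {R : realType} {d : nat}.
Local Notation V := 'rV[R]_d.
Local Notation leb := (lebesgue_rV R d).
Variables (k : nat) (p : \bar R).
Hypothesis k0 : (0 < k)%N.
Hypothesis p1 : (1 <= p)%E.
Hypothesis d0 : (0 < d)%N.
Variable N : nat.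
Hypothesis kN : (k < N)%N.
Variables (psi T : R).
Hypothesis NT : N%:R^-1 <= T.
Local Notation c := (unit_ball_volume d p).
Local Notation VN := (N.-tuple V).
Local Notation a := (scale_radius (d := d) p N T).

Let N0 : (0 < N)%N. Proof. exact: leq_ltn_trans kN. Qed.
Let NR0 : 0 < N%:R :> R. Proof. by rewrite ltr0n. Qed.
Let T0 : 0 < T. Proof. by apply: lt_le_trans NT; rewrite invr_gt0. Qed.

Definition trunc_term (z : VN) i := log_trunc psi T N%:R^-1 (knn_scaled k p (tnth z) i).

Definition trunc_mean (z : VN) := N%:R^-1 * \sum_(i < N) trunc_term z i.

Definition trunc_bound := `|psi| + `|ln T| + ln N%:R.

Lemma trunc_term_bound z i : `|trunc_term z i| <= trunc_bound.
Proof.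
apply: le_trans (log_trunc_bound _ _ _ _ _) _ => //.
- by rewrite invr_gt0.
- by rewrite invf_le1 // ler1n.
- by rewrite lnV ?posrE // opprK.
Qed.

Lemma trunc_bound_ge0 : 0 <= trunc_bound.
Proof. by rewrite !addr_ge0 // ln_ge0 // ler1n. Qed.

Lemma trunc_mean_bound z : `|trunc_mean z| <= trunc_bound.
Proof.
rewrite normrM ger0_norm ?invr_ge0 // ler_pdivrMl //.
apply: le_trans (ler_norm_sum _ _ _) _.
apply: (@le_trans _ _ (\sum_(i < N) trunc_bound)).
  by apply: ler_sum => i _; exact: trunc_term_bound.
by rewrite sumr_const card_ord -[_ *+ N]mulr_natl.
Qed.

Lemma measurable_trunc_mean : measurable_fun setT trunc_mean.
Proof.
apply: measurable_funM => //; apply: measurable_sum => i.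
apply: (measurableT_comp (measurable_log_trunc _ _ _)).
exact: measurable_knn_scaled.
Qed.

Lemma trunc_term_eq z z' i :
  (forall r, r <= a -> (knn_dist k p (tnth z) i <= r) = (knn_dist k p (tnth z') i <= r)) ->
  trunc_term z i = trunc_term z' i.
Proof.
move=> h; rewrite /trunc_term /log_trunc !knn_scaled_le ?(ltW T0) // h //.
case: ifP => // z'a; rewrite /knn_scaled.
suff -> : knn_dist k p (tnth z) i = knn_dist k p (tnth z') i by [].
have za : knn_dist k p (tnth z) i <= a by rewrite h.
by apply/eqP; rewrite eq_le (h _ z'a) lexx -(h _ za) lexx.
Qed.

(* Truncation localizes the estimator: resampling the l-th point affects only
   the neighbours of its old and of its new position within distance a. *)
Lemma trunc_term_resample l z x i : i != l ->
  a < lp_norm p (tnth z i - tnth z l) -> a < lp_norm p (tnth z i - x) ->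
  trunc_term (resample l z x) i = trunc_term z i.
Proof.
move=> il al ax; apply: trunc_term_eq => r ra.
rewrite !(knn_dist_le p k0 kN); congr (_ <= _)%N; apply: eq_in_count => j ji.
rewrite !resampleE (negbTE il); case: eqP => // ->.
by rewrite -[in LHS]lp_normN // -[in RHS]lp_normN // !opprB !leNgt !(le_lt_trans ra).
Qed.

(** A count, written with the indicator of one measurable set of pairs so that it is measurable
    jointly in z and y. Leaving out l makes it independent of the l-th point. *)
Definition nbrs l (z : VN) (y : V) : R :=
  \sum_(i < N | i != l) \1_[set u : V * V | lp_norm p (u.2 - u.1) <= a] (y, tnth z i).

Lemma nbrs_ge0 l z y : 0 <= nbrs l z y.
Proof. by apply: sumr_ge0 => i _. Qed.

Lemma trunc_mean_resample l z x :
  `|trunc_mean z - trunc_mean (resample l z x)| <=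
  2 * trunc_bound / N%:R * (1 + nbrs l z (tnth z l) + nbrs l z x).
Proof.
rewrite -mulrBr normrM ger0_norm ?invr_ge0 // -sumrB [leRHS]mulrAC mulrC ler_wpM2r ?invr_ge0 //.
apply: le_trans (ler_norm_sum _ _ _) _.
have M0 := trunc_bound_ge0.
have dM i : `|trunc_term z i - trunc_term (resample l z x) i| <= 2 * trunc_bound.
  apply: le_trans (ler_normB _ _) _.
  by have := trunc_term_bound z i; have := trunc_term_bound (resample l z x) i; lra.
rewrite (bigD1 l) //= -addrA mulrDr mulr1 lerD //.
rewrite /nbrs -big_split /= mulr_sumr; apply: ler_sum => i il.
rewrite !indicE; set A := [set u | _].
case: (boolP (_ \in A)) => [_|A1].
  by apply: le_trans (dM i) _; rewrite ler_peMr ?mulr_ge0 // -natrD ler1n.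
case: (boolP (_ \in A)) => [_|A2]; first by rewrite add0r mulr1.
rewrite trunc_term_resample ?subrr ?normr0 ?addr0 ?mulr0 //.
- by rewrite ltNge; apply: contra A1 => h; rewrite inE.
- by rewrite ltNge; apply: contra A2 => h; rewrite inE.
Qed.

Variables (f : V -> R) (Ca : R).
Hypothesis mf : measurable_fun setT f.
Hypothesis f0 : forall x, 0 <= f x.
Hypothesis f1 : (\int[leb]_x (f x)%:E = 1)%E.
Hypothesis Ca0 : 0 <= Ca.
Hypothesis fCa : {ae leb, forall x, f x <= Ca}.
Local Notation mu := (density_prob mf f0 f1).
Variable nu : probability (N.-tuple V) R.
Hypothesis nuP : iid_law mu nu.

Let S := (Ca * T) ^+ 2 + Ca * T.

Lemma measurable_nbrs l : measurable_fun setT (fun u : VN * V => nbrs l u.1 u.2).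
Proof.
have mA : measurable [set u : V * V | lp_norm p (u.2 - u.1) <= a].
  by apply: measurable_le_fun; exact: measurable_lp_sub.
rewrite /nbrs; under eq_fun do rewrite -big_filter.
apply: measurable_sum => i.
apply: (measurableT_comp (measurable_indic mA)).
apply: measurable_fun_pair => //.
exact: (measurableT_comp (@measurable_tnth _ _ _ i)).
Qed.

(** When the square is expanded, pairs of distinct points contribute at most (N q)^2 and the
    diagonal N q. The ball of radius a has volume T / N, hence N q <= Ca T. *)
Lemma nbrs_sqr l y : (\int[nu]_z (nbrs l z y ^+ 2)%:E <= S%:E)%E.
Proof.
pose B := [set x : V | lp_norm p (x - y) <= a].
have mB : measurable B by exact: measurable_lp_ball_at.
pose q := ball_prob p mf f0 f1 a y.
have muB : mu B = q%:E by exact: ball_probE.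
have q0 : 0 <= q by have /andP[] := ball_prob01 p mf f0 f1 a y.
have Nq : N%:R * q <= Ca * T.
  have := ball_prob_le p1 d0 mf f0 f1 Ca0 fCa y (scale_radius_ge0 (d := d) p N T).
  rewrite volume_radius ?(ltW T0) // -/q => qle.
  by rewrite mulrC -ler_pdivlMr // -mulrA.
pose A i := [set z : VN | tnth z i \in B].
have mA i : measurable (A i) by exact: measurable_tnth_in.
apply: (@le_trans _ _ (\int[nu]_z \sum_(i < N) \sum_(j < N) (\1_(A i `&` A j) z)%:E)%E).
  apply: ge0_le_integral => //.
  - by move=> z _; rewrite lee_fin sqr_ge0.
  - apply/measurable_EFinP; apply: measurable_funX.
    apply: (measurableT_comp (measurable_nbrs l) (g := fun z : VN => (z, y))).
    exact: measurable_fun_pair.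
  - apply: emeasurable_sum => i; apply: emeasurable_sum => j.
    by apply/measurable_EFinP/measurable_indic/measurableI.
  - move=> z _; under eq_bigr do rewrite sumEFin; rewrite sumEFin lee_fin.
    have le1 : nbrs l z y <= \sum_(i < N) \1_(A i) z.
      rewrite [leRHS](bigD1 l) //= ler_wpDl //; apply: ler_sum => i _.
      rewrite !indicE ler_nat; case: (boolP (z \in A i)) => [_|zA]; first exact: leq_b1.
      by rewrite leqn0 eqb0; apply: contra zA => h; rewrite !inE /A /= in h *; rewrite inE.
    apply: (@le_trans _ _ ((\sum_(i < N) \1_(A i) z) ^+ 2)).
      by rewrite ler_pXn2r // nnegrE ?nbrs_ge0 // sumr_ge0.
    rewrite expr2 mulr_suml; apply: ler_sum => i _; rewrite mulr_sumr.
    by apply: ler_sum => j _; rewrite indicI.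
rewrite ge0_integral_sum //; last 2 first.
- move=> i; apply: emeasurable_sum => j.
  by apply/measurable_EFinP/measurable_indic/measurableI.
- by move=> i z _; apply: sume_ge0 => j _; rewrite lee_fin.
apply: (@le_trans _ _ (\sum_(i < N) \sum_(j < N) (q * q + (j == i)%:R * q)%:E)%E).
  apply: lee_sum => i _; rewrite ge0_integral_sum //; last first.
    by move=> j; apply/measurable_EFinP/measurable_indic/measurableI.
  apply: lee_sum => j _; rewrite integral_indic ?setIT //; last exact: measurableI.
  have [->|ji] := eqVneq j i.
    rewrite setIid mul1r (_ : A i = (fun z : VN => tnth z i) @^-1` B); last first.
      by apply/seteqP; split => z; rewrite /A /= inE.
    apply: (@le_trans _ _ q%:E); last by rewrite lee_fin lerDr mulr_ge0.
    by rewrite le_eqVlt -muB; apply/orP; left; apply/eqP; exact: (iid_marginal nuP i mB).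
  rewrite mul0r addr0 le_eqVlt; apply/orP; left; apply/eqP.
  by apply: (indep_pair nuP mB muB); rewrite eq_sym.
under eq_bigr do rewrite sumEFin.
rewrite sumEFin lee_fin.
rewrite (eq_bigr (fun=> N%:R * (q * q) + q)); last first.
  move=> i _; rewrite big_split /= sumr_const card_ord -[_ *+ N]mulr_natl; congr (_ + _).
  by rewrite (bigD1 i) //= eqxx mul1r big1 ?addr0 // => j /negbTE ->; rewrite mul0r.
rewrite sumr_const card_ord -[_ *+ N]mulr_natl /S.
have := ler_pM (mulr_ge0 (ler0n _ _) q0) (mulr_ge0 (ler0n _ _) q0) Nq Nq.
rewrite expr2; lra.
Qed.

Lemma trunc_mean_variance :
  (\int[nu]_z ((trunc_mean z - \int[nu]_z' trunc_mean z') ^+ 2)%:E <=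
   (6 * trunc_bound ^+ 2 * (1 + 2 * S) / N%:R)%:E)%E.
Proof.
apply: le_trans (efron_stein nuP measurable_trunc_mean trunc_mean_bound) _.
set b := 2 * trunc_bound / N%:R.
have M0 := trunc_bound_ge0.
have b0 : 0 <= b by rewrite divr_ge0 // mulr_ge0.
(* The 3 comes from (1 + x + y)^2 <= 3 (1 + x^2 + y^2); with the 4 in b^2 and the 1/2 of Efron-Stein
   it makes the constant 6. *)
apply: (@le_trans _ _ (\sum_(l < N) (2^-1 * (b ^+ 2 * 3 * (1 + (S + S))))%:E)%E); last first.
  rewrite sumEFin lee_fin sumr_const card_ord -[_ *+ N]mulr_natl.
  rewrite le_eqVlt; apply/orP; left; apply/eqP; rewrite /b; field.
  by rewrite pnatr_eq0 gtn_eqF.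
apply: lee_sum => l _; rewrite [leRHS]EFinM; apply: lee_wpmul2l => //.
have mn1 : measurable_fun setT (fun u : VN * VN => nbrs l u.1 (tnth u.1 l)).
  apply: (measurableT_comp (measurable_nbrs l) (g := fun u : VN * VN => (u.1, tnth u.1 l))).
  by apply: measurable_fun_pair => //; exact: (measurableT_comp (@measurable_tnth _ _ _ l)).
have mn2 : measurable_fun setT (fun u : VN * VN => nbrs l u.1 (tnth u.2 l)).
  apply: (measurableT_comp (measurable_nbrs l) (g := fun u : VN * VN => (u.1, tnth u.2 l))).
  by apply: measurable_fun_pair => //; exact: (measurableT_comp (@measurable_tnth _ _ _ l)).
have mn1' : measurable_fun setT (fun u : VN * VN => nbrs l u.1 (tnth u.1 l) ^+ 2).
  exact: measurable_funX.
have mn2' : measurable_fun setT (fun u : VN * VN => nbrs l u.1 (tnth u.2 l) ^+ 2).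
  exact: measurable_funX.
apply: (@le_trans _ _ (\int[nu \x nu]_u (b ^+ 2 * 3 * (1 +
    (nbrs l u.1 (tnth u.1 l) ^+ 2 + nbrs l u.1 (tnth u.2 l) ^+ 2)))%:E)%E).
  apply: ge0_le_integral => //.
  - by move=> u _; rewrite lee_fin sqr_ge0.
  - apply/measurable_EFinP; apply: measurable_funX; apply: measurable_funB.
      exact: (measurableT_comp measurable_trunc_mean measurable_fst).
    apply: (measurableT_comp measurable_trunc_mean).
    apply: (measurableT_comp (measurable_resample l) (g := fun u : VN * VN => (u.1, tnth u.2 l))).
    by apply: measurable_fun_pair => //; exact: (measurableT_comp (@measurable_tnth _ _ _ l)).
  - apply/measurable_EFinP; apply: measurable_funM => //; apply: measurable_funD => //.
    exact: measurable_funD.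
  - move=> u _; rewrite lee_fin.
    have h := trunc_mean_resample l u.1 (tnth u.2 l).
    have n1 := nbrs_ge0 l u.1 (tnth u.1 l); have n2 := nbrs_ge0 l u.1 (tnth u.2 l).
    rewrite -real_normK ?num_real //.
    apply: (@le_trans _ _ ((b * (1 + nbrs l u.1 (tnth u.1 l) + nbrs l u.1 (tnth u.2 l))) ^+ 2)).
      by rewrite ler_pXn2r // nnegrE mulr_ge0 // !addr_ge0.
    rewrite exprMn -mulrA ler_wpM2l ?sqr_ge0 //.
    move: (nbrs l u.1 (tnth u.1 l)) (nbrs l u.1 (tnth u.2 l)) => x y.
    have := sqr_ge0 (x - y); have := sqr_ge0 (1 - x); have := sqr_ge0 (1 - y).
    rewrite !expr2; lra.
have S0 : 0 <= S by rewrite addr_ge0 ?sqr_ge0 // mulr_ge0 // ltW.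
apply: integralZ_le.
- by rewrite mulr_ge0 // sqr_ge0.
- by apply: measurable_funD => //; exact: measurable_funD.
- by move=> u; rewrite !addr_ge0 // sqr_ge0.
apply: integralD_le => //.
- exact: measurable_funD.
- by move=> u; rewrite !addr_ge0 // sqr_ge0.
- by rewrite integral_cst // mul1e; apply: probability_le1.
apply: integralD_le => //.
- by move=> u; rewrite sqr_ge0.
- by move=> u; rewrite sqr_ge0.
- have mF : measurable_fun setT (fun u : VN * VN => (nbrs l u.1 (tnth u.1 l) ^+ 2)%:E).
    exact/measurable_EFinP.
  rewrite (fubini_tonelli1 _ mF); last by move=> u; rewrite lee_fin sqr_ge0.
  have mG : measurable_fun setT (fun z : VN => (nbrs l z (tnth z l) ^+ 2)%:E).
    apply/measurable_EFinP; apply: measurable_funX.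
    apply: (measurableT_comp (measurable_nbrs l) (g := fun z : VN => (z, tnth z l))).
    by apply: measurable_fun_pair => //; exact: (@measurable_tnth _ _ _ l).
  have -> : (\int[nu]_z fubini_F nu (fun u : VN * VN => (nbrs l u.1 (tnth u.1 l) ^+ 2)%:E) z =
      \int[nu]_z (nbrs l z (tnth z l) ^+ 2)%:E)%E.
    apply: eq_integral => z _; rewrite /fubini_F /= integral_cst //.
    by rewrite [X in (_ * X)%E](@probability_setT _ _ _ nu) mule1.
  (* The old position is itself a coordinate of z. Conditioning on it fixes the centre, while the
     counted points keep their law because [nbrs l] leaves out the l-th one. *)
  rewrite (ge0_integral_resample nuP l mG); last by move=> z; rewrite lee_fin sqr_ge0.
  have -> : (\int[mu]_x \int[nu]_z (nbrs l (resample l z x) (tnth (resample l z x) l) ^+ 2)%:E =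
      \int[mu]_x \int[nu]_z (nbrs l z x ^+ 2)%:E)%E.
    apply: eq_integral => x _; apply: eq_integral => z _.
    rewrite resampleE eqxx; congr ((_ ^+ 2)%:E).
    by apply: eq_bigr => i il; rewrite resampleE (negbTE il).
  apply: (@le_trans _ _ (\int[mu]_x (cst S%:E) x)%E); last first.
    by rewrite integral_cst // [X in (_ * X)%E](@probability_setT _ _ _ mu) mule1.
  have mH : measurable_fun setT (fun u : VN * V => (nbrs l u.1 u.2 ^+ 2)%:E).
    by apply/measurable_EFinP; apply: measurable_funX; exact: measurable_nbrs.
  apply: ge0_le_integral => //.
  + by move=> x _; apply: integral_ge0 => z _; rewrite lee_fin sqr_ge0.
  + by apply: (measurable_fun_fubini_tonelli_G (m1 := nu) _ mH) => u; rewrite lee_fin sqr_ge0.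
  + by move=> x _; exact: (nbrs_sqr l x).
- have mF : measurable_fun setT (fun u : VN * VN => (nbrs l u.1 (tnth u.2 l) ^+ 2)%:E).
    exact/measurable_EFinP.
  rewrite (fubini_tonelli2 _ mF); last by move=> u; rewrite lee_fin sqr_ge0.
  apply: (@le_trans _ _ (\int[nu]_x (cst S%:E) x)%E); last first.
    by rewrite integral_cst // [X in (_ * X)%E](@probability_setT _ _ _ nu) mule1.
  apply: ge0_le_integral => //.
  + by move=> x _; apply: integral_ge0 => z _; rewrite lee_fin sqr_ge0.
  + by apply: (measurable_fun_fubini_tonelli_G (m1 := nu) _ mF) => u; rewrite lee_fin sqr_ge0.
  + by move=> y _; rewrite /fubini_G /=; exact: (nbrs_sqr l (tnth y l)).
Qed.

End variance.

(** * Bias of the truncated estimator *)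

Section positive_FTC.
Context {R : realType}.
Local Notation leb := (@lebesgue_measure R).

Lemma positive_FTC (F g : R -> R) (a b : R) : 0 < a -> a <= b ->
  (forall x : R, 0 < x -> is_derive x (1 : R) F (g x)) ->
  (forall x : R, 0 < x -> {for x, continuous g}) ->
  (\int[leb]_(x in `[a, b]) (g x)%:E = (F b - F a)%:E)%E.
Proof.
move=> a0; rewrite le_eqVlt => /orP[/eqP <-|ab] dF cg.
  by rewrite set_itv1 integral_set1 subrr.
have cF (x : R) : 0 < x -> {for x, continuous F}.
  by move=> x0; apply: differentiable_continuous; apply/derivable1_diffP; have [] := dF x x0.
rewrite (@continuous_FTC2 _ g F) //.
- apply: continuous_in_subspaceT => x; rewrite inE /= in_itv /= => /andP[ax _].
  by apply: cg; exact: lt_le_trans ax.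
- split.
  + by move=> x; rewrite in_itv /= => /andP[ax _]; have [] := dF x (lt_trans a0 ax).
  + by apply: cvg_at_right_filter; exact: cF.
  + by apply: cvg_at_left_filter; apply: cF; exact: lt_trans ab.
- move=> x; rewrite in_itv /= => /andP[ax _].
  by rewrite derive1E; have [_ ->] := dF x (lt_trans a0 ax).
Qed.

Lemma continuous_inv_gt0 (x : R) : 0 < x -> {for x, continuous (fun y : R => y^-1)}.
Proof. by move=> x0; apply: inv_continuous; rewrite gt_eqF. Qed.

Lemma integral_inv (a b : R) : 0 < a -> a <= b ->
  (\int[leb]_(x in `[a, b]) (x^-1)%:E = (ln b - ln a)%:E)%E.
Proof.
by move=> a0 ab; apply: positive_FTC => // x x0; exact: continuous_inv_gt0.
Qed.

End positive_FTC.

Section layer_cake.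
Context {R : realType}.
Local Notation leb := (@lebesgue_measure R).
Variables (psi T e : R).
Hypothesis e0 : 0 < e.
Hypothesis eT : e <= T.

Let g (s : R) : R := s^-1 * \1_(`[e, T]) s.

Let g0 s : 0 <= g s.
Proof.
rewrite /g indicE; case: (boolP (s \in _)) => [|_]; last by rewrite mulr0.
by rewrite inE /= in_itv /= => /andP[es _]; rewrite mulr1 invr_ge0 (le_trans (ltW e0)).
Qed.

Let mg : measurable_fun setT g.
Proof.
rewrite (_ : g = fun s => s `^ (-1) * \1_(`[e, T]) s); last first.
  apply/funext => s; rewrite /g indicE; case: (boolP (s \in _)) => [|_]; last by rewrite !mulr0.
  rewrite inE /= in_itv /= => /andP[es _].
  by rewrite powR_inv1 // (le_trans (ltW e0)).
by apply: measurable_funM; [exact: measurable_powR|exact: measurable_indic].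
Qed.

(** For t <= T this is the integral of ds/s over the part of [e, T] above t, hence an integral of
    indicators of t <= s; [log_trunc] is a multiple of the indicator of t <= T minus it. *)
Let A (t : R) : R := if t <= T then ln T - ln (Num.max t e) else 0.

Let AE t : (\int[leb]_s (g s * (t <= s)%R%:R)%:E = (A t)%:E)%E.
Proof.
have m0 : 0 < Num.max t e by rewrite lt_max e0 orbT.
rewrite /A; case: ifP => tT; last first.
  rewrite (eq_integral (fun=> 0%E)) ?integral0 // => s _; rewrite /g indicE.
  case: (boolP (s \in _)) => [|_]; last by rewrite mulr0 mul0r.
  rewrite inE /= in_itv /= => /andP[_ sT].
  by rewrite (_ : (t <= s)%R = false) ?mulr0 //; apply: contraFF tT => /le_trans; exact.
rewrite -integral_inv //; last by rewrite ge_max tT.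
rewrite [RHS]integral_mkcond; apply: eq_integral => s _.
rewrite patchE /g indicE.
have -> : (s \in `[Num.max t e, T]%classic) = (s \in `[e, T]%classic) && (t <= s).
  rewrite !mem_setE /= !in_itv /= ge_max.
  by case: (t <= s); case: (e <= s); case: (s <= T).
case: (s \in _) => /=; last by rewrite mulr0 mul0r.
by case: (t <= s); rewrite ?mulr1 ?mulr0.
Qed.

Let A0 t : 0 <= A t.
Proof.
by rewrite -lee_fin -AE; apply: integral_ge0 => s _; rewrite lee_fin mulr_ge0.
Qed.

Let log_truncE t : log_trunc psi T e t = (ln T - psi) * (t <= T)%R%:R - A t.
Proof. by rewrite /log_trunc /A; case: ifP => _; rewrite ?mulr1 ?mulr0; lra. Qed.

Section law.
Context dd (W : measurableType dd) (P : probability W R) (tau : W -> R).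
Hypothesis mtau : measurable_fun setT tau.

Definition cdf (s : R) : R := fine (P [set w | tau w <= s]).

Let mle s : measurable [set w | tau w <= s].
Proof. exact: measurable_le_fun. Qed.

Let cdfE s : P [set w | tau w <= s] = (cdf s)%:E.
Proof. by rewrite /cdf fineK // fin_num_measure. Qed.

Let mG : measurable_fun setT (fun u : W * R => (g u.2 * (tau u.1 <= u.2)%R%:R)%:E).
Proof.
apply/measurable_EFinP; apply: measurable_funM.
  exact: (measurableT_comp mg measurable_snd).
rewrite (_ : (fun _ => _) = fun u : W * R => if tau u.1 <= u.2 then 1 else 0); last first.
  by apply/funext => u; case: (_ <= _).
apply: measurable_fun_ifT => //; apply: measurable_fun_ler => //.
exact: (measurableT_comp mtau measurable_fst).
Qed.

Let G0 u : (0 <= (g u.2 * (tau u.1 <= u.2)%R%:R)%:E)%E.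
Proof. by rewrite lee_fin mulr_ge0. Qed.

Let inner s : (\int[P]_w (g s * (tau w <= s)%R%:R)%:E = (g s * cdf s)%:E)%E.
Proof.
under eq_integral do rewrite EFinM.
have ms : measurable_fun setT (fun w => ((tau w <= s)%R%:R : R)%:E).
  apply/measurable_EFinP.
  rewrite (_ : (fun _ => _) = fun w => if tau w <= s then 1 else 0); last first.
    by apply/funext => u; case: (_ <= _).
  by apply: measurable_fun_ifT => //; exact: measurable_fun_ler.
rewrite ge0_integralZl_EFin //.
rewrite [RHS]EFinM -cdfE; congr (_ * _)%E; rewrite -(setIT [set w | _]) -integral_indic //.
by apply: eq_integral => w _; rewrite indicE; case: (boolP (tau w <= s)%R) => h;
    [rewrite mem_set|rewrite memNset //=; apply/negP].
Qed.

Lemma measurable_g_cdf : measurable_fun setT (fun s => (g s * cdf s)%:E).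
Proof.
have := measurable_fun_fubini_tonelli_G (m1 := P) _ mG G0.
congr (measurable_fun _ _); apply/funext => s; rewrite -inner //.
Qed.

Lemma layer_cake : P.-integrable setT (EFin \o (A \o tau)) /\
  (\int[P]_w (A (tau w))%:E = \int[leb]_s (g s * cdf s)%:E)%E.
Proof.
have E : (\int[P]_w (A (tau w))%:E = \int[leb]_s (g s * cdf s)%:E)%E.
  transitivity (\int[P]_w \int[leb]_s (g s * (tau w <= s)%R%:R)%:E)%E.
    by apply: eq_integral => w _; rewrite AE.
  have := @fubini_tonelli _ _ _ _ R P leb _ mG G0.
  rewrite /fubini_F /fubini_G /= => ->.
  by apply: eq_integral => s _; exact: inner.
split => //.
apply: (@bounded_integrable _ _ _ _ _ (ln T - ln e)).
  apply: (measurableT_comp (_ : measurable_fun setT A) mtau).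
  apply: measurable_fun_ifT => //; first exact: measurable_fun_ler.
  apply: measurable_funB => //; apply: (measurableT_comp (@measurable_ln R)).
  exact: measurable_maxr.
move=> w; rewrite /= ger0_norm // /A; case: ifP => _.
  by rewrite lerD2l lerN2 ler_ln ?posrE ?lt_max ?e0 ?orbT // le_max lexx orbT.
by rewrite subr_ge0 ler_ln ?posrE // (lt_le_trans e0).
Qed.

Let aval := fine (\int[leb]_s (g s * cdf s)%:E)%E.

Lemma integral_log_trunc :
  (\int[leb]_s (g s * cdf s)%:E)%E = aval%:E /\
  \int[P]_w log_trunc psi T e (tau w) = (ln T - psi) * cdf T - aval.
Proof.
have [iA EA] := layer_cake; split.
  by rewrite /aval fineK // -EA; exact: integrable_fin_num iA.
have iI : P.-integrable setT (EFin \o (fun w => (ln T - psi) * (tau w <= T)%R%:R)).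
  apply: (@bounded_integrable _ _ _ _ _ `|ln T - psi|).
    apply: measurable_funM => //.
    rewrite (_ : (fun _ => _) = fun w => if tau w <= T then 1 else 0); last first.
      by apply/funext => u; case: (_ <= _).
    by apply: measurable_fun_ifT => //; exact: measurable_fun_ler.
  by move=> w; rewrite normrM ler_piMr // normr_nat lern1 leq_b1.
transitivity (\int[P]_w ((ln T - psi) * (tau w <= T)%R%:R - A (tau w))).
  by apply: eq_Rintegral => w _; rewrite log_truncE.
rewrite RintegralB //; congr (_ - _); last by rewrite /Rintegral /aval -EA.
transitivity (\int[P]_w ((ln T - psi) * \1_[set w | tau w <= T] w)).
  apply: eq_Rintegral => w _; rewrite indicE; congr (_ * _).
  by case: (boolP (tau w <= T)%R) => h; [rewrite mem_set|rewrite memNset //=; apply/negP].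
rewrite RintegralZl //.
  by rewrite /Rintegral integral_indic // setIT.
apply: (@bounded_integrable _ _ _ _ _ 1); first exact: measurable_indic.
by move=> w; rewrite indicE normr_nat lern1 leq_b1.
Qed.

End law.

(** By the layer cake, both means depend on the laws only through their distribution functions on
    [e, T]. A bound E on the difference of these passes to the means: once at T, from the jump of
    [log_trunc] there, and once integrated against ds/s. *)
Lemma log_trunc_compare d1 (W1 : measurableType d1) (P1 : probability W1 R) (tau1 : W1 -> R)
    d2 (W2 : measurableType d2) (P2 : probability W2 R) (tau2 : W2 -> R) (E : R -> R) (B : R) :
  measurable_fun setT tau1 -> measurable_fun setT tau2 -> measurable_fun setT E ->
  (forall s, e <= s <= T -> `|cdf P1 tau1 s - cdf P2 tau2 s| <= E s) ->
  (\int[leb]_(s in `[e, T]) (s^-1 * E s)%:E <= B%:E)%E ->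
  `|\int[P1]_w log_trunc psi T e (tau1 w) - \int[P2]_w log_trunc psi T e (tau2 w)| <=
    `|ln T - psi| * E T + B.
Proof.
move=> m1 m2 mE FE EB.
have [a1 ->] := integral_log_trunc P1 m1; have [a2 ->] := integral_log_trunc P2 m2.
set A1 := fine _ in a1 *; set A2 := fine _ in a2 *.
have E0 s : e <= s <= T -> 0 <= E s by move=> /FE; apply: le_trans.
have gE0 s : 0 <= g s * E s.
  have [sI|sI] := boolP (e <= s <= T); first by rewrite mulr_ge0 // E0.
  by rewrite /g indicE mem_setE /= in_itv /= (negbTE sI) mulr0 mul0r.
have gEB : (\int[leb]_s (g s * E s)%:E <= B%:E)%E.
  apply: le_trans EB; rewrite [leRHS]integral_mkcond le_eqVlt; apply/orP; left; apply/eqP.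
  apply: eq_integral => s _; rewrite patchE /g indicE.
  by case: (s \in _); rewrite ?mulr1 ?mulr0 ?mul0r.
have c0 dd (W : measurableType dd) (P : probability W R) (tau : W -> R) s : 0 <= cdf P tau s.
  by rewrite fine_ge0.
have key d3 (W3 : measurableType d3) (P3 : probability W3 R) (tau3 : W3 -> R)
    d4 (W4 : measurableType d4) (P4 : probability W4 R) (tau4 : W4 -> R) x y :
    measurable_fun setT tau3 -> measurable_fun setT tau4 ->
    (forall s, e <= s <= T -> cdf P3 tau3 s <= cdf P4 tau4 s + E s) ->
    (\int[leb]_s (g s * cdf P3 tau3 s)%:E)%E = x%:E ->
    (\int[leb]_s (g s * cdf P4 tau4 s)%:E)%E = y%:E -> x <= y + B.
  move=> m3 m4 h xE yE; rewrite -lee_fin EFinD -xE -yE.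
  apply: (@le_trans _ _ (\int[leb]_s ((g s * cdf P4 tau4 s)%:E + (g s * E s)%:E)%E)%E).
    apply: ge0_le_integral => //.
    - by move=> s _; rewrite lee_fin mulr_ge0.
    - exact: measurable_g_cdf.
    - apply: emeasurable_funD; first exact: measurable_g_cdf.
      by apply/measurable_EFinP; exact: measurable_funM.
    - move=> s _; rewrite -EFinD lee_fin -mulrDr.
      have [sI|sI] := boolP (e <= s <= T); first by rewrite ler_wpM2l // h.
      by rewrite /g indicE mem_setE /= in_itv /= (negbTE sI) mulr0 !mul0r.
  rewrite ge0_integralD //.
  - exact: leeD.
  - by move=> s _; rewrite lee_fin mulr_ge0.
  - exact: measurable_g_cdf.
  - by move=> s _; rewrite lee_fin.
  - by apply/measurable_EFinP; exact: measurable_funM.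
have k1 : A1 <= A2 + B.
  apply: (key _ _ _ _ _ _ _ _ _ _ m1 m2 _ a1 a2) => s /FE; rewrite ler_norml => /andP[_]; lra.
have k2 : A2 <= A1 + B.
  apply: (key _ _ _ _ _ _ _ _ _ _ m2 m1 _ a2 a1) => s /FE; rewrite ler_norml => /andP[+ _]; lra.
rewrite (_ : _ - _ - _ = (ln T - psi) * (cdf P1 tau1 T - cdf P2 tau2 T) + (A2 - A1)); last by ring.
apply: le_trans (ler_normD _ _) _; rewrite normrM lerD //.
  by rewrite ler_wpM2l // FE // eT lexx.
by rewrite ler_norml; apply/andP; split; lra.
Qed.

End layer_cake.

Section cdf_comparison.
Context {R : realType} {d : nat}.
Local Notation V := 'rV[R]_d.
Local Notation leb := (lebesgue_rV R d).
Variables (k : nat) (p : \bar R).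
Hypothesis k0 : (0 < k)%N.
Hypothesis p1 : (1 <= p)%E.
Hypothesis d0 : (0 < d)%N.
Variables (f : V -> R) (Ca K : R).
Hypothesis mf : measurable_fun setT f.
Hypothesis f0 : forall x, 0 <= f x.
Hypothesis f1 : (\int[leb]_x (f x)%:E = 1)%E.
Hypothesis Ca0 : 0 <= Ca.
Hypothesis K0 : 0 <= K.
Hypothesis fCa : {ae leb, forall x, f x <= Ca}.
Local Notation c := (unit_ball_volume d p).
Hypothesis fK : forall (r : R) (P : V -> R), 0 < r -> r <= 1 -> measurable_fun setT P ->
  (forall x, (\int[leb]_(y in [set y | (lp_norm p (y - x) <= r)%R]) (f y)%:E = (P x)%:E)%E) ->
  (\int[leb]_x (`|P x - f x * (c * r ^+ d)|)%:E <= (c * r ^+ d * (K * (r * (1 + ln r^-1))))%:E)%E.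
Local Notation mu := (density_prob mf f0 f1).
Variable N : nat.
Hypothesis kN : (k < N)%N.
Variable nu : probability (N.-tuple V) R.
Hypothesis nuP : iid_law mu nu.

Let N0 : (0 < N)%N. Proof. exact: leq_ltn_trans kN. Qed.
Let NR0 : 0 < N%:R :> R. Proof. by rewrite ltr0n. Qed.
Let c0 : 0 < c. Proof. exact: unit_ball_volume_gt0. Qed.

Local Notation gam := (gamma_prob k.-1 : probability (measurableTypeR R) R).
Local Notation rad := (scale_radius (d := d) p N).

(* If U has density s^(k-1) e^(-s) / (k-1)! and X has density f, then U / f(X)
   is the limit of N c_(d,p) rho^d. *)
Definition limit_law : probability (V * measurableTypeR R)%type R := (mu \x gam)%E.
Definition limit_scaled (u : V * measurableTypeR R) : R := u.2 / f u.1.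

Lemma measurable_limit_scaled : measurable_fun setT limit_scaled.
Proof.
rewrite (_ : limit_scaled = fun u => u.2 * f u.1 `^ (-1)).
  apply: measurable_funM; first exact: measurable_snd.
  apply: (measurableT_comp (measurable_powR _)).
  exact: (measurableT_comp mf measurable_fst).
by apply/funext => u; rewrite /limit_scaled powR_inv1.
Qed.

Lemma binom_lt01 m n (q : R) : 0 <= q <= 1 -> 0 <= binom_lt m n q <= 1.
Proof.
move=> /andP[q0 q1]; elim: n m => [|n IH] [|m] /=; rewrite ?lexx ?ler01 //.
have /andP[a0 a1] := IH m; have /andP[b0 b1] := IH m.+1.
have q0' : 0 <= 1 - q by rewrite subr_ge0.
rewrite addr_ge0 ?mulr_ge0 //=.
have := ler_wpM2l q0 a1; have := ler_wpM2l q0' b1; rewrite !mulr1; lra.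
Qed.

Lemma measurable_binom_lt dd (W : measurableType dd) (q : W -> R) m n :
  measurable_fun setT q -> measurable_fun setT (fun x => binom_lt m n (q x)).
Proof.
move=> mq; elim: n m => [|n IH] [|m] //=; apply: measurable_funD; apply: measurable_funM => //.
exact: measurable_funB.
Qed.

Lemma measurable_poisson_lt m : measurable_fun setT (@poisson_lt R m).
Proof. by apply: measurable_sum => j; exact: measurable_gamma_pdf. Qed.

Lemma cdf_limit t : 0 < t ->
  cdf limit_law limit_scaled t = \int[mu]_x (1 - poisson_lt k (f x * t)).
Proof.
move=> t0; rewrite /cdf /Rintegral; congr fine.
have ft0 x : 0 <= f x * t by rewrite mulr_ge0 // ltW.
transitivity (\int[mu]_x gam (xsection [set u | (limit_scaled u <= t)%R] x))%E; first by [].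
rewrite [LHS]ge0_integral_density_prob; last 2 first.
- apply: measurable_fun_xsection; apply: measurable_le_fun; exact: measurable_limit_scaled.
- by move=> x; exact: measure_ge0.
rewrite [RHS]ge0_integral_density_prob; last 2 first.
- apply/measurable_EFinP; apply: measurable_funB => //.
  by apply: (measurableT_comp (measurable_poisson_lt k)); exact: measurable_funM.
- by move=> x; rewrite lee_fin subr_ge0 poisson_lt_le1.
apply: eq_integral => x _.
(* Where f vanishes, the quotient in [limit_scaled] takes its default value 0, but the density
   weight is 0 as well. *)
have [->|fx0] := eqVneq (f x) 0; first by rewrite !mule0.
have {}fx0 : 0 < f x by rewrite lt_def fx0 f0.
congr (_ * _)%E; rewrite -[in RHS](prednK k0) -(gamma_prob_itv k.-1 (ft0 x)).
congr (gamma_prob _ _); apply/seteqP; split => u; rewrite /xsection /= in_itv /= inE /limit_scaled /=.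
  by rewrite ler_pdivrMr // mulrC.
by rewrite ler_pdivrMr // mulrC.
Qed.

Lemma cdf_knn i t : 0 < t ->
  cdf nu (fun z => knn_scaled k p (tnth z) i) t =
  \int[mu]_x (1 - binom_lt k N.-1 (ball_prob p mf f0 f1 (rad t) x)).
Proof.
move=> t0; rewrite /cdf /Rintegral; congr fine.
rewrite -(knn_law p k0 kN nuP i (rad t)); congr (nu _).
by apply/seteqP; split => z /=; rewrite knn_scaled_le // ltW.
Qed.

(** Given X_i = x, let q <= Ca t / N be the mass of the ball. The binomial tail is compared with the
    Poisson tail of mean (N-1) q, at cost N q^2, then of mean N q, at cost q, then of mean f(x) t,
    at the cost of the relative distance of the means. The denominator f(x) t cancels the weight
    f(x), which leaves the L1 distance bounded by [fK]. *)
Lemma cdf_diff_le i t : 0 < t -> rad t <= 1 ->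
  `|cdf nu (fun z => knn_scaled k p (tnth z) i) t - cdf limit_law limit_scaled t| <=
  (Ca * t) ^+ 2 / N%:R + Ca * t / N%:R + 2 * k%:R * K * (rad t * (1 + ln (rad t)^-1)).
Proof.
move=> t0 rt1; have r0 : 0 < rad t by exact: scale_radius_gt0.
rewrite cdf_knn // cdf_limit //.
pose q x := ball_prob p mf f0 f1 (rad t) x.
have q01 x : 0 <= q x <= 1 by exact: ball_prob01.
have q0 x : 0 <= q x by have /andP[] := q01 x.
have ft0 x : 0 <= f x * t by rewrite mulr_ge0 // ltW.
have mq : measurable_fun setT q by exact: measurable_ball_prob.
have mu1 : measurable_fun setT (fun x => 1 - binom_lt k N.-1 (q x)).
  by apply: measurable_funB => //; exact: measurable_binom_lt.
have mv : measurable_fun setT (fun x => 1 - poisson_lt k (f x * t)).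
  apply: measurable_funB => //.
  by apply: (measurableT_comp (measurable_poisson_lt k)); exact: measurable_funM.
have iu : mu.-integrable setT (EFin \o (fun x => 1 - binom_lt k N.-1 (q x))).
  apply: (@bounded_integrable _ _ _ _ _ 1) => // x.
  have /andP[b0 b1] := binom_lt01 k N.-1 (q01 x).
  by rewrite ger0_norm ?subr_ge0 // lerBlDr lerDl.
have iv : mu.-integrable setT (EFin \o (fun x => 1 - poisson_lt k (f x * t))).
  apply: (@bounded_integrable _ _ _ _ _ 1) => // x.
  have b0 := poisson_lt_ge0 k (ft0 x); have b1 := poisson_lt_le1 k (ft0 x).
  by rewrite ger0_norm ?subr_ge0 // lerBlDr lerDl.
rewrite -RintegralB //.
pose D x := (1 - binom_lt k N.-1 (q x)) - (1 - poisson_lt k (f x * t)).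
have mD : measurable_fun setT D by exact: measurable_funB.
have iD : mu.-integrable setT (EFin \o D).
  by have := integrableB measurableT iu iv; apply: eq_integrable.
apply: le_trans (le_normr_Rintegral measurableT iD) _.
rewrite -lee_fin /Rintegral fineK; last first.
  by apply: integrable_fin_num => //; exact: (integrable_abse iD).
rewrite [leLHS]ge0_integral_density_prob; last 2 first.
- by apply/measurable_EFinP; exact: measurableT_comp.
- by move=> x; rewrite lee_fin.
pose B := Ca * t / N%:R.
have qB x : q x <= B.
  have := ball_prob_le p1 d0 mf f0 f1 Ca0 fCa x (ltW r0).
  by rewrite volume_radius ?(ltW t0) // mulrA.
have B0 : 0 <= B by apply: le_trans (qB 0).
pose A := N%:R * B ^+ 2 + B.
have A0 : 0 <= A by rewrite addr_ge0 // mulr_ge0 // sqr_ge0.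
pose G x := A * f x + 2 * k%:R / t * N%:R * `|q x - f x * (c * rad t ^+ d)|.
have C0 : 0 <= 2 * k%:R / t * N%:R by rewrite mulr_ge0 // divr_ge0 ?mulr_ge0 // ltW.
have mH : measurable_fun setT (fun x => `|q x - f x * (c * rad t ^+ d)|).
  by apply: measurableT_comp => //; apply: measurable_funB => //; exact: measurable_funM.
have mG : measurable_fun setT G by apply: measurable_funD; exact: measurable_funM.
apply: (@le_trans _ _ (\int[leb]_x (G x)%:E)%E).
  apply: ge0_le_integral => //.
  - by move=> x _; rewrite -EFinM lee_fin mulr_ge0.
  - apply/measurable_EFinP; apply: measurable_funM => //; exact: measurableT_comp.
  - exact/measurable_EFinP.
  - move=> x _; rewrite -EFinM lee_fin /G.
    have [->|fx0] := eqVneq (f x) 0; first by rewrite !mulr0 add0r mulr_ge0.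
    have {}fx0 : 0 < f x by rewrite lt_def fx0 f0.
    have ftx : 0 < f x * t by rewrite mulr_gt0.
    rewrite volume_radius ?(ltW t0) //.
    have Nq0 : 0 <= N%:R * q x by rewrite mulr_ge0.
    have nq0 : 0 <= N.-1%:R * q x by rewrite mulr_ge0.
    have b1 := binom_lt_poisson k N.-1 (q01 x).
    have b2 := poisson_lt_lip k nq0 Nq0.
    have b3 := poisson_lt_rel k0 Nq0 ftx.
    have NE : N%:R = N.-1%:R + 1 :> R by rewrite natr1 prednK.
    have b1' : N.-1%:R * q x ^+ 2 <= N%:R * B ^+ 2.
      apply: ler_pM; rewrite ?sqr_ge0 //; first by rewrite ler_nat leq_pred.
      by rewrite ler_pXn2r // ?nnegrE.
    have b2' : `|N.-1%:R * q x - N%:R * q x| = q x.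
      rewrite NE (_ : _ - _ = - q x); last by ring.
      by rewrite normrN ger0_norm.
    have DE : `|D x| <= A + 2 * k%:R * (`|N%:R * q x - f x * t| / (f x * t)).
      rewrite /D (_ : _ - _ = - ((binom_lt k N.-1 (q x) - poisson_lt k (N.-1%:R * q x)) +
        (poisson_lt k (N.-1%:R * q x) - poisson_lt k (N%:R * q x)) +
        (poisson_lt k (N%:R * q x) - poisson_lt k (f x * t)))); last by ring.
      rewrite normrN; apply: le_trans (ler_normD _ _) _; apply: lerD => //.
      apply: le_trans (ler_normD _ _) _; rewrite /A; apply: lerD.
        exact: le_trans b1 b1'.
      by apply: le_trans b2 _; rewrite b2'.
    apply: le_trans (ler_wpM2r (ltW fx0) DE) _.
    rewrite mulrDl lerD2l.
    have -> : N%:R * q x - f x * t = N%:R * (q x - f x * (t / N%:R)).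
      by field; rewrite gt_eqF.
    rewrite normrM (ger0_norm (ltW NR0)) le_eqVlt; apply/orP; left; apply/eqP.
    by move: (`|_|) => w; field; rewrite !gt_eqF.
have rE : c * rad t ^+ d = t / N%:R by rewrite volume_radius // ltW.
rewrite (_ : (Ca * t) ^+ 2 / N%:R + Ca * t / N%:R + _ =
  A * 1 + 2 * k%:R / t * N%:R * (c * rad t ^+ d * (K * (rad t * (1 + ln (rad t)^-1))))); last first.
  by rewrite rE /A /B; move: (ln _) => w; field; rewrite !gt_eqF.
apply: integralD_le.
- exact: measurable_funM.
- exact: measurable_funM.
- by move=> x; rewrite mulr_ge0.
- by move=> x; rewrite mulr_ge0.
- by apply: integralZ_le => //; rewrite f1.
- apply: integralZ_le => //; apply: fK => // x; exact: integral_ball_prob.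
Qed.

End cdf_comparison.

Section radius_integral.
Context {R : realType} {d : nat}.
Local Notation leb := (@lebesgue_measure R).
Variable p : \bar R.
Hypothesis p1 : (1 <= p)%E.
Hypothesis d0 : (0 < d)%N.
Variable N : nat.
Hypothesis N0 : (0 < N)%N.
Local Notation c := (unit_ball_volume d p).
Local Notation rad := (scale_radius (d := d) p N).

Let NR0 : 0 < N%:R :> R. Proof. by rewrite ltr0n. Qed.
Let c0 : 0 < c. Proof. exact: unit_ball_volume_gt0. Qed.
Let Nc0 : 0 < N%:R * c. Proof. by rewrite mulr_gt0. Qed.
Let dR0 : d%:R != 0 :> R. Proof. by rewrite pnatr_eq0 gtn_eqF. Qed.

Lemma is_derive_scale_radius (s : R) : 0 < s ->
  is_derive s (1 : R) rad (d%:R^-1 * (rad s / s)).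
Proof.
move=> s0; have sc : 0 < s / (N%:R * c) by rewrite divr_gt0.
have h1 : is_derive s (1 : R) (fun x : R => x / (N%:R * c)) (N%:R * c)^-1.
  rewrite (_ : (fun _ => _) = fun x : R => (N%:R * c)^-1 * x); last first.
    by apply/funext => x; rewrite mulrC.
  by apply: is_derive_eq; rewrite /GRing.scale /= mulr1.
have h := @is_derive1_comp R (powR (R := R) ^~ d%:R^-1) (fun x : R => x / (N%:R * c)) s _ _
  (is_derive1_powR d%:R^-1 sc) h1.
apply: is_derive_eq h _.
have snz : s / (N%:R * c) != 0 by rewrite gt_eqF.
rewrite /scale_radius powRD ?snz ?implybT // powR_inv1 ?(ltW sc) //.
have cn : c != 0 by rewrite gt_eqF.
have Nn : N%:R != 0 :> R by rewrite gt_eqF.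
have sn : s != 0 by rewrite gt_eqF.
by move: (_ `^ _) => w; field; rewrite dR0 cn Nn sn.
Qed.

(** As [rad] is proportional to s^(1/d), the function d [rad] is a primitive of [rad] s / s: on this
    term the layer-cake weight costs only a factor d. *)
Lemma integral_rate (a1 a2 L e T : R) : 0 <= a1 -> 0 <= a2 -> 0 <= L -> 0 < e -> e <= T ->
  (\int[leb]_(s in `[e, T]) (s^-1 * (a1 * s ^+ 2 + a2 * s + L * rad s))%:E <=
   (a1 * T ^+ 2 + a2 * T + L * d%:R * rad T)%:E)%E.
Proof.
move=> a10 a20 L0 e0 eT; have T0 := lt_le_trans e0 eT.
pose F s := a1 / 2 * s ^+ 2 + a2 * s + L * d%:R * rad s.
have dF (s : R) : 0 < s -> is_derive s (1 : R) F (s^-1 * (a1 * s ^+ 2 + a2 * s + L * rad s)).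
  move=> s0; have hr := is_derive_scale_radius s0.
  have h2 : is_derive s (1 : R) (fun s : R => s ^+ 2) (2 * s).
    by apply: is_derive_eq; rewrite /GRing.scale /=; ring.
  have h3 : is_derive s (1 : R) (fun s => a1 / 2 * s ^+ 2) (a1 * s).
    by apply: is_derive_eq; rewrite /GRing.scale /=; field.
  have h4 : is_derive s (1 : R) (fun s => a2 * s) a2.
    by apply: is_derive_eq; rewrite /GRing.scale /= mulr1.
  have h5 : is_derive s (1 : R) (fun s => L * d%:R * rad s) (L * (rad s / s)).
    by apply: is_derive_eq; rewrite /GRing.scale /=; move: (rad s) => w; field; rewrite dR0 gt_eqF.
  have h := is_deriveD (is_deriveD h3 h4) h5.
  by apply: is_derive_eq h _; move: (rad s) => w; field; rewrite gt_eqF.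
have cF (s : R) : 0 < s -> {for s, continuous (fun x : R => x^-1 * (a1 * x ^+ 2 + a2 * x + L * rad x))}.
  move=> s0; have [dr _] := is_derive_scale_radius s0.
  have cr : {for s, continuous rad}.
    by apply: differentiable_continuous; apply/derivable1_diffP.
  have ci := continuous_inv_gt0 s0.
  have cid : {for s, continuous (fun x : R => x)} by exact: cvg_id.
  have cc (b : R) : {for s, continuous (fun _ : R => b)} by exact: cst_continuous.
  have c2 : {for s, continuous (fun x : R => x ^+ 2)} by exact: exprn_continuous.
  exact: (continuousM ci (continuousD (continuousD (continuousM (cc a1) c2) (continuousM (cc a2) cid))
    (continuousM (cc L) cr))).
rewrite (positive_FTC e0 eT dF cF) lee_fin /F.
have h1 : 0 <= a1 * T ^+ 2 by rewrite mulr_ge0 // sqr_ge0.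
have h2 : 0 <= a1 * e ^+ 2 by rewrite mulr_ge0 // sqr_ge0.
have h3 : 0 <= a2 * e by rewrite mulr_ge0 // ltW.
have h4 : 0 <= L * d%:R * rad e by rewrite !mulr_ge0 // scale_radius_ge0.
lra.
Qed.

(** Above the truncation level 1/N the logarithm of 1/r is at most of order ln N, so it leaves the
    integral over s as a constant. *)
Lemma ln_scale_radius_le (t : R) : N%:R^-1 <= t ->
  1 + ln (rad t)^-1 <= 1 + 2 * ln N%:R + `|ln c|.
Proof.
move=> Nt; have t0 : 0 < t by apply: lt_le_trans Nt; rewrite invr_gt0.
have l0 : 0 <= ln N%:R :> R by rewrite ln_ge0 // ler1n.
have lt : - ln N%:R <= ln t by rewrite -lnV ?posrE // ler_ln ?posrE ?invr_gt0.
rewrite lnV ?posrE ?scale_radius_gt0 // ln_powR lnM ?posrE ?invr_gt0 // lnV ?posrE //.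
rewrite lnM ?posrE // -addrA lerD2l -mulrN.
have d1 : d%:R^-1 <= 1 :> R by rewrite invf_le1 ?ltr0n // ler1n.
have di0 : 0 <= d%:R^-1 :> R by rewrite invr_ge0.
have h : - (ln t - (ln N%:R + ln c)) <= 2 * ln N%:R + `|ln c|.
  by have := ler_norm (ln c); lra.
apply: le_trans (ler_wpM2l di0 h) _; rewrite ler_piMl // addr_ge0 // mulr_ge0 //.
Qed.

End radius_integral.

Section density_signed.
Context d (T : measurableType d) (R : realType) (m : {measure set T -> \bar R}).
Variable w : T -> R.
Hypothesis mw : measurable_fun setT w.
Hypothesis w0 : forall x, 0 <= w x.
Hypothesis w1 : (\int[m]_x (w x)%:E = 1)%E.

Lemma integral_density_prob (h : T -> R) : measurable_fun setT h ->
  (\int[density_prob mw w0 w1]_x (h x)%:E = \int[m]_x (h x * w x)%:E)%E.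
Proof.
move=> mh; rewrite [LHS]integralE [RHS]integralE.
congr (_ - _)%E.
- rewrite [LHS]ge0_integral_density_prob //.
  + apply: eq_integral => x _; rewrite !funeposE -!EFin_max -EFinM; congr EFin.
    by rewrite maxr_pMl // mul0r.
  + by apply: measurable_funepos; apply/measurable_EFinP.
- rewrite [LHS]ge0_integral_density_prob //.
  + apply: eq_integral => x _; rewrite !funenegE -!EFinN -!EFin_max -EFinM; congr EFin.
    by rewrite maxr_pMl // mul0r mulNr.
  + by apply: measurable_funeneg; apply/measurable_EFinP.
Qed.

End density_signed.

Section limit_bias.
Context {R : realType}.
Variables (k : nat) (Ca C0 T : R) (N : nat).
Hypothesis k0 : (0 < k)%N.
Hypothesis C00 : 0 < C0.
Hypothesis N0 : (0 < N)%N.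
Hypothesis T1 : 1 <= T.
Hypothesis TN : ln N%:R <= C0 * T.
Hypothesis CaN : Ca <= N%:R.
Local Notation gam := (gamma_prob k.-1 : probability (measurableTypeR R) R).
Local Notation psi := (digamma k%:R : R).

Let NR0 : 0 < N%:R :> R. Proof. by rewrite ltr0n. Qed.
Let rN : R := N%:R `^ (- 2^-1).
Let rN0 : 0 <= rN. Proof. exact: powR_ge0. Qed.

(** Each summand pays for one truncation of ln (u / y) - psi: the first below 1/N, the second beyond
    T. Both carry the factor N^(-1/2), and their moments are those computed for the Gamma law. *)
Let bound u := 4 * (1 + Ca) * rN * near0 u + (1 + `|psi|) / C0 * rN * (`|u| * expR (u / 2)).

Let neg_ln_le (t : R) : 0 < t -> - ln t <= 4 * t `^ (- 4^-1).
Proof.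
move=> t0; have := ltW (ln_sublinear (powR_gt0 (- 4^-1) t0)).
by rewrite ln_powR; lra.
Qed.

Let pointwise (y u : R) : C0 <= y -> y <= Ca -> 0 < u ->
  `|log_trunc psi T N%:R^-1 (u / y) - (ln u - ln y - psi)| <= bound u.
Proof.
move=> C0y yCa u0; have y0 := lt_le_trans C00 C0y.
have Ca0 := lt_le_trans y0 yCa.
have t0 : 0 < u / y by rewrite divr_gt0.
have -> : ln u - ln y = ln (u / y) by rewrite lnM ?posrE ?invr_gt0 // lnV.
have b1 : 0 <= 4 * (1 + Ca) * rN * near0 u.
  have h0 : 0 <= 1 + Ca by rewrite addr_ge0 // ltW.
  by apply: mulr_ge0 (near0_ge0 u); apply: mulr_ge0 => //; apply: mulr_ge0.
have b2 : 0 <= (1 + `|psi|) / C0 * rN * (`|u| * expR (u / 2)).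
  have h0 : 0 <= (1 + `|psi|) / C0 by apply: divr_ge0; [exact: addr_ge0|exact: ltW].
  by apply: mulr_ge0; [exact: mulr_ge0|apply: mulr_ge0 => //; exact: expR_ge0].
set t := u / y in t0 *.
have uE : u = t * y by rewrite /t divfK // gt_eqF.
rewrite /log_trunc; case: ifP => tT.
  have [Nt|Nt] := leP N%:R^-1 t; first by rewrite subrr normr0 addr_ge0.
  have Nt' := ltW Nt.
  have le0 : ln N%:R^-1 <= 0 :> R by rewrite ln_le0 // invf_le1 // ler1n.
  have ltN : ln t <= ln N%:R^-1 by rewrite ler_ln ?posrE ?invr_gt0.
  rewrite (_ : _ - _ - _ = ln N%:R^-1 - ln t); last by ring.
  rewrite ger0_norm ?subr_ge0 //.
  apply: (@le_trans _ _ (4 * (1 + Ca) * rN * near0 u)); last by rewrite lerDl.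
  apply: (@le_trans _ _ (4 * t `^ (- 4^-1))); first by have := neg_ln_le t0; lra.
  have u1 : 0 < u <= 1.
    rewrite u0 uE /= -[leRHS](@mulVf _ N%:R) ?gt_eqF // ler_pM ?(ltW t0) ?(ltW y0) //.
    exact: le_trans yCa CaN.
  rewrite near0E // -!mulrA ler_wpM2l //.
  have -> : u `^ (- (3 / 4)) = t `^ (- (3 / 4)) * y `^ (- (3 / 4)).
    by rewrite uE powRM ?ltW.
  (* The factor t^(1/2) split off is at most N^(-1/2) since t < 1/N; the remaining power is the
     integrable one of [near0], up to the factor in y. *)
  have -> : t `^ (- 4^-1) = t `^ (2^-1) * t `^ (- (3 / 4)).
    have tn0 : t != 0 by rewrite gt_eqF.
    by rewrite -powRD ?tn0 ?implybT //; apply: (f_equal (powR t)); field.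
  have h1 : t `^ (2^-1) <= rN.
    rewrite /rN powRN -[leRHS]powR_inv1 ?powR_ge0 // -powRrM mulrC powRrM powR_inv1 ?(ltW NR0) //.
    by rewrite ge0_ler_powR // nnegrE ?(ltW t0) // invr_ge0 ltW.
  have h2 : 1 <= (1 + Ca) * y `^ (- (3 / 4)).
    rewrite powRN ler_pdivlMr ?powR_gt0 // mul1r.
    have [y1|y1] := leP y 1.
      apply: (@le_trans _ _ 1); last by rewrite lerDl ltW.
      have q0 : 0 <= 3 / 4 :> R by lra.
      have : y `^ (3 / 4) <= 1 `^ (3 / 4) by apply: (ge0_ler_powR q0); rewrite ?nnegrE ?(ltW y0).
      by rewrite powR1.
    apply: (@le_trans _ _ (y `^ 1)); first by apply: ler_powR; [exact: ltW|lra].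
    by rewrite powRr1 ?(ltW y0) //; lra.
  have tp : 0 <= t `^ (- (3 / 4)) by exact: powR_ge0.
  apply: (@le_trans _ _ (rN * t `^ (- (3 / 4)))); first by rewrite ler_wpM2r.
  rewrite mulrCA ler_wpM2l // mulrCA ler_peMr //.
rewrite sub0r normrN.
have {}tT : T < t by rewrite ltNge tT.
have t1 : 1 <= t by apply: le_trans T1 (ltW tT).
apply: (@le_trans _ _ ((1 + `|psi|) / C0 * rN * (`|u| * expR (u / 2)))); last by rewrite lerDr.
apply: (@le_trans _ _ ((1 + `|psi|) * t)).
  apply: le_trans (ler_normB _ _) _; rewrite mulrDl mul1r lerD //.
    by rewrite ger0_norm ?ln_ge0 // ltW // ln_sublinear.
  by rewrite ler_peMr.
rewrite -!mulrA; apply: ler_wpM2l; first by rewrite addr_ge0.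
have tu : t <= C0^-1 * u.
  by rewrite /t mulrC ler_wpM2r ?(ltW u0) // lef_pV2 ?posrE.
apply: le_trans tu _; apply: ler_wpM2l; first by rewrite invr_ge0 ltW.
rewrite (gtr0_norm u0) mulrCA ler_peMr ?(ltW u0) //.
rewrite /rN /powR gt_eqF // -expRD -[leLHS]expR0 ler_expR.
(* Since u = t y with t > T and y >= C0, the value u is at least ln N, so that exp (u/2) compensates
   N^(-1/2). *)
have : C0 * T <= u.
  have T0 := le_trans ler01 T1; rewrite uE [leLHS]mulrC.
  exact: (ler_pM T0 (ltW C00) (ltW tT) C0y).
move=> /(le_trans TN) h.
by rewrite mulNr addrC subr_ge0 [leRHS]mulrC ler_wpM2l // invr_ge0.
Qed.

Let bias_const := 16 * (1 + Ca) + (1 + `|psi|) / C0 * (k%:R * 2 ^+ k.+1).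

Let gam_gt0 : {ae gam, forall u, 0 < u}.
Proof.
exists `]-oo, 0%R]%classic; split => //.
  rewrite [LHS]gamma_prob_itv // poisson_lt0 subrr //.
by move=> u /= /negP; rewrite -leNgt in_itv.
Qed.

Lemma gamma_log_trunc_bias y : C0 <= y -> y <= Ca ->
  `|\int[gam]_u log_trunc psi T N%:R^-1 (u / y) + ln y| <= bias_const * rN.
Proof.
move=> C0y yCa; have y0 := lt_le_trans C00 C0y.
have Ca0 := lt_le_trans y0 yCa.
have [iln lnE] := @gamma_prob_ln R k.-1; rewrite prednK // in lnE.
have NT : N%:R^-1 <= T by apply: le_trans T1; rewrite invf_le1 // ler1n.
have mt : measurable_fun setT (fun u : R => log_trunc psi T N%:R^-1 (u / y)).
  by apply: (measurableT_comp (measurable_log_trunc _ _ _)); exact: measurable_funM.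
have it : gam.-integrable setT (EFin \o (fun u : R => log_trunc psi T N%:R^-1 (u / y))).
  apply: (@bounded_integrable _ _ _ _ _ (`|psi| + `|ln T| - ln N%:R^-1)) => // u.
  by apply: log_trunc_bound; rewrite ?invr_gt0 // invf_le1 // ler1n.
have icst (b : R) : gam.-integrable setT (EFin \o (fun _ : R => b)).
  by apply: (@bounded_integrable _ _ _ _ _ `|b|).
have il : gam.-integrable setT (EFin \o (fun u : R => ln u - (ln y + psi))).
  by have := integrableB measurableT iln (icst (ln y + psi)); apply: eq_integrable.
have E : \int[gam]_u (ln u - (ln y + psi)) = - ln y.
  rewrite RintegralB // Rintegral_cst // /Rintegral lnE /=.
  rewrite (_ : fine _ = 1); last by rewrite [X in fine X](@probability_setT _ _ _ gam).
  by lra.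
rewrite -[ln y]opprK -E -RintegralB //.
set D := (X in \int[_]_u (X u)); rewrite -/(\int[gam]_u D u).
have mD : measurable_fun setT D.
  by apply: measurable_funB => //; apply: measurable_funB => //; exact: measurable_ln.
have iD : gam.-integrable setT (EFin \o D).
  by have := integrableB measurableT it il; apply: eq_integrable.
apply: le_trans (le_normr_Rintegral measurableT iD) _.
rewrite -lee_fin /Rintegral fineK; last first.
  by apply: integrable_fin_num => //; exact: (integrable_abse iD).
have mb1 : measurable_fun setT (fun u : R => 4 * (1 + Ca) * rN * near0 u).
  by apply: measurable_funM => //; exact: measurable_near0.
have mb2' : measurable_fun setT (fun u : R => `|u| * expR (u / 2)).
  by apply: measurable_funM => //; apply: measurableT_comp => //; exact: measurable_funM.
have mb2 : measurable_fun setT (fun u : R => (1 + `|psi|) / C0 * rN * (`|u| * expR (u / 2))).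
  exact: measurable_funM.
have g1 : 0 <= 4 * (1 + Ca) * rN.
  by apply: mulr_ge0 => //; apply: mulr_ge0 => //; rewrite addr_ge0 // ltW.
have g2 : 0 <= (1 + `|psi|) / C0 * rN.
  by apply: mulr_ge0 => //; apply: divr_ge0; [exact: addr_ge0|exact: ltW].
have b20 (u : R) : 0 <= `|u| * expR (u / 2) by rewrite mulr_ge0 // expR_ge0.
apply: (@le_trans _ _ (\int[gam]_u (bound u)%:E)%E).
  apply: ae_ge0_le_integral => //.
  - apply/measurable_EFinP; exact: measurableT_comp.
  - move=> u _; rewrite lee_fin addr_ge0 // mulr_ge0 //; exact: near0_ge0.
  - by apply/measurable_EFinP; exact: measurable_funD.
  - have [A [mA A0 sub]] := gam_gt0; exists A; split => // u hu.
    apply: sub => /= u0; apply: hu => _; rewrite lee_fin /D.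
    by have := pointwise C0y yCa u0; rewrite -(addrA (ln u)) -(opprD (ln y)).
rewrite (_ : bias_const * rN = 4 * (1 + Ca) * rN * 4 + (1 + `|psi|) / C0 * rN * (k%:R * 2 ^+ k.+1)); last first.
  by rewrite /bias_const; ring.
apply: integralD_le => //.
- by move=> u; apply: mulr_ge0 => //; exact: near0_ge0.
- by move=> u; apply: mulr_ge0.
- apply: integralZ_le => //; [exact: measurable_near0|exact: near0_ge0|exact: gamma_moment_near0].
- by apply: integralZ_le => //; rewrite gamma_moment_exp prednK.
Qed.

End limit_bias.

Section limit_expectation.
Context {R : realType} {d : nat}.
Local Notation V := 'rV[R]_d.
Local Notation leb := (lebesgue_rV R d).
Variable k : nat.
Hypothesis k0 : (0 < k)%N.
Variables (f : V -> R) (Ca C0 T : R).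
Hypothesis mf : measurable_fun setT f.
Hypothesis f0 : forall x, 0 <= f x.
Hypothesis f1 : (\int[leb]_x (f x)%:E = 1)%E.
Hypothesis Ca0 : 0 < Ca.
Hypothesis C00 : 0 < C0.
Hypothesis fCa : {ae leb, forall x, f x <= Ca}.
Hypothesis fC0 : {ae leb, forall x, f x = 0 \/ C0 <= f x}.
Local Notation mu := (density_prob mf f0 f1).
Variable N : nat.
Hypothesis N0 : (0 < N)%N.
Hypothesis T1 : 1 <= T.
Hypothesis TN : ln N%:R <= C0 * T.
Hypothesis CaN : Ca <= N%:R.
Local Notation gam := (gamma_prob k.-1 : probability (measurableTypeR R) R).
Local Notation psi := (digamma k%:R : R).

Definition limit_bias_const : R := 16 * (1 + Ca) + (1 + `|psi|) / C0 * (k%:R * 2 ^+ k.+1).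

Let rN : R := N%:R `^ (- 2^-1).
Let G (u : V * measurableTypeR R) := log_trunc psi T N%:R^-1 (limit_scaled f u).
Let h (x : V) : R := \int[gam]_u log_trunc psi T N%:R^-1 (u / f x).

Let NR0 : 0 < N%:R :> R. Proof. by rewrite ltr0n. Qed.
Let NT : N%:R^-1 <= T.
Proof. by apply: le_trans T1; rewrite invf_le1 // ler1n. Qed.

Let M := `|psi| + `|ln T| - ln (N%:R^-1 : R).

Let boundM t : `|log_trunc psi T N%:R^-1 t| <= M.
Proof. by apply: log_trunc_bound; rewrite ?invr_gt0 // invf_le1 // ler1n. Qed.

Let mG : measurable_fun setT G.
Proof. exact: (measurableT_comp (measurable_log_trunc _ _ _) (measurable_limit_scaled mf f0)). Qed.

Let iG : (mu \x gam)%E.-integrable setT (EFin \o G).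
Proof. by apply: (@bounded_integrable _ _ _ (limit_law k mf f0 f1) _ M) => // u; exact: boundM. Qed.

Let it x : gam.-integrable setT (EFin \o (fun u : measurableTypeR R => log_trunc psi T N%:R^-1 (u / f x))).
Proof.
apply: (@bounded_integrable _ _ _ _ _ M) => //.
by apply: (measurableT_comp (measurable_log_trunc _ _ _)); exact: measurable_funM.
Qed.

Let hE : EFin \o h = fubini_F gam (EFin \o G).
Proof.
apply/funext => x; rewrite /h /Rintegral /= fineK //.
exact: (integrable_fin_num measurableT (it x)).
Qed.

Let mh : measurable_fun setT h.
Proof.
apply/measurable_EFinP; rewrite -/(EFin \o h) hE.
by have /integrableP[] := integrable_fubini_F iG.
Qed.

Let hM x : `|h x| <= M.
Proof.
apply: le_trans (le_normr_Rintegral measurableT (it x)) _.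
apply: (@le_trans _ _ (\int[gam]_u M)).
  apply: le_Rintegral => //.
  - by have := integrable_abse (it x); apply: eq_integrable.
  - by apply: (@bounded_integrable _ _ _ _ _ `|M|).
rewrite Rintegral_cst // (_ : fine _ = 1) ?mulr1 //.
by rewrite [X in fine X](@probability_setT _ _ _ gam).
Qed.

Let int_f : leb.-integrable setT (EFin \o f).
Proof.
apply/integrableP; split; first exact/measurable_EFinP.
under eq_integral do rewrite /= ger0_norm //.
by rewrite f1 ltry.
Qed.

Let int_hf : leb.-integrable setT (EFin \o (fun x => h x * f x)).
Proof.
have := integrableZl measurableT M int_f.
apply: le_integrable => //; first by apply/measurable_EFinP; exact: measurable_funM.
by move=> x _; rewrite /= lee_fin normrM [leRHS]normrM ler_wpM2r // (le_trans (hM x)) // ler_norm.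
Qed.

Let mflf : measurable_fun setT (fun x => f x * ln (f x)).
Proof. by apply: measurable_funM => //; exact: (measurableT_comp (@measurable_ln R)). Qed.

(** Almost everywhere on the support ln f lies between ln C0 and ln Ca, so the integrand is
    dominated by a multiple of f. *)
Let int_flf : leb.-integrable setT (EFin \o (fun x => f x * ln (f x))).
Proof.
apply/integrableP; split; first exact/measurable_EFinP.
apply: (@le_lt_trans _ _ (\int[leb]_x ((`|ln Ca| + `|ln C0|) * f x)%:E)%E); last first.
  apply: (@le_lt_trans _ _ ((`|ln Ca| + `|ln C0|) * 1)%:E); last by rewrite ltry.
  by apply: integralZ_le => //; rewrite ?addr_ge0 // f1.
apply: ae_ge0_le_integral => //.
- by apply/measurable_EFinP; exact: measurableT_comp.
- by move=> x _; rewrite lee_fin mulr_ge0 // addr_ge0.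
- by apply/measurable_EFinP; exact: measurable_funM.
- apply: filterS2 fCa fC0 => x xCa xC0 _; rewrite /= lee_fin normrM (ger0_norm (f0 x)) mulrC.
  case: xC0 => [->|xC0]; first by rewrite !mulr0.
  have x0 := lt_le_trans C00 xC0.
  rewrite ler_wpM2r // ler_norml.
  have l1 : ln (f x) <= ln Ca by rewrite ler_ln ?posrE.
  have l2 : ln C0 <= ln (f x) by rewrite ler_ln ?posrE.
  have := ler_norm (ln Ca); have := ler_norm (- ln C0); rewrite normrN.
  have := normr_ge0 (ln Ca); have := normr_ge0 (ln C0).
  by move=> *; apply/andP; split; lra.
Qed.

(** Given X = x with C0 <= f(x) <= Ca, the truncated mean is -ln f(x) up to order N^(-1/2), and -ln
    f has mean [entropy f]; points where f vanishes carry no weight. *)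
Lemma limit_expectation :
  `|\int[limit_law k mf f0 f1]_u log_trunc psi T N%:R^-1 (limit_scaled f u) - entropy f|
  <= limit_bias_const * rN.
Proof.
have -> : \int[limit_law k mf f0 f1]_u log_trunc psi T N%:R^-1 (limit_scaled f u) =
    \int[leb]_x (h x * f x).
  rewrite /Rintegral -(integral_density_prob mf f0 f1 mh); congr fine.
  have := integral12_prod_meas1 iG; rewrite -hE => E.
  by apply: etrans (esym E) _.
rewrite /entropy opprK -RintegralD //.
have iD : leb.-integrable setT (EFin \o (fun x => h x * f x + f x * ln (f x))).
  by have := integrableD measurableT int_hf int_flf; apply: eq_integrable.
apply: le_trans (le_normr_Rintegral measurableT iD) _.
rewrite -lee_fin /Rintegral fineK; last first.
  by apply: integrable_fin_num => //; exact: (integrable_abse iD).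
have c0 : 0 <= limit_bias_const * rN.
  apply: mulr_ge0; last exact: powR_ge0.
  apply: addr_ge0; first by rewrite mulr_ge0 // addr_ge0 // ltW.
  apply: mulr_ge0; first by apply: divr_ge0; [exact: addr_ge0|exact: ltW].
  by apply: mulr_ge0 => //; exact: exprn_ge0.
apply: (@le_trans _ _ (\int[leb]_x (limit_bias_const * rN * f x)%:E)%E).
  apply: ae_ge0_le_integral => //.
  - apply/measurable_EFinP; apply: measurableT_comp => //; apply: measurable_funD => //.
    exact: measurable_funM.
  - by move=> x _; rewrite lee_fin mulr_ge0.
  - by apply/measurable_EFinP; exact: measurable_funM.
  - apply: filterS2 fCa fC0 => x xCa xC0 _; rewrite /= lee_fin.
    rewrite (mulrC (f x)) -mulrDl normrM (ger0_norm (f0 x)).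
    case: xC0 => [->|xC0]; first by rewrite !mulr0.
    rewrite ler_wpM2r //; exact: gamma_log_trunc_bias.
by rewrite -[X in (_ <= X%:E)%E]mulr1; apply: integralZ_le => //; rewrite f1.
Qed.

End limit_expectation.

(** * Mean squared error *)

Section mean_squared_error.
Context {R : realType} {d : nat}.
Local Notation V := 'rV[R]_d.
Local Notation leb := (lebesgue_rV R d).
Variables (k : nat) (p : \bar R) (delta : R).
Hypothesis k0 : (0 < k)%N.
Hypothesis p1 : (1 <= p)%E.
Hypothesis d0 : (0 < d)%N.
Variables (f : V -> R) (Ca C0 K : R).
Hypothesis mf : measurable_fun setT f.
Hypothesis f0 : forall x, 0 <= f x.
Hypothesis f1 : (\int[leb]_x (f x)%:E = 1)%E.
Hypothesis Ca0 : 0 < Ca.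
Hypothesis C00 : 0 < C0.
Hypothesis K0 : 0 < K.
Hypothesis fCa : {ae leb, forall x, f x <= Ca}.
Hypothesis fC0 : {ae leb, forall x, f x = 0 \/ C0 <= f x}.
Local Notation c := (unit_ball_volume d p).
Hypothesis fK : forall (r : R) (P : V -> R), 0 < r -> r <= 1 -> measurable_fun setT P ->
  (forall x, (\int[leb]_(y in [set y | (lp_norm p (y - x) <= r)%R]) (f y)%:E = (P x)%:E)%E) ->
  (\int[leb]_x (`|P x - f x * (c * r ^+ d)|)%:E <= (c * r ^+ d * (K * (r * (1 + ln r^-1))))%:E)%E.
Local Notation mu := (density_prob mf f0 f1).
Variable N : nat.
Hypothesis kN : (k < N)%N.
Variable nu : probability (N.-tuple V) R.
Hypothesis nuP : iid_law mu nu.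
Local Notation T := (c * ln N%:R `^ (1 + delta) : R).
Local Notation psi := (digamma k%:R : R).
Local Notation rad := (scale_radius (d := d) p N).
Hypothesis T1 : 1 <= T.
Hypothesis TN : ln N%:R <= C0 * T.
Hypothesis CaN : Ca <= N%:R.
Hypothesis rT1 : rad T <= 1.

Let N0 : (0 < N)%N. Proof. exact: leq_ltn_trans kN. Qed.
Let NR0 : 0 < N%:R :> R. Proof. by rewrite ltr0n. Qed.
Let NT : N%:R^-1 <= T.
Proof. by apply: le_trans T1; rewrite invf_le1 // ler1n. Qed.
Let T0 : 0 < T. Proof. exact: lt_le_trans T1. Qed.
Let l0 : 0 <= ln N%:R :> R. Proof. by rewrite ln_ge0 // ler1n. Qed.

Let a1 := Ca ^+ 2 / N%:R.
Let a2 := Ca / N%:R.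
Let L := 2 * k%:R * K * (1 + 2 * ln N%:R + `|ln c|).

Let L0 : 0 <= L.
Proof.
apply: mulr_ge0; first by rewrite mulr_ge0 ?(ltW K0) // mulr_ge0.
by rewrite addr_ge0 // addr_ge0 // mulr_ge0.
Qed.

Let a10 : 0 <= a1. Proof. by rewrite divr_ge0 // sqr_ge0. Qed.
Let a20 : 0 <= a2. Proof. by rewrite divr_ge0 // ltW. Qed.

(** The lines account for the Poisson approximation, for the ball averages of f and for the
    truncation of the limit law. In the first two, |ln T - psi| weighs the error at T and the other
    summand of the bracket comes from integrating the error against ds/s. *)
Definition bias_bound : R :=
  (`|ln T - psi| + 1) * (Ca ^+ 2 / N%:R * T ^+ 2 + Ca / N%:R * T) +
  (`|ln T - psi| + d%:R) * (2 * k%:R * K * (1 + 2 * ln N%:R + `|ln c|)) * rad T +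
  limit_bias_const k Ca C0 * N%:R `^ (- 2^-1).

Let E s := a1 * s ^+ 2 + a2 * s + L * rad s.

Let mE : measurable_fun setT E.
Proof.
apply: measurable_funD.
  by apply: measurable_funD; apply: measurable_funM => //; exact: measurable_funX.
apply: measurable_funM => //; apply: (measurableT_comp (measurable_powR _)).
exact: measurable_funM.
Qed.

Lemma trunc_term_bias i :
  `|\int[nu]_z trunc_term k p psi T z i - entropy f| <= bias_bound.
Proof.
have h1 := limit_expectation k0 mf f0 f1 Ca0 C00 fCa fC0 N0 T1 TN CaN.
have h2 : `|\int[nu]_z trunc_term k p psi T z i -
    \int[limit_law k mf f0 f1]_u log_trunc psi T N%:R^-1 (limit_scaled f u)| <=
    `|ln T - psi| * E T + (a1 * T ^+ 2 + a2 * T + L * d%:R * rad T).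
  have e0 : 0 < N%:R^-1 :> R by rewrite invr_gt0.
  apply: (log_trunc_compare _ e0 NT _ _ mE).
  - exact: measurable_knn_scaled.
  - exact: measurable_limit_scaled.
  - move=> s /andP[Ns sT]; have s0 : 0 < s by exact: lt_le_trans Ns.
    have rsT : rad s <= rad T.
      rewrite /scale_radius ge0_ler_powR ?invr_ge0 // ?nnegrE.
      + by rewrite divr_ge0 ?(ltW s0) // mulr_ge0 // ltW // unit_ball_volume_gt0.
      + by rewrite divr_ge0 ?(ltW T0) // mulr_ge0 // ltW // unit_ball_volume_gt0.
      + by rewrite ler_wpM2r // invr_ge0 mulr_ge0 // ltW // unit_ball_volume_gt0.
    apply: le_trans (cdf_diff_le k0 p1 d0 (ltW Ca0) fCa fK kN nuP i s0 (le_trans rsT rT1)) _.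
    have lr := ln_scale_radius_le p1 d0 N0 Ns.
    rewrite /E lerD //.
      rewrite le_eqVlt; apply/orP; left; apply/eqP; rewrite /a1 /a2; field.
      by rewrite gt_eqF.
    rewrite /L -!mulrA ler_wpM2l // ler_wpM2l // ler_wpM2l ?(ltW K0) //.
    by rewrite mulrC ler_wpM2r // scale_radius_ge0.
  - exact: integral_rate.
rewrite (_ : _ - _ = (\int[nu]_z trunc_term k p psi T z i -
    \int[limit_law k mf f0 f1]_u log_trunc psi T N%:R^-1 (limit_scaled f u)) +
  (\int[limit_law k mf f0 f1]_u log_trunc psi T N%:R^-1 (limit_scaled f u) - entropy f)); last by ring.
apply: le_trans (ler_normD _ _) _; apply: le_trans (lerD h2 h1) _.
rewrite /bias_bound lerD2r /E -/a1 -/a2 -/L le_eqVlt; apply/orP; left; apply/eqP; ring.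
Qed.

Let mtt i : measurable_fun setT (fun z : N.-tuple V => trunc_term k p psi T z i).
Proof.
apply: (measurableT_comp (measurable_log_trunc _ _ _)).
exact: measurable_knn_scaled.
Qed.

Lemma trunc_mean_bias :
  `|\int[nu]_z trunc_mean k p psi T z - entropy f| <= bias_bound.
Proof.
have itt i : nu.-integrable setT (EFin \o (fun z => trunc_term k p psi T z i)).
  apply: (@bounded_integrable _ _ _ _ _ (trunc_bound N psi T)) => // z.
  exact: trunc_term_bound.
have isum : nu.-integrable setT (EFin \o (fun z => \sum_(i < N) trunc_term k p psi T z i)).
  have := integrable_sum measurableT (index_enum 'I_N) (P := xpredT) (fun i _ => itt i).
  by apply: eq_integrable => // z _; rewrite /= sumEFin.
have E1 : \int[nu]_z trunc_mean k p psi T z = N%:R^-1 * \sum_(i < N) \int[nu]_z trunc_term k p psi T z i.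
  rewrite /trunc_mean RintegralZl //; congr (_ * _).
  rewrite /Rintegral.
  have -> : (\int[nu]_z (\sum_(i < N) trunc_term k p psi T z i)%:E =
      \sum_(i < N) \int[nu]_z (trunc_term k p psi T z i)%:E)%E.
    rewrite -integral_sum //; apply: eq_integral => z _; by rewrite sumEFin.
  rewrite (eq_bigr (fun i => (\int[nu]_z trunc_term k p psi T z i)%:E)) ?sumEFin // => i _.
  by rewrite /Rintegral fineK //; exact: (integrable_fin_num measurableT (itt i)).
rewrite E1 -(@mulKf _ N%:R _ (entropy f)) ?gt_eqF // -mulrBr normrM ger0_norm ?invr_ge0 // ler_pdivrMl //.
rewrite -[N in N%:R * entropy f]card_ord [_ * entropy f]mulr_natl -sumr_const -sumrB.
apply: le_trans (ler_norm_sum _ _ _) _.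
apply: (@le_trans _ _ (\sum_(i < N) bias_bound)).
  by apply: ler_sum => i _; exact: trunc_term_bias.
by rewrite sumr_const card_ord -[_ *+ N]mulr_natl.
Qed.

(** Jensen's inequality, read off the nonnegative sum of squared deviations from the mean. It
    reduces the truncation error of the average to that of single terms. *)
Lemma sqr_mean_le (a : 'I_N -> R) :
  (N%:R^-1 * \sum_(i < N) a i) ^+ 2 <= N%:R^-1 * \sum_(i < N) a i ^+ 2.
Proof.
set m := N%:R^-1 * _.
have h : 0 <= \sum_(i < N) (a i - m) ^+ 2 by apply: sumr_ge0 => i _; exact: sqr_ge0.
have e : \sum_(i < N) (a i - m) ^+ 2 = \sum_(i < N) a i ^+ 2 - N%:R * m ^+ 2.
  rewrite (eq_bigr (fun i => a i ^+ 2 - 2 * m * a i + m ^+ 2)); last by move=> i _; ring.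
  rewrite big_split /= sumrB -mulr_sumr sumr_const card_ord -[_ *+ N]mulr_natl.
  have -> : \sum_(i < N) a i = N%:R * m by rewrite /m mulVKf // gt_eqF.
  ring.
rewrite e subr_ge0 in h.
by rewrite mulrC ler_pdivlMr // mulrC.
Qed.

Lemma sqr_dist3 (x y v w : R) :
  (x - w) ^+ 2 <= 3 * ((x - y) ^+ 2 + ((y - v) ^+ 2 + (v - w) ^+ 2)).
Proof.
have := sqr_ge0 ((x - y) - (y - v)); have := sqr_ge0 ((x - y) - (v - w)).
have := sqr_ge0 ((y - v) - (v - w)); rewrite !expr2; lra.
Qed.

Let S := (Ca * T) ^+ 2 + Ca * T.

Lemma tKL_mse :
  (\int[nu]_z ((tKL k p delta (tnth z) - entropy f) ^+ 2)%:E <=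
   (3 * (Ca * sqr_exp_sum / N%:R + (6 * trunc_bound N psi T ^+ 2 * (1 + 2 * S) / N%:R +
      bias_bound ^+ 2)))%:E)%E.
Proof.
pose m := \int[nu]_z trunc_mean k p psi T z.
have mtK i : measurable_fun setT (fun z : N.-tuple V => tKL_term k p delta (tnth z) i).
  exact: measurable_tKL_term.
have mtKL : measurable_fun setT (fun z : N.-tuple V => tKL k p delta (tnth z)).
  by apply: measurable_funM => //; exact: measurable_sum.
have mtm : measurable_fun setT (@trunc_mean R d k p N psi T) by exact: measurable_trunc_mean.
pose dif (i : 'I_N) (z : N.-tuple V) := (tKL_term k p delta (tnth z) i - trunc_term k p psi T z i) ^+ 2.
have mdif i : measurable_fun setT (dif i) by apply: measurable_funX; exact: measurable_funB.
have mA : measurable_fun setT (fun z : N.-tuple V => N%:R^-1 * \sum_(i < N) dif i z).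
  by apply: measurable_funM => //; exact: measurable_sum.
have mB : measurable_fun setT (fun z : N.-tuple V => (trunc_mean k p psi T z - m) ^+ 2).
  by apply: measurable_funX; exact: measurable_funB.
have s0 (z : N.-tuple V) : 0 <= \sum_(i < N) dif i z by apply: sumr_ge0 => i _; exact: sqr_ge0.
apply: (@le_trans _ _ (\int[nu]_z (3 * (N%:R^-1 * \sum_(i < N) dif i z +
   ((trunc_mean k p psi T z - m) ^+ 2 + bias_bound ^+ 2)))%:E)%E).
  apply: ge0_le_integral => //.
  - by move=> z _; rewrite lee_fin sqr_ge0.
  - by apply/measurable_EFinP; apply: measurable_funX; exact: measurable_funB.
  - apply/measurable_EFinP; apply: measurable_funM => //; apply: measurable_funD => //.
    exact: measurable_funD.
  - move=> z _; rewrite lee_fin.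
    have hA : (tKL k p delta (tnth z) - trunc_mean k p psi T z) ^+ 2 <= N%:R^-1 * \sum_(i < N) dif i z.
      by rewrite /tKL /trunc_mean -mulrBr -sumrB; exact: sqr_mean_le.
    have hB : (m - entropy f) ^+ 2 <= bias_bound ^+ 2.
      have b0 := le_trans (normr_ge0 _) trunc_mean_bias.
      by rewrite -real_normK ?num_real // ler_pXn2r ?nnegrE // trunc_mean_bias.
    apply: (@le_trans _ _ (3 * ((tKL k p delta (tnth z) - trunc_mean k p psi T z) ^+ 2 +
       ((trunc_mean k p psi T z - m) ^+ 2 + (m - entropy f) ^+ 2)))); last first.
      by apply: ler_wpM2l => //; apply: lerD => //; apply: lerD.
    exact: sqr_dist3.
apply: integralZ_le => //.
- by apply: measurable_funD => //; exact: measurable_funD.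
- by move=> z; rewrite addr_ge0 ?mulr_ge0 ?invr_ge0 // addr_ge0 ?sqr_ge0.
apply: integralD_le => //.
- exact: measurable_funD.
- by move=> z; rewrite mulr_ge0 ?invr_ge0.
- by move=> z; rewrite addr_ge0 ?sqr_ge0.
- rewrite (_ : Ca * sqr_exp_sum / N%:R = N%:R^-1 * (N%:R * (Ca * sqr_exp_sum / N%:R))); last first.
    by rewrite mulKf // gt_eqF.
  apply: integralZ_le => //; first exact: measurable_sum.
  under eq_integral do rewrite -sumEFin.
  rewrite ge0_integral_sum //; last 2 first.
  + by move=> i; exact/measurable_EFinP.
  + by move=> i z _; rewrite lee_fin sqr_ge0.
  apply: (@le_trans _ _ (\sum_(i < N) (Ca * sqr_exp_sum / N%:R)%:E)%E).
    by apply: lee_sum => i _; exact: (term_error k0 p1 d0 kN NT (ltW Ca0) fCa nuP i).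
  by rewrite sumEFin sumr_const card_ord -[_ *+ N]mulr_natl.
apply: integralD_le => //.
- by move=> z; rewrite sqr_ge0.
- by move=> z; rewrite sqr_ge0.
- exact: (trunc_mean_variance k0 p1 d0 kN psi NT (ltW Ca0) fCa nuP).
- by rewrite integral_cst // [X in (_ * X)%E](@probability_setT _ _ _ nu) mule1.
Qed.

End mean_squared_error.

(** * Comparison with the stated rate *)

Section rate.
Context {R : realType} {d : nat}.
Variables (k : nat) (p : \bar R) (delta Ca C0 K : R).
Hypothesis k0 : (0 < k)%N.
Hypothesis p1 : (1 <= p)%E.
Hypothesis d0 : (0 < d)%N.
Hypothesis delta0 : 0 < delta.
Hypothesis Ca0 : 0 < Ca.
Hypothesis C00 : 0 < C0.
Hypothesis K0 : 0 < K.
Local Notation c := (unit_ball_volume d p).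
Local Notation psi := (digamma k%:R : R).

Let c0 : 0 < c. Proof. exact: unit_ball_volume_gt0. Qed.

(** With x = (ln N)^(1+delta), w = ln ln N and a the truncation radius: [m1] x bounds the size of a
    term, [s1] x^2 the neighbour counts in the variance, and [m2] w the factor |ln T - psi|. The
    coefficients [b1], [b2], [b3] multiply w x^2 / N, x a and N^(-1/2) in the bias. *)
Let s1 := 1 + 2 * ((Ca * c) ^+ 2 + Ca * c).
Let m1 := `|psi| + (`|ln c| + (1 + delta)) + 1.
Let m2 := `|ln c| + (1 + delta) + `|psi|.
Let b1 := (m2 + 1) * ((Ca * c) ^+ 2 + Ca * c).
Let b2 := (m2 + d%:R) * (2 * k%:R * K * (3 + `|ln c|)) / delta.
Let b3 := limit_bias_const k Ca C0.

Definition rate_const : R :=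
  3 * (Ca * sqr_exp_sum + (6 * m1 ^+ 2 * s1 + 3 * (b1 ^+ 2 + b2 ^+ 2 + b3 ^+ 2))).

Variable N : nat.
Hypothesis N0 : (0 < N)%N.
Local Notation l := (ln N%:R : R).
Hypothesis l_ge : expR 1 <= l.
Let x : R := l `^ (1 + delta).
Let w : R := ln l.
Local Notation T := (c * ln N%:R `^ (1 + delta) : R).
Local Notation rad := (scale_radius (d := d) p N).
Let a := rad T.

Let NR0 : 0 < N%:R :> R. Proof. by rewrite ltr0n. Qed.
Let l1 : 1 <= l. Proof. by apply: le_trans l_ge; rewrite -[leLHS]expR0 ler_expR. Qed.
Let l0 : 0 < l. Proof. exact: lt_le_trans l1. Qed.

Let w1 : 1 <= w.
Proof. by rewrite /w -[leLHS]expRK ler_ln ?posrE ?expR_gt0. Qed.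

Let lx : l <= x.
Proof.
rewrite -[leLHS]powRr1 ?(ltW l0) // ler_powR // lerDl; exact: ltW.
Qed.

Let x1 : 1 <= x. Proof. exact: le_trans lx. Qed.
Let x0 : 0 < x. Proof. exact: lt_le_trans x1. Qed.
Let wl : w <= l. Proof. by apply: ltW; exact: ln_sublinear. Qed.

(** The positivity of delta is spent here: ln ln N <= (ln N)^delta / delta, so the factor ln N ln ln
    N of the ball-average bias fits in (ln N)^(1+delta). *)
Let wlx : w * l <= x / delta.
Proof.
have h : delta * w <= l `^ delta.
  by rewrite -ln_powR; apply: ltW; apply: ln_sublinear; exact: powR_gt0.
have xE : x = l * l `^ delta.
  rewrite /x powRD ?powRr1 ?(ltW l0) //.
  by rewrite (gt_eqF l0) implybT.
by rewrite ler_pdivlMr // mulrC mulrA xE mulrC ler_wpM2l // ltW.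
Qed.

Let a0 : 0 <= a. Proof. exact: scale_radius_ge0. Qed.

Let rate1E : (x * a) ^+ 2 = l `^ ((1 + delta) * (2 + 2 / d%:R)) / N%:R `^ (2 / d%:R).
Proof.
have Tx : T / (N%:R * c) = x / N%:R by rewrite -/x; field; rewrite !gt_eqF.
have aE : a ^+ 2 = x `^ (2 / d%:R) / N%:R `^ (2 / d%:R).
  rewrite /a /scale_radius Tx -powR_mulrn ?powR_ge0 // -powRrM [d%:R^-1 * _]mulrC.
  rewrite powRM ?invr_ge0 ?(ltW x0) //; congr (_ * _).
  by rewrite -powRN -powR_inv1 ?(ltW NR0) // -powRrM mulN1r.
rewrite exprMn aE mulrA; congr (_ / _).
rewrite powRrM -/x powRD ?powR_mulrn ?(ltW x0) //.
by rewrite (gt_eqF x0) implybT.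
Qed.

Let Q : R := w ^+ 2 * x ^+ 4 / N%:R.

(** As k >= 1 and x >= 1, the power x^4 is at most x^(2k+2). The fourth power comes from the
    variance: squared size of a term times second moment of the neighbour counts. *)
Let rate_ge : (x * a) ^+ 2 + Q <= tKL_rate d k delta N.
Proof.
rewrite rate1E /tKL_rate lerD2l /Q ler_wpM2r ?invr_ge0 // ler_wpM2l ?sqr_ge0 //.
rewrite mulrC powRrM -/x powR_mulrn ?(ltW x0) // ler_weXn2l //.
by apply: (@leq_add 2 2 (2 * k) 2) => //; rewrite leq_pmulr.
Qed.

Let x4N : x ^+ 4 / N%:R <= Q.
Proof.
rewrite /Q ler_wpM2r ?invr_ge0 // ler_peMl ?exprn_ge0 ?(ltW x0) //.
exact: exprn_ege1.
Qed.

Let oneN : N%:R^-1 <= Q.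
Proof.
apply: le_trans x4N; rewrite ler_peMl ?invr_ge0 //; exact: exprn_ege1.
Qed.

Let lnT : `|ln T| <= (`|ln c| + (1 + delta)) * w.
Proof.
have w0 : 0 <= w by apply: le_trans w1.
rewrite lnM ?posrE // ln_powR -/w; apply: le_trans (ler_normD _ _) _.
rewrite [leRHS]mulrDl; apply: lerD; first by rewrite ler_peMr.
by rewrite ger0_norm // mulr_ge0 // addr_ge0 // ltW.
Qed.

Let tb_le : trunc_bound N psi T <= m1 * x.
Proof.
have wx : w <= x by exact: le_trans wl lx.
rewrite /trunc_bound /m1 [leRHS]mulrDl [X in _ <= X + _]mulrDl mul1r lerD // lerD ?ler_peMr //.
by apply: le_trans lnT _; rewrite ler_wpM2l // addr_ge0 // addr_ge0 // ltW.
Qed.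

Let S_le : 1 + 2 * ((Ca * T) ^+ 2 + Ca * T) <= s1 * x ^+ 2.
Proof.
have xx : x <= x ^+ 2 by rewrite expr2 ler_peMr // ltW.
have x21 : 1 <= x ^+ 2 by exact: le_trans x1 xx.
have cc : 0 <= Ca * c by rewrite mulr_ge0 // ltW.
have := ler_wpM2l cc xx.
rewrite /s1 -/x !exprMn; lra.
Qed.

Let T0 : 0 <= T. Proof. exact: (mulr_ge0 (ltW c0) (ltW x0)). Qed.
Let CT0 : 0 <= Ca * T. Proof. exact: mulr_ge0 (ltW Ca0) T0. Qed.
Let Cc0 : 0 <= Ca * c. Proof. exact: mulr_ge0 (ltW Ca0) (ltW c0). Qed.
Let s10 : 0 <= s1.
Proof.
by apply: addr_ge0 => //; apply: mulr_ge0 => //; apply: addr_ge0; [exact: sqr_ge0|exact: Cc0].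
Qed.

Let var_le : 6 * trunc_bound N psi T ^+ 2 * (1 + 2 * ((Ca * T) ^+ 2 + Ca * T)) / N%:R <=
  6 * m1 ^+ 2 * s1 * Q.
Proof.
have tb0 : 0 <= trunc_bound N psi T.
  by apply: addr_ge0; [exact: addr_ge0|exact: ltW].
have S0 : 0 <= 1 + 2 * ((Ca * T) ^+ 2 + Ca * T).
  by apply: addr_ge0 => //; apply: mulr_ge0 => //; apply: addr_ge0; [exact: sqr_ge0|exact: CT0].
have tb2 : trunc_bound N psi T ^+ 2 <= (m1 * x) ^+ 2.
  by rewrite ler_pXn2r ?nnegrE // (le_trans tb0).
have h := ler_pM (sqr_ge0 _) S0 tb2 S_le.
have h2 : m1 ^+ 2 * s1 * (x ^+ 4 / N%:R) <= m1 ^+ 2 * s1 * Q.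
  by rewrite ler_wpM2l // mulr_ge0 ?sqr_ge0.
have i0 : 0 <= N%:R^-1 :> R by rewrite invr_ge0.
have h3 := ler_wpM2r i0 h.
have e : (m1 * x) ^+ 2 * (s1 * x ^+ 2) / N%:R = m1 ^+ 2 * s1 * (x ^+ 4 / N%:R) by ring.
rewrite e in h3; lra.
Qed.

Let m20 : 0 <= m2. Proof. by rewrite !addr_ge0 // ltW. Qed.

Let bias_le : bias_bound (d := d) k p delta Ca C0 K N <=
  b1 * (w * x ^+ 2 / N%:R) + b2 * (x * a) + b3 * N%:R `^ (- 2^-1).
Proof.
have w0 : 0 <= w by apply: le_trans w1.
have lp : `|ln T - psi| <= m2 * w.
  apply: le_trans (ler_normB _ _) _; rewrite /m2 mulrDl lerD //.
  by rewrite ler_peMr.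
rewrite /bias_bound lerD2r; apply: lerD.
  have e1 : Ca ^+ 2 / N%:R * T ^+ 2 + Ca / N%:R * T <= ((Ca * c) ^+ 2 + Ca * c) * (x ^+ 2 / N%:R).
    have xx : x <= x ^+ 2 by rewrite expr2 ler_peMr // ltW.
    have cc : 0 <= Ca * c / N%:R by exact: divr_ge0.
    by have := ler_wpM2l cc xx; rewrite -/x; lra.
  have e0 : 0 <= Ca ^+ 2 / N%:R * T ^+ 2 + Ca / N%:R * T.
    apply: addr_ge0; apply: mulr_ge0; rewrite ?divr_ge0 ?sqr_ge0 ?(ltW Ca0) //.
  have e2 : `|ln T - psi| + 1 <= (m2 + 1) * w by rewrite mulrDl mul1r lerD.
  have e3 : 0 <= `|ln T - psi| + 1 by rewrite addr_ge0.
  apply: le_trans (ler_pM e3 e0 e2 e1) _.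
  by rewrite /b1 le_eqVlt; apply/orP; left; apply/eqP; ring.
rewrite [leRHS]mulrA -[rad _]/a; apply: ler_wpM2r => //.
have e2 : `|ln T - psi| + d%:R <= (m2 + d%:R) * w by rewrite mulrDl lerD // ler_peMr.
have kK : 0 <= 2 * k%:R * K by rewrite mulr_ge0 ?(ltW K0) // mulr_ge0.
have e4 : 1 + 2 * l + `|ln c| <= (3 + `|ln c|) * l.
  rewrite [leRHS]mulrDl; apply: lerD; last by rewrite ler_peMr.
  by rewrite (_ : 3 = 1 + 2) ?[leRHS]mulrDl ?mul1r ?lerD //; ring.
have e5 : 2 * k%:R * K * (1 + 2 * l + `|ln c|) <= 2 * k%:R * K * ((3 + `|ln c|) * l).
  by rewrite ler_wpM2l.
have e6 : 0 <= 2 * k%:R * K * (1 + 2 * l + `|ln c|).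
  by rewrite mulr_ge0 // addr_ge0 // addr_ge0 // mulr_ge0 // ltW.
have e7 : 0 <= `|ln T - psi| + d%:R by rewrite addr_ge0.
apply: le_trans (ler_pM e7 e6 e2 e5) _.
have e8 : 0 <= (m2 + d%:R) * (2 * k%:R * K * (3 + `|ln c|)).
  by apply: mulr_ge0; [exact: addr_ge0|apply: mulr_ge0 => //; exact: addr_ge0].
have := ler_wpM2l e8 wlx.
by rewrite /b2; lra.
Qed.

Let bias_sqr_le : bias_bound (d := d) k p delta Ca C0 K N ^+ 2 <=
  3 * (b1 ^+ 2 + b2 ^+ 2 + b3 ^+ 2) * ((x * a) ^+ 2 + Q).
Proof.
have w0 : 0 <= w by apply: le_trans w1.
have bb0 : 0 <= bias_bound (d := d) k p delta Ca C0 K N.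
  have kK : 0 <= 2 * k%:R * K by rewrite mulr_ge0 ?(ltW K0) // mulr_ge0.
  have lb0 : 0 <= limit_bias_const k Ca C0.
    apply: addr_ge0; first by rewrite mulr_ge0 // addr_ge0 // ltW.
    apply: mulr_ge0; first by apply: divr_ge0; [exact: addr_ge0|exact: ltW].
    by apply: mulr_ge0 => //; exact: exprn_ge0.
  apply: addr_ge0; last by apply: mulr_ge0 => //; exact: powR_ge0.
  have e1 : 0 <= Ca ^+ 2 / N%:R * T ^+ 2 + Ca / N%:R * T.
    by apply: addr_ge0; apply: mulr_ge0; rewrite ?divr_ge0 ?sqr_ge0 ?(ltW Ca0).
  have e2 : 0 <= 1 + 2 * l + `|ln c|.
    by rewrite addr_ge0 // addr_ge0 // mulr_ge0 // ltW.
  apply: addr_ge0; first by apply: mulr_ge0 => //; exact: addr_ge0.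
  apply: mulr_ge0; last exact: scale_radius_ge0.
  by apply: mulr_ge0; [exact: addr_ge0|exact: mulr_ge0].
have N2 : (N%:R `^ (- 2^-1)) ^+ 2 = N%:R^-1 :> R.
  rewrite -powR_mulrn ?powR_ge0 // -powRrM -[RHS](powR_inv1 (ltW NR0)).
  by apply: (f_equal (powR N%:R)); field.
have wQ : (w * x ^+ 2 / N%:R) ^+ 2 <= Q.
  have -> : (w * x ^+ 2 / N%:R) ^+ 2 = Q * N%:R^-1 by rewrite /Q; field; rewrite gt_eqF.
  rewrite ler_piMr ?invf_le1 ?ler1n //.
  by rewrite /Q mulr_ge0 ?invr_ge0 // mulr_ge0 ?sqr_ge0 // exprn_ge0 // ltW.
have Q0 : 0 <= Q by apply: le_trans oneN; rewrite invr_ge0.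
move: bias_le; set u := w * x ^+ 2 / N%:R in wQ *; set v := x * a; set t := N%:R `^ _ in N2 *.
move=> h; apply: (@le_trans _ _ ((b1 * u + b2 * v + b3 * t) ^+ 2)).
  by rewrite ler_pXn2r ?nnegrE // (le_trans bb0).
apply: (@le_trans _ _ (3 * (b1 ^+ 2 * u ^+ 2 + b2 ^+ 2 * v ^+ 2 + b3 ^+ 2 * t ^+ 2))).
  have := sqr_ge0 (b1 * u - b2 * v); have := sqr_ge0 (b1 * u - b3 * t).
  have := sqr_ge0 (b2 * v - b3 * t); rewrite !expr2; lra.
rewrite -mulrA ler_wpM2l // !mulrDl lerD //.
  apply: lerD; apply: ler_wpM2l; rewrite ?sqr_ge0 //; last by rewrite lerDl.
  by apply: le_trans wQ _; rewrite lerDr sqr_ge0.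
by rewrite ler_wpM2l ?sqr_ge0 // N2; apply: le_trans oneN _; rewrite lerDr sqr_ge0.
Qed.

Lemma mse_rate_le :
  3 * (Ca * sqr_exp_sum / N%:R + (6 * trunc_bound N psi T ^+ 2 * (1 + 2 * ((Ca * T) ^+ 2 + Ca * T)) / N%:R +
      bias_bound (d := d) k p delta Ca C0 K N ^+ 2)) <= rate_const * tKL_rate d k delta N.
Proof.
have se0 := ltW (sqr_exp_sum_gt0 (R := R)).
have B0 : 0 <= b1 ^+ 2 + b2 ^+ 2 + b3 ^+ 2 by rewrite !addr_ge0 ?sqr_ge0.
have r0 : 0 <= rate_const.
  apply: mulr_ge0 => //; apply: addr_ge0; first by rewrite mulr_ge0 // ltW.
  by apply: addr_ge0; [rewrite mulr_ge0 // mulr_ge0 // sqr_ge0|exact: mulr_ge0].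
apply: le_trans (ler_wpM2l r0 rate_ge).
have Q0 : 0 <= Q by apply: le_trans oneN; rewrite invr_ge0.
have v0 : 0 <= (x * a) ^+ 2 by exact: sqr_ge0.
have h1 : Ca * sqr_exp_sum / N%:R <= Ca * sqr_exp_sum * ((x * a) ^+ 2 + Q).
  rewrite ler_wpM2l //; first by rewrite mulr_ge0 // ltW.
  by apply: le_trans oneN _; rewrite lerDr.
have h2 : 6 * m1 ^+ 2 * s1 * Q <= 6 * m1 ^+ 2 * s1 * ((x * a) ^+ 2 + Q).
  by rewrite ler_wpM2l ?lerDr // mulr_ge0 // mulr_ge0 // sqr_ge0.
rewrite /rate_const -[leRHS]mulrA ler_wpM2l // [leRHS]mulrDl; apply: lerD => //.
rewrite [leRHS]mulrDl; apply: lerD => //.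
exact: le_trans var_le h2.
Qed.

End rate.

(** * From the random variables to the law of the sample *)

Section transfer.
Context {R : realType} {d N : nat}.
Local Notation V := 'rV[R]_d.
Context d0 (W : measurableType d0) (P : probability W R) (X : 'I_N -> {RV P >-> V}).

Definition sample_tuple (w : W) : N.-tuple V := [tuple X i w | i < N].

Lemma measurable_sample_tuple : measurable_fun setT sample_tuple.
Proof.
apply/measurable_fun_tnthP => i.
rewrite (_ : _ \o _ = X i); first exact: measurable_funPT.
by apply/funext => w; rewrite /= tnth_mktuple.
Qed.

HB.instance Definition _ := isMeasurableFun.Build _ _ _ _ sample_tuple measurable_sample_tuple.

Definition sample_law : probability (N.-tuple V) R := distribution P sample_tuple.

Variable f : V -> R.
Hypothesis mf : measurable_fun setT f.
Hypothesis f0 : forall x, 0 <= f x.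
Hypothesis f1 : (\int[lebesgue_rV R d]_x (f x)%:E = 1)%E.

Lemma iid_sample_law : iid_sample X f -> iid_law (density_prob mf f0 f1) sample_law.
Proof.
move=> [indep law] A C mA CA.
transitivity (P (\bigcap_(i in [set i | i \in [set: 'I_N]%SET]) (X i @^-1` A i))).
  congr (P _); apply/seteqP; split => w /=.
    by move=> /CA h i _ /=; have := h i; rewrite tnth_mktuple.
  by move=> h; apply/CA => i; rewrite tnth_mktuple; apply: (h i); rewrite /= inE.
apply: etrans (indep [set: 'I_N]%SET A mA) _; apply: eq_big => [i|i _]; first by rewrite inE.
by rewrite -[LHS]/(distribution P (X i) (A i)) law // density_probE.
Qed.

Lemma expectation_sample (F : N.-tuple V -> R) : measurable_fun setT F ->
  (forall z, 0 <= F z) ->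
  ('E_P[fun w => F (sample_tuple w)] = \int[sample_law]_z (F z)%:E)%E.
Proof.
move=> mF F0; rewrite unlock; apply/esym.
apply: (ge0_integral_distribution sample_tuple (f := EFin \o F)) => //.
exact/measurable_EFinP.
Qed.

End transfer.

(** * Conditions on large N and conclusion *)

Section large_N.
Context {R : realType}.

Lemma near_ln_ge (A : R) : \forall N \near \oo, A <= ln (N%:R : R).
Proof.
near=> N; rewrite -[leLHS]expRK ler_ln ?posrE ?expR_gt0 //.
  near: N; exact: nbhs_infty_ger.
by rewrite ltr0n; near: N; exact: nbhs_infty_gt.
Unshelve. all: by end_near. Qed.

(** With l = ln N and q = l^(1/2), sublinearity gives s ln l = 2 s ln q <= 2 s q <= q^2 = l. This
    brings the truncation radius below 1, the range of the ball-average bound. *)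
Lemma powR_ln_le (s : R) (N : nat) : 0 < s -> (0 < N)%N -> 1 <= ln N%:R :> R ->
  (2 * s) ^+ 2 <= ln N%:R -> ln N%:R `^ s <= N%:R :> R.
Proof.
move=> s0 N0 l1 ls; have l0 : 0 < ln N%:R :> R by exact: lt_le_trans l1.
have NR0 : 0 < N%:R :> R by rewrite ltr0n.
rewrite -ler_ln ?posrE ?powR_gt0 // ln_powR.
set l := ln N%:R in l1 ls l0 *.
pose q := l `^ 2^-1.
have q0 : 0 < q by rewrite powR_gt0.
have qq : q ^+ 2 = l.
  by rewrite -powR_mulrn ?powR_ge0 // -powRrM mulVf // powRr1 // ltW.
have lq : ln l = 2 * ln q by rewrite ln_powR mulrA mulfV // mul1r.
have sq : 2 * s <= q by rewrite -(ler_pXn2r (n := 2)) ?nnegrE ?qq ?(ltW q0) // mulr_ge0 // ltW.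
apply: (@le_trans _ _ (s * (2 * q))).
  by rewrite lq ler_wpM2l ?(ltW s0) // ler_wpM2l // ltW // ln_sublinear.
by rewrite -[leRHS]qq expr2 mulrA ler_wpM2r ?(ltW q0) // mulrC.
Qed.

End large_N.

Theorem corollary1 (R : realType) (d k : nat) (hd : (1 <= d)%N) (hk : (1 <= k)%N)
    (p : \bar R) (hp : (1 <= p)%E) (delta : R) (hdelta : 0 < delta)
    (f : 'rV[R]_d -> R) (hf : is_density f) (hA : assumption_A f) :
  exists C : R, \forall N \near \oo,
    forall (d0 : measure_display) (T : measurableType d0) (P : probability T R)
      (X : 'I_N -> {RV P >-> 'rV[R]_d}),
      iid_sample X f ->
      ('E_P[fun w => ((tKL k p delta (fun i => X i w) - entropy f) ^+ 2)%R]
         <= (C * tKL_rate d k delta N)%:E)%E.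
Proof.
have [mf f0 f1] := hf.
have [Ca [C0 [K [[Ca0 C00 K0] [fCa fC0 fK]]]]] := assumption_A_consequences hd hp hf hA.
have c0 := unit_ball_volume_gt0 hp hd.
set c := unit_ball_volume d p in c0 *.
exists (rate_const (d := d) k p delta Ca C0 K); near=> N => d0 W P X iidX.
have N0 : (0 < N)%N by near: N; exact: nbhs_infty_gt.
have kN : (k < N)%N by near: N; exact: nbhs_infty_gt.
have CaN : Ca <= N%:R by near: N; exact: nbhs_infty_ger.
have le1 : expR 1 <= ln (N%:R : R) by near: N; exact: near_ln_ge.
(* The next three lower bounds on ln N yield, in this order, 1 <= T, ln N <= C0 T and a truncation
   radius at most 1; the preceding one makes ln ln N at least 1. *)
have lec : c^-1 <= ln (N%:R : R) by near: N; exact: near_ln_ge.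
have leC0 : ((C0 * c)^-1) `^ delta^-1 <= ln (N%:R : R) by near: N; exact: near_ln_ge.
have led : (2 * (1 + delta)) ^+ 2 <= ln (N%:R : R) by near: N; exact: near_ln_ge.
have NR0 : 0 < N%:R :> R by rewrite ltr0n.
set l := ln (N%:R : R) in le1 lec leC0 led.
have l1 : 1 <= l by apply: le_trans le1; rewrite -[leLHS]expR0 ler_expR.
have l0 : 0 < l by exact: lt_le_trans l1.
have lx : l <= l `^ (1 + delta).
  by rewrite -[leLHS]powRr1 ?(ltW l0) // ler_powR // lerDl; exact: ltW.
have T1 : 1 <= c * l `^ (1 + delta).
  by rewrite -ler_pdivrMl // mulr1 (le_trans lec).
have TN : l <= C0 * (c * l `^ (1 + delta)).
  have xE : l `^ (1 + delta) = l * l `^ delta.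
    by rewrite powRD ?powRr1 ?(ltW l0) // (gt_eqF l0) implybT.
  rewrite xE mulrA mulrCA ler_peMr ?(ltW l0) // -ler_pdivrMl ?mulr_gt0 // mulr1.
  have := ge0_ler_powR (ltW hdelta) _ _ leC0; rewrite !nnegrE powR_ge0 (ltW l0) => /(_ isT isT).
  by rewrite -powRrM mulVf ?gt_eqF // powRr1 // invr_ge0 mulr_ge0 // ltW.
have rT1 : scale_radius (d := d) p N (c * l `^ (1 + delta)) <= 1.
  rewrite /scale_radius -/c.
  have -> : c * l `^ (1 + delta) / (N%:R * c) = l `^ (1 + delta) / N%:R.
    by field; rewrite !gt_eqF.
  have i0 : 0 <= d%:R^-1 :> R by rewrite invr_ge0.
  have h : l `^ (1 + delta) / N%:R <= 1.
    by rewrite ler_pdivrMr // mul1r powR_ln_le // addr_gt0.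
  have := ge0_ler_powR i0 _ _ h; rewrite !nnegrE divr_ge0 ?powR_ge0 // ler01 => /(_ isT isT).
  by rewrite powR1.
have nuP := iid_sample_law mf f0 f1 iidX.
have mTKL : measurable_fun setT (fun z : N.-tuple 'rV[R]_d => (tKL k p delta (tnth z) - entropy f) ^+ 2).
  apply: measurable_funX; apply: measurable_funB => //.
  by apply: measurable_funM => //; apply: measurable_sum => i; exact: measurable_tKL_term.
rewrite (_ : (fun w => _) = fun w => (tKL k p delta (tnth (sample_tuple X w)) - entropy f) ^+ 2); last first.
  apply/funext => w; congr ((tKL _ _ _ _ - _) ^+ 2); apply/funext => i.
  by rewrite tnth_mktuple.
rewrite (expectation_sample X mTKL) //; last by move=> z; exact: sqr_ge0.
apply: le_trans (tKL_mse hk hp hd Ca0 C00 K0 fCa fC0 fK kN nuP T1 TN CaN rT1) _.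
by rewrite lee_fin; exact: mse_rate_le.
Unshelve. all: by end_near. Qed.
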